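(* Let $t\in(0,1)$ and let $\lambda(\tau)$, $\tau\ge0$, be the stochastic process on the set $\mathbb{Y}$ of integer partitions distributed as an ascending Hall-Littlewood process with one specialization $1,t,t^2,\ldots$ and the other Plancherel, i.e. with finite-dimensional marginals $$\Pr\left(\lambda(\tau_i)=\lambda^{(i)}\text{ for all }i=1,\ldots,k\right)=\frac{\left(\prod_{j=1}^kQ_{\lambda^{(j)}/\lambda^{(j-1)}}(\gamma(\tau_j-\tau_{j-1});t)\right)P_{\lambda^{(k)}}(1,t,t^2,\ldots;t)}{\exp\left(\frac{\tau_k}{1-t}\right)}$$ for all $0\le\tau_1\le\cdots\le\tau_k$ and $\lambda^{(1)},\ldots,\lambda^{(k)}\in\mathbb{Y}$, with the conventions $\tau_0=0$ and $\lambda^{(0)}=\emptyset$ (the zero partition). Let $\mathbf{x}_t(\tau)=(x_1(\tau),x_2(\tau),\ldots)$ be slowed $t$-TASEP with parameter $t$ and packed initial condition. Then $$\mathbf{x}_t(\tau)=\left(\lambda_k'((1-t)\tau)-k\right)_{k\ge1}$$ in multi-time distribution (i.e. as processes in $\tau\geq 0$, in the sense of equality of finite-dimensional distributions).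
   Context: Slowed $t$-TASEP with parameter $t\in(0,1)$ is the continuous-time Markov jump process on particle configurations $x_1>x_2>\cdots$ in $\mathbb{Z}$ in which, when the current configuration is $(x_1,x_2,\ldots)$, the $k$-th particle jumps one unit to the right at rate $t^{x_k+k}\left(1-t^{x_{k-1}-x_k-1}\right)$, $k\ge1$, independently, with $x_0:=\infty$. Packed initial condition means $x_k(0)=-k$ for all $k\ge1$. $\mathbb{Y}$ is the set of integer partitions $\lambda=(\lambda_1\ge\lambda_2\ge\cdots\ge0)$, eventually zero; $\lambda_i'=\#\{j:\lambda_j\ge i\}$; $m_i(\lambda)=\#\{j:\lambda_j=i\}$; $(t;t)_m=\prod_{i=1}^m(1-t^i)$. The Hall-Littlewood polynomial of a partition $\lambda$ with at most $n$ nonzero parts is $$P_\lambda(x_1,\ldots,x_n;t)=\frac1{v_\lambda(t)}\sum_{\sigma\in S_n}\sigma\left(x_1^{\lambda_1}\cdots x_n^{\lambda_n}\prod_{1\le i<j\le n}\frac{x_i-tx_j}{x_i-x_j}\right),\qquad v_\lambda(t)=\prod_{i\ge0}\frac{(t;t)_{m_i(\lambda)}}{(1-t)^{m_i(\lambda)}},$$ where $\sigma$ permutes the variables and $m_0(\lambda)$ is $n$ minus the number of nonzero parts of $\lambda$. These are consistent under setting $x_{n+1}=0$, so define elements $P_\lambda$ of the ring of symmetric functions $\Lambda=\mathbb{C}[p_1,p_2,\ldots]$ ($p_k$ the power sums). Set $Q_\lambda=\prod_{i>0}(t;t)_{m_i(\lambda)}\,P_\lambda$, and define the skew functions $Q_{\lambda/\mu}\in\Lambda$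 by $Q_\lambda(\mathbf{x},\mathbf{y})=\sum_{\mu\in\mathbb{Y}}Q_{\lambda/\mu}(\mathbf{x})Q_\mu(\mathbf{y})$. $P_\lambda(1,t,t^2,\ldots;t)$ is the image of $P_\lambda$ under the substitution $x_i=t^{i-1}$, i.e. under the homomorphism $p_k\mapsto\frac1{1-t^k}$. For $\tau\ge0$, $Q_{\lambda/\mu}(\gamma(\tau);t)$ is the image of $Q_{\lambda/\mu}$ under the Plancherel specialization, the homomorphism $\Lambda\to\mathbb{C}$ with $p_1\mapsto\frac{\tau}{1-t}$ and $p_k\mapsto0$ for $k\ge2$. *)

(* Defs.v *)
From HB Require Import structures.
From mathcomp Require Import all_boot all_order all_algebra all_fingroup.
From mathcomp Require Import finmap complex.
(* The notations of multinomials clash with those of mathcomp-analysis. *)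
From mathcomp Require Import -(notations) mpoly monalg.
From mathcomp Require Import all_classical all_reals all_analysis.

Set Implicit Arguments.
Unset Strict Implicit.
Unset Printing Implicit Defensive.

Import Order.TTheory GRing.Theory Num.Theory.
Import numFieldNormedType.Exports.

Local Open Scope classical_set_scope.
Local Open Scope ring_scope.

(** * Integer partitions *)

(* Only the nonzero parts are stored: [size la] is the length of [la], and
   [nth 0%N la i] is its (i+1)-st part. *)
Record intpart := IntPart {
  parts :> seq nat;
  partsP : sorted geq parts && (0%N \notin parts) }.

HB.instance Definition _ := [isSub for parts].
HB.instance Definition _ := [Choice of intpart by <:].

Definition empty_partition : intpart := @IntPart [::] isT.

(* The formula is meant for i >= 1 only. *)
Definition conj_part (la : intpart) (i : nat) : nat :=
  count (fun p => i <= p)%N la.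

Definition part_mult (la : intpart) (i : nat) : nat := count_mem i la.

(* Multiplicities of [la] padded with zeros to a sequence of length n. *)
Definition padded_mult (n : nat) (la : intpart) (i : nat) : nat :=
  if i == 0%N then (n - size la)%N else part_mult la i.

(** * Symmetric functions *)

(* Polynomials over K in the free variables p_1, p_2, ...; the variable of
   index i : nat stands for the power sum p_{i+1}. *)
Definition symfun (K : fieldType) := malg (cmonom nat) K.

(* The K-algebra homomorphism sending p_{i+1} to [c i]. *)
Definition symfun_hom (K : fieldType) (A : comAlgType K) (c : nat -> A)
    (f : symfun K) : A :=
  monalg.mmap (in_alg A)
    (fun m : cmonom nat => \prod_(i <- finsupp m) c i ^+ m i) f.

Definition specialize (K : fieldType) (c : nat -> K) (f : symfun K) : K :=
  @symfun_hom K K^o c f.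

(* The ring Lambda (x) Lambda = K[p_i(x), p_i(y)] of symmetric functions in two
   alphabets: [inl i] is p_{i+1}(x), and [inr i] is p_{i+1}(y). *)
Definition symfun2 (K : fieldType) := malg (cmonom (nat + nat)%type) K.

Definition psum2 (K : fieldType) (i : nat + nat) : symfun2 K :=
  mkmalgU (ucm i) 1.

Definition in_x (K : fieldType) (f : symfun K) : symfun2 K :=
  symfun_hom (fun i => psum2 K (inl i)) f.

Definition in_y (K : fieldType) (f : symfun K) : symfun2 K :=
  symfun_hom (fun i => psum2 K (inr i)) f.

(* f |-> f(x, y); indeed p_k(x, y) = p_k(x) + p_k(y). *)
Definition in_xy (K : fieldType) (f : symfun K) : symfun2 K :=
  symfun_hom (fun i => psum2 K (inl i) + psum2 K (inr i)) f.

(** * Hall-Littlewood functions *)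

Section HallLittlewood.
Variables (K : fieldType) (t : K).

Definition tpoch (m : nat) : K := \prod_(1 <= i < m.+1) (1 - t ^+ i).

(* The factors with i > la_1 are 1. *)
Definition hl_v (n : nat) (la : intpart) : K :=
  \prod_(0 <= i < (nth 0%N la 0).+1)
    (tpoch (padded_mult n la i) / (1 - t) ^+ padded_mult n la i).

Definition var (n : nat) (i : 'I_n) : mpoly n K := mpolyX K (mnm1 i).

(* The Hall-Littlewood polynomial in n variables, as a rational function. *)
Definition hl_poly (n : nat) (la : intpart) : {fraction mpoly n K} :=
  tofrac (mpolyC n (hl_v n la)^-1) *
  \sum_(s : {perm 'I_n})
    ((\prod_(i < n) tofrac (var (s i)) ^+ nth 0%N la i) *
     \prod_(i < n) \prod_(j < n | (i < j)%N)
       (tofrac (var (s i) - t *: var (s j)) /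
        tofrac (var (s i) - var (s j)))).

Definition in_vars (n : nat) (f : symfun K) : mpoly n K :=
  symfun_hom (fun k => \sum_(i < n) var i ^+ k.+1) f.

Definition hl_P (la : intpart) : symfun K :=
  xget 0 [set f : symfun K | forall n, (size la <= n)%N ->
                 tofrac (in_vars n f) = hl_poly n la].

Definition hl_Q (la : intpart) : symfun K :=
  (\prod_(1 <= i < (nth 0%N la 0).+1) tpoch (part_mult la i)) *: hl_P la.

(* [g mu] = Q_{la/mu}; the sum over all partitions mu is required to have
   finite support S. *)
Definition is_skew_Q (la : intpart) (g : intpart -> symfun K) : Prop :=
  exists S : seq intpart,
    [/\ uniq S,
        forall mu : intpart, mu \notin S -> g mu = 0
      & in_xy (hl_Q la) = \sum_(mu <- S) in_x (g mu) * in_y (hl_Q mu)].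

Definition hl_Qskew (la : intpart) : intpart -> symfun K :=
  xget (fun=> 0) [set g | is_skew_Q la g].

(* The substitution x_i = t^(i-1). *)
Definition principal_spec (f : symfun K) : K :=
  specialize (fun k => (1 - t ^+ k.+1)^-1) f.

Definition plancherel_spec (tau : K) (f : symfun K) : K :=
  specialize (fun k => if k == 0%N then tau / (1 - t) else 0) f.

End HallLittlewood.

Local Notation "x %:C" := (real_complex _ x) : ring_scope.

(* The times tau_1 <= ... <= tau_k are [tau 1], ..., [tau k], and similarly for
   the partitions; the values at 0 are the conventions tau_0 = 0, la^(0) empty. *)
Record hl_process (R : realType) (t : R) (d : measure_display)
    (Omega : measurableType d) (Pr : probability Omega R)
    (lam : R -> Omega -> intpart) : Prop := {
  hl_measurable : forall (tau : R) (mu : intpart), 0 <= tau ->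
    measurable [set w | lam tau w = mu];
  hl_marginals : forall (k : nat) (tau : nat -> R) (la : nat -> intpart),
    (0 < k)%N -> tau 0%N = 0 -> la 0%N = empty_partition ->
    (forall j, (j < k)%N -> tau j <= tau j.+1) ->
    (fine (Pr [set w | forall j, (0 < j <= k)%N -> lam (tau j) w = la j]))%:C =
    (\prod_(1 <= j < k.+1)
       plancherel_spec t%:C (tau j - tau j.-1)%:C
         (hl_Qskew t%:C (la j) (la j.-1))) *
    principal_spec t%:C (hl_P t%:C (la k)) /
    (expR (tau k / (1 - t)))%:C }.

(** * Slowed t-TASEP *)

(* Particles are indexed from 0: [x k] is the position of the (k+1)-st one. *)
Definition configuration (x : nat -> int) : Prop :=
  forall k, x k.+1 < x k.

Definition packed : nat -> int := fun k => - k.+1%:Z.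

(* The countable set of configurations in which all but finitely many particles
   are at their packed position; it is closed under jumps. *)
Definition packed_states : set (nat -> int) :=
  [set x | configuration x /\
           exists N : nat, forall k, (N <= k)%N -> x k = packed k].

Definition jump (x : nat -> int) (k : nat) : nat -> int :=
  fun j => if j == k then x j + 1 else x j.

(* For the first particle x_0 = oo, so that t ^ (x_0 - x_1 - 1) = 0. *)
Definition jump_rate (R : realType) (t : R) (x : nat -> int) (k : nat) : R :=
  t ^ (x k + k.+1%:Z) *
  (1 - if k is k'.+1 then t ^ (x k' - x k - 1) else 0).

(* [p h x y] is the probability to go from x to y in time h.  The Q-matrix,
   i.e. the derivative of p at 0, is given by the jump rates: rate
   [jump_rate t x k] from x to [jump x k], and total exit rate the sum over k
   of those (so that there are no other transitions). *)
Record tasep_transition (R : realType) (t : R)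
    (p : R -> (nat -> int) -> (nat -> int) -> R) : Prop := {
  trans_ge0 : forall (h : R) x y, 0 <= h -> packed_states x -> packed_states y ->
    0 <= p h x y;
  trans_sum : forall (h : R) x, 0 <= h -> packed_states x ->
    (\esum_(y in packed_states) (p h x y)%:E = 1)%E;
  trans_0 : forall x y, packed_states x -> packed_states y ->
    p 0 x y = (x == y)%:R;
  trans_chapman_kolmogorov : forall (h h' : R) x z, 0 <= h -> 0 <= h' ->
    packed_states x -> packed_states z ->
    ((p (h + h') x z)%:E =
     \esum_(y in packed_states) (p h x y * p h' y z)%:E)%E;
  trans_jump : forall x k, packed_states x -> packed_states (jump x k) ->
    p h x (jump x k) / h @[h --> 0^'+] --> jump_rate t x k;
  trans_exit : forall x, packed_states x ->
    (1 - p h x x) / h @[h --> 0^'+] --> limn (series (jump_rate t x)) }.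

(* The Markov jump process with these rates started from [packed].  As
   transition probabilities sum to 1 over [packed_states], the process stays
   there almost surely, and [tasep_markov] determines its law. *)
Record slowed_tTASEP (R : realType) (t : R) (d : measure_display)
    (Omega : measurableType d) (Pr : probability Omega R)
    (X : R -> Omega -> nat -> int) : Prop := {
  tasep_configuration : forall (tau : R) w, 0 <= tau -> configuration (X tau w);
  tasep_measurable : forall (tau : R) (k : nat) (z : int), 0 <= tau ->
    measurable [set w | X tau w k = z];
  tasep_step_paths : {ae Pr, forall w, forall tau : R, 0 <= tau ->
    exists2 e : R, 0 < e &
      forall u, tau <= u < tau + e -> X u w = X tau w};
  tasep_markov : exists2 p, tasep_transition t p &
    forall (n : nat) (tau : nat -> R) (x : nat -> nat -> int),
      tau 0%N = 0 -> (forall j, (j < n)%N -> tau j <= tau j.+1) ->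
      (forall j, (j <= n)%N -> packed_states (x j)) ->
      (Pr [set w | forall j, (j <= n)%N -> X (tau j) w = x j] =
       ((x 0%N == packed)%:R *
        \prod_(j < n) p (tau j.+1 - tau j) (x j) (x j.+1))%:E)%E }.

(** * Equality of finite-dimensional distributions *)

(* The product sigma-algebra on n-tuples of integer sequences. *)
Definition multitime_events (n : nat) : set (set ('I_n -> nat -> int)) :=
  <<s [set C | exists (i : 'I_n) (k : nat) (z : int),
                 C = [set f : 'I_n -> nat -> int | f i k = z]] >>.

Definition eq_in_multitime_dist (R : realType) (d d' : measure_display)
    (Omega : measurableType d) (Omega' : measurableType d')
    (Pr : probability Omega R) (Pr' : probability Omega' R)
    (X : R -> Omega -> nat -> int) (Y : R -> Omega' -> nat -> int) : Prop :=
  forall (n : nat) (tau : 'I_n -> R), (forall i, 0 <= tau i) ->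
  forall A, multitime_events A ->
    Pr [set w | A (fun i => X (tau i) w)] =
    Pr' [set w | A (fun i => Y (tau i) w)].

(* Main.v *)
(* With Q(xs) the value of the Hall-Littlewood function Q_la at a finite set xs of
   points, the recursion on the first part of la is
     Q_{a::la}(xs) = (1 - t) sum_{y in xs} y^a (prod_{z <> y} (y - t z) / (y - z)) Q_la(xs - y).
   Expanding Q_la(e, xs) to first order in e, and straightening Q_{..,a-1,a,..} =
   t Q_{..,a,a-1,..}, gives dQ_la/dp_1 = sum_v (1 - t^{m_v}) Q_{la - box in column v},
   and iterating it gives the Plancherel specialization of Q_{la/mu} as a sum over
   chains of partitions from mu to la, by linear independence of the Q_mu (leading coefficients).
   With P_la(1, t, ...) = t^{n(la)} / prod_i (t;t)_{m_i}, the weight of adding a box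
   in column k is the rate of slowed t-TASEP.
   All exit rates of slowed t-TASEP are 1, so that its transition function is a
   Poisson time change of the jump chain: each partial sum over numbers of jumps is a
   lower bound for it, and the total masses agree.
   P_la and Q_{la/mu} exist as symmetric functions because the Hall-Littlewood process
   does: otherwise it would give probability 0 to a partition which t-TASEP reaches
   with positive probability, without giving more weight to any other, and its
   probabilities would not sum to 1. *)
Require Import Defs.
From HB Require Import structures.
From mathcomp Require Import all_boot all_order all_algebra all_fingroup.
From mathcomp Require Import finmap complex.
From mathcomp Require Import -(notations) mpoly monalg.
From mathcomp Require Import all_classical all_reals all_analysis.
From mathcomp Require Import ring lra zify.

Set Implicit Arguments.
Unset Strict Implicit.
Unset Printing Implicit Defensive.
Import Order.TTheory GRing.Theory Num.Theory.
Import numFieldNormedType.Exports.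

Local Open Scope ring_scope.

(** * Hall-Littlewood functions as iterated operators on point sets *)

(** Symmetric functions are handled through their values at finite sets of distinct nonzero points.
    The values are rational in each point, and the poles at coinciding points do no harm, because
    every identity in one variable is needed only outside a finite set. No such set realizes the
    Plancherel specialization, which is why derivatives come in: modulo e^2 a new point e shifts p_1
    by e and fixes the other p_k. The infinite alphabet 1, t, t^2, ... is reached differently, by
    polynomiality in u = t^n and setting u = 0. The time change has the factor 1 - t because the
    Plancherel specialization at (1 - t) s sends p_1 to s and comes with the normalization exp(s),
    that of a Poisson clock of rate 1. Existence must not be argued in a circle: comparing
    coefficients of all Q_mu presupposes all P_mu. Evaluating the second alphabet at no points at
    all isolates the empty partition, and Q_{la/empty} is all that the law at one time requires. *)

Fixpoint selections (T : Type) (xs : seq T) : seq (T * seq T) :=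
  if xs is x :: s then (x, s) :: [seq (p.1, x :: p.2) | p <- selections s]
  else [::].

Lemma selections_perm (T : eqType) (xs : seq T) p :
  p \in selections xs -> perm_eq (p.1 :: p.2) xs.
Proof.
elim: xs p => [|x s IH] p //=; rewrite inE => /orP[/eqP->//|].
case/mapP => q /IH qs -> /=; rewrite -(perm_cons x) in qs.
by apply: perm_trans qs; apply: (permEl (perm_catCA [:: q.1] [:: x] q.2)).
Qed.

(** The points left over depend only on the unordered pair of chosen positions. This is what makes
    an antisymmetric summand cancel. *)
Lemma selections2_swap (T : Type) (V : nmodType) (xs : seq T)
    (f : T -> T -> seq T -> V) :
  \sum_(p <- selections xs) \sum_(q <- selections p.2) f p.1 q.1 q.2 =
  \sum_(p <- selections xs) \sum_(q <- selections p.2) f q.1 p.1 q.2.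
Proof.
elim: xs f => [|x s IH] f; rewrite ?big_nil //= !big_cons !big_map /=.
under [X in _ + X = _]eq_bigr do rewrite big_cons big_map /=.
under [X in _ = _ + X]eq_bigr do rewrite big_cons big_map /=.
rewrite !big_split /= (IH (fun y z r => f y z (x :: r))).
by rewrite !addrA [X in X + _]addrC.
Qed.

Section HallLittlewoodOperators.
Variables (K : numFieldType) (t : K).

Definition good_points (xs : seq K) := uniq xs && (0 \notin xs).

Definition hl_kernel (y : K) (r : seq K) : K :=
  \prod_(z <- r) ((y - t * z) / (y - z)).

(** Prepends the part a to the index of a Hall-Littlewood function. One factor 1 - t per part
    produces the normalization of Q instead of that of P. *)
Definition hl_op (a : nat) (F : seq K -> K) (xs : seq K) : K :=
  (1 - t) * \sum_(p <- selections xs) p.1 ^+ a * hl_kernel p.1 p.2 * F p.2.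

(** With fewer points than parts some inner sum is empty and the value is 0, as it should be for
    Q_la. *)
Definition hl_val (la : seq nat) : seq K -> K := foldr hl_op (fun=> 1) la.

Lemma hl_opE a F xs : hl_op a F xs =
  (1 - t) * \sum_(p <- selections xs) p.1 ^+ a * hl_kernel p.1 p.2 * F p.2.
Proof. by []. Qed.

Lemma good_selections xs p : good_points xs -> p \in selections xs ->
  [/\ good_points p.2, p.1 != 0 & p.1 \notin p.2].
Proof.
case/andP=> u z /selections_perm pe.
have := perm_uniq pe; rewrite u /= => /andP[np u2].
move: z; rewrite -(perm_mem pe) inE negb_or eq_sym => /andP[-> z2].
by rewrite /good_points u2 z2 np.
Qed.

Lemma size_selections (xs : seq K) p :
  p \in selections xs -> size xs = (size p.2).+1.
Proof. by move/selections_perm/perm_size => /= <-. Qed.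

Lemma eq_hl_op a F G xs : good_points xs ->
  (forall ys, good_points ys -> size xs = (size ys).+1 -> F ys = G ys) ->
  hl_op a F xs = hl_op a G xs.
Proof.
move=> gx FG; congr (_ * _); rewrite big_seq [RHS]big_seq.
apply: eq_bigr => p pi; have [g _ _] := good_selections gx pi.
by rewrite FG // (size_selections pi).
Qed.

Lemma hl_opZ a c F xs : hl_op a (fun ys => c * F ys) xs = c * hl_op a F xs.
Proof.
rewrite /hl_op mulrCA; congr (_ * _).
by rewrite big_distrr /=; apply: eq_bigr => p _; rewrite mulrCA.
Qed.

Lemma hl_op_sum (I : Type) (s : seq I) a (F : I -> seq K -> K) xs :
  hl_op a (fun ys => \sum_(i <- s) F i ys) xs = \sum_(i <- s) hl_op a (F i) xs.
Proof.
rewrite /hl_op -big_distrr /= exchange_big /=; congr (_ * _).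
by apply: eq_bigr => p _; rewrite big_distrr.
Qed.

(** For two chosen points y and z the difference of the two sides contains (y z)^a (z - t y) (y - t
    z) / (y - z), and everything else is symmetric; the summand is antisymmetric in y and z. *)
Lemma hl_op_straighten a F xs : good_points xs ->
  hl_op a (hl_op a.+1 F) xs = t * hl_op a.+1 (hl_op a F) xs.
Proof.
move=> gx.
pose g (y z : K) (r : seq K) :=
  hl_kernel y r * hl_kernel z r * F r * (1 - t) ^+ 2 *
  ((y ^+ a * z ^+ a.+1 - t * (y ^+ a.+1 * z ^+ a)) * ((y - t * z) / (y - z))).
suff sg0 : \sum_(p <- selections xs) \sum_(q <- selections p.2) g p.1 q.1 q.2 = 0.
  apply/eqP; rewrite -subr_eq0 -sg0 /hl_op mulrCA -mulrBr mulr_sumr -sumrB.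
  rewrite mulr_sumr; apply/eqP/eq_big_seq => p pi.
  rewrite !mulr_sumr -sumrB mulr_sumr.
  apply: eq_big_seq => q qi.
  have -> : hl_kernel p.1 p.2 =
    (p.1 - t * q.1) / (p.1 - q.1) * hl_kernel p.1 q.2.
    by rewrite /hl_kernel -(perm_big _ (selections_perm qi)) big_cons.
  rewrite /g; set u := (_ / _); ring.
(* Adding the copy with y and z exchanged yields twice the sum, which is enough in characteristic
   0. *)
have: \sum_(p <- selections xs) \sum_(q <- selections p.2)
   (g p.1 q.1 q.2 + g q.1 p.1 q.2) = 0.
  rewrite big_seq big1 // => p pi; rewrite big_seq big1 // => q qi.
  have [gp _ np] := good_selections gx pi.
  have qp : q.1 \in p.2 by rewrite -(perm_mem (selections_perm qi)) mem_head.
  have pq : p.1 - q.1 != 0.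
    by rewrite subr_eq0; apply: contraNneq np => ->.
  have qp' : q.1 - p.1 != 0 by rewrite -opprB oppr_eq0.
  rewrite /g !exprS; field; by rewrite pq qp'.
under eq_bigr do rewrite big_split /=.
rewrite big_split /= -selections2_swap => /eqP.
by rewrite -mulr2n mulrn_eq0 /= => /eqP.
Qed.

(** Partial fractions in e: the product tends to 1 at infinity, and its residue at a point y of [xs]
    is (1 - t) y times the kernel of y with respect to the other points. *)
Lemma hl_kernel_partial_fractions e xs : good_points (e :: xs) ->
  hl_kernel e xs =
  1 + (1 - t) * \sum_(p <- selections xs) p.1 / (e - p.1) * hl_kernel p.1 p.2.
Proof.
elim: xs e => [|w s IH] e; first by rewrite big_nil mulr0 addr0 /hl_kernel big_nil.
move=> /andP[/= /andP[+ /andP[ws us]]]; rewrite !inE !negb_or.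
move=> /andP[ew es] /and3P[e0 w0 s0].
have gs : good_points (e :: s) by rewrite /good_points /= es us inE negb_or e0 s0.
have gw : good_points (w :: s) by rewrite /good_points /= ws us inE negb_or w0 s0.
rewrite big_cons /= big_map /= {1}/hl_kernel big_cons -/(hl_kernel e s).
rewrite (IH _ gs) [in RHS](IH _ gw).
have ew' : e - w != 0 by rewrite subr_eq0.
under [X in _ = _ + _ * (_ + X)]eq_bigr do
  rewrite {1}/hl_kernel big_cons -/(hl_kernel _ _).
set S1 := \sum_(p <- _) _; set S2 := \sum_(p <- _) _; set S3 := \sum_(p <- _) _.
(* Termwise, the product of the poles at w and at [p.1] is separated into single poles in e. *)
have : (e - t * w) / (e - w) * S1 = w / (e - w) * (1 - t) * S2 + S3.
  rewrite /S1 /S2 /S3 !mulr_sumr -big_split /=; apply: eq_big_seq => p pi.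
  have ps : p.1 \in s by rewrite -(perm_mem (selections_perm pi)) mem_head.
  have ep : e - p.1 != 0 by rewrite subr_eq0; apply: contraNneq es => ->.
  have wp : w - p.1 != 0 by rewrite subr_eq0; apply: contraNneq ws => ->.
  have pw : p.1 - w != 0 by rewrite -opprB oppr_eq0.
  by field; rewrite ep ew' wp pw.
move: S1 S2 S3 => S1 S2 S3 S123.
have -> : (e - t * w) / (e - w) * (1 + (1 - t) * S1) =
  (e - t * w) / (e - w) + (1 - t) * ((e - t * w) / (e - w) * S1) by ring.
by rewrite S123; field.
Qed.

(** The classical identity that the kernels of n points add up to (1 - t^n) / (1 - t). It is the
    origin of all t-factorials below. *)
Lemma hl_op0_const c xs : good_points xs ->
  hl_op 0 (fun=> c) xs = (1 - t ^+ size xs) * c.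
Proof.
elim: xs => [|e s IH]; first by rewrite /hl_op big_nil subrr mulr0 mul0r.
move=> gs; have gs' : good_points s.
  by move: gs; rewrite /good_points /= inE negb_or => /andP[/andP[_ ->] /andP[]].
have es : e \notin s by case/andP: gs => /= /andP[].
move: (IH gs'); rewrite /hl_op /= big_cons big_map /=.
rewrite hl_kernel_partial_fractions //.
set S := \sum_(p <- _) _; set S1 := \sum_(p <- _) _; set S2 := \sum_(p <- _) _.
(* From (y - t e) / (y - e) = t - (1 - t) y / (e - y). The second part cancels against the partial
   fractions of the kernel of e. *)
move=> IHs; have -> : S2 = t * S - (1 - t) * S1 * c.
  rewrite /S1 /S2 /S mulrAC mulr_sumr mulr_sumr -sumrB; apply: eq_big_seq => p pi.
  have ps : p.1 \in s by rewrite -(perm_mem (selections_perm pi)) mem_head.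
  have ep : e - p.1 != 0 by rewrite subr_eq0; apply: contraNneq es => ->.
  have pe : p.1 - e != 0 by rewrite -opprB oppr_eq0.
  rewrite {1}/hl_kernel big_cons -/(hl_kernel _ _).
  by field; rewrite ep pe.
rewrite mulrDr [_ * (t * S - _)]mulrBr [_ * (t * S)]mulrCA IHs exprS; ring.
Qed.

End HallLittlewoodOperators.

(** * Expansion in a small additional variable *)

Section Germs.
Variable K : numFieldType.

Lemma poly_eq0_of_roots (r : nat -> K) (N : nat) (q : {poly K}) : injective r ->
  (forall n : nat, (N <= n)%N -> q.[r n] = 0) -> q = 0.
Proof.
move=> ri q0; apply/eqP/contraT => qn0.
have := max_poly_roots qn0 (rs := [seq r n | n <- iota N (size q)]).
rewrite size_map size_iota ltnn map_inj_uniq ?iota_uniq// => -> //.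
apply/allP => _ /mapP[n + ->]; rewrite mem_iota => /andP[Nn _].
by rewrite /root q0.
Qed.

Lemma poly_eq0_generic (h q : {poly K}) : h != 0 ->
  (forall x, h.[x] != 0 -> q.[x] = 0) -> q = 0.
Proof.
move=> h0 hq; have /eqP: q * h = 0.
  apply: (@poly_eq0_of_roots (fun n => n%:R) 0) => [m n /eqP|n _].
    by rewrite eqr_nat => /eqP.
  rewrite hornerM; by have [->|/hq->] := eqVneq h.[n%:R] 0; rewrite ?mulr0 ?mul0r.
by rewrite mulf_eq0 (negPf h0) orbF => /eqP.
Qed.

(* Away from the roots of [h], f is a rational function p / d, which is regular at
   0 with expansion a + b e + O(e^2). *)
Definition germ (f : K -> K) (a b : K) : Prop :=
  exists h p d : {poly K}, [/\ h != 0, d`_0 != 0, p`_0 = a * d`_0,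
    p`_1 = a * d`_1 + b * d`_0 & forall x, h.[x] != 0 -> f x * d.[x] = p.[x]].

Lemma coef1M (R : nzRingType) (p q : {poly R}) :
  (p * q)`_1 = p`_0 * q`_1 + p`_1 * q`_0.
Proof. by rewrite coefM !big_ord_recl big_ord0 /= addr0. Qed.

Lemma germ_poly (q : {poly K}) : germ (horner q) q`_0 q`_1.
Proof.
exists 1, q, 1; split; rewrite ?oner_eq0 //.
- by rewrite coef1 oner_eq0.
- by rewrite !coef1 /= mulr1.
- by rewrite !coef1 /= mulr1 mulr0 add0r.
by move=> x _; rewrite hornerE mulr1.
Qed.

Lemma eq_germ (h0 : {poly K}) f g a b : h0 != 0 ->
  (forall x, h0.[x] != 0 -> f x = g x) -> germ f a b -> germ g a b.
Proof.
move=> h00 fg [h [p [d [hn0 d0 p0 p1 fE]]]].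
exists (h0 * h), p, d; split; rewrite ?mulf_neq0 //.
by move=> x; rewrite hornerM mulf_eq0 negb_or => /andP[/fg <- /fE].
Qed.

Lemma germD f g a b a' b' : germ f a b -> germ g a' b' ->
  germ (fun x => f x + g x) (a + a') (b + b').
Proof.
move=> [h [p [d [hn0 d0 p0 p1 fE]]]] [h' [p' [d' [hn0' d0' p0' p1' fE']]]].
exists (h * h'), (p * d' + p' * d), (d * d'); split.
- by rewrite mulf_neq0.
- by rewrite coef0M mulf_neq0.
- by rewrite coefD !coef0M p0 p0'; ring.
- by rewrite coefD !coef0M !coef1M p0 p0' p1 p1'; ring.
move=> x; rewrite hornerM mulf_eq0 negb_or => /andP[/fE E /fE' E'].
by rewrite hornerD !hornerM -E -E'; ring.
Qed.

Lemma germM f g a b a' b' : germ f a b -> germ g a' b' ->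
  germ (fun x => f x * g x) (a * a') (a * b' + b * a').
Proof.
move=> [h [p [d [hn0 d0 p0 p1 fE]]]] [h' [p' [d' [hn0' d0' p0' p1' fE']]]].
exists (h * h'), (p * p'), (d * d'); split.
- by rewrite mulf_neq0.
- by rewrite coef0M mulf_neq0.
- by rewrite !coef0M p0 p0'; ring.
- by rewrite !coef0M !coef1M p0 p0' p1 p1'; ring.
move=> x; rewrite hornerM mulf_eq0 negb_or => /andP[/fE E /fE' E'].
by rewrite !hornerM -E -E'; ring.
Qed.

Lemma germV f a b : a != 0 -> germ f a b ->
  germ (fun x => (f x)^-1) a^-1 (- (b / a ^+ 2)).
Proof.
move=> a0 [h [p [d [hn0 d0 p0 p1 fE]]]].
have pn0 : p`_0 != 0 by rewrite p0 mulf_neq0.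
exists (h * p), d, p; split => //.
- by rewrite mulf_neq0 //; apply: contraNneq pn0 => ->; rewrite coef0.
- by rewrite p0; field.
- by rewrite p0 p1; field.
move=> x; rewrite hornerM mulf_eq0 negb_or => /andP[/fE E px].
have fx : f x != 0 by apply: contraNneq px; rewrite -E => ->; rewrite mul0r.
by rewrite -E mulrA mulVf // mul1r.
Qed.

Lemma germ_sum (I : eqType) (s : seq I) (f : I -> K -> K) a b :
  (forall i, i \in s -> germ (f i) (a i) (b i)) ->
  germ (fun x => \sum_(i <- s) f i x) (\sum_(i <- s) a i) (\sum_(i <- s) b i).
Proof.
elim: s => [|i s IH] H.
  rewrite !big_nil; apply: (@eq_germ 1 (horner 0)).
  - exact: oner_neq0.
  - by move=> x _; rewrite big_nil horner0.
  - by have := germ_poly 0; rewrite !coef0.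
rewrite !big_cons; apply: (@eq_germ 1 (fun x => f i x + \sum_(j <- s) f j x)).
- exact: oner_neq0.
- by move=> x _; rewrite big_cons.
apply: germD; first by apply: H; rewrite mem_head.
by apply: IH => j js; apply: H; rewrite inE js orbT.
Qed.

Lemma germ_cst c : germ (fun=> c) c 0.
Proof.
apply: (@eq_germ 1 (horner c%:P)); rewrite ?oner_neq0 //.
  by move=> x; rewrite hornerC.
by have := germ_poly c%:P; rewrite !coefC.
Qed.

Lemma germ_id : germ id 0 1.
Proof.
apply: (@eq_germ 1 (horner 'X)); rewrite ?oner_neq0 //.
  by move=> x; rewrite hornerX.
by have := germ_poly 'X; rewrite !coefX.
Qed.

(** Cross-multiplied, the agreement becomes an equality of polynomials valid at infinitely many
    points. Thus an expansion computed for the rational function determines two coefficients of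
    [q]. *)
Lemma germ_inj_poly (h q : {poly K}) f a b : h != 0 ->
  (forall x, h.[x] != 0 -> f x = q.[x]) -> germ f a b -> q`_0 = a /\ q`_1 = b.
Proof.
move=> h0 fq [h' [p [d [hn0 d0 p0 p1 fE]]]].
have /eqP : q * d - p = 0.
  apply: (@poly_eq0_generic (h * h')); first by rewrite mulf_neq0.
  move=> x; rewrite hornerM mulf_eq0 negb_or => /andP[/fq E /fE].
  by rewrite E !hornerE => ->; rewrite subrr.
rewrite subr_eq0 => /eqP pE; move: p0 p1; rewrite -pE coef0M coef1M.
move=> /(mulIf d0) -> /addrI/(mulIf d0) ->; by [].
Qed.

Definition avoid (s : seq K) : {poly K} := 'X * \prod_(z <- s) ('X - z%:P).

Lemma avoid_neq0 s : avoid s != 0.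
Proof.
by rewrite mulf_neq0 ?polyX_eq0 // prodf_seq_neq0; apply/allP => z _;
  rewrite polyXsubC_eq0.
Qed.

Lemma horner_avoid s x : ((avoid s).[x] != 0) = (x != 0) && (x \notin s).
Proof.
rewrite hornerM hornerX horner_prod mulf_eq0 negb_or; congr (_ && _).
rewrite prodf_seq_neq0; apply/allP/idP => [H|xs z zs].
  by apply/negP => /H; rewrite hornerXsubC subrr eqxx.
by rewrite hornerXsubC subr_eq0; apply: contraNneq xs => ->.
Qed.

End Germs.

Section HallLittlewoodGerms.
Variables (K : numFieldType) (t : K).
Local Notation hl_op := (hl_op t).
Local Notation hl_val := (hl_val t).

(** A term of the sum over [e :: xs] may select e; it then matters to first order only for a = 1,
    and the kernel at e = 0 is t^n for n points. Otherwise it selects y in [xs] and gains the factor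
    (y - t e) / (y - e) = 1 + (1 - t) e / y + O(e^2), whose linear term lowers the exponent of y by
    one. *)
Lemma germ_hl_op (F : seq K -> K) (F0 F1 : seq K -> K) a xs : (0 < a)%N ->
  good_points xs ->
  (forall ys, good_points ys -> size xs = (size ys).+1 ->
    germ (fun e => F (e :: ys)) (F0 ys) (F1 ys)) ->
  germ (fun e => hl_op a F (e :: xs)) (hl_op a F0 xs)
    (hl_op a F1 xs + (1 - t) * hl_op a.-1 F0 xs
     + (a == 1%N)%:R * ((1 - t) * t ^+ size xs * F xs)).
Proof.
move=> a0 gx HF.
pose f1 e := e ^+ a * hl_kernel t e xs * F xs.
pose f2 e := \sum_(p <- selections xs)
   p.1 ^+ a * ((p.1 - t * e) * (p.1 - e)^-1 * hl_kernel t p.1 p.2) *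
   F (e :: p.2).
apply: (@eq_germ _ 1 (fun e => (1 - t) * (f1 e + f2 e))).
- exact: oner_neq0.
- move=> e _; rewrite /hl_op /= big_cons big_map /=; congr (_ * (_ + _)).
  by apply: eq_bigr => p _; rewrite {2}/hl_kernel big_cons.
have g1 : germ f1 0 ((a == 1%N)%:R * (t ^+ size xs * F xs)).
  have [b gk] : exists b, germ (fun e => hl_kernel t e xs) (t ^+ size xs) b.
    have : 0 \notin xs by case/andP: gx.
    elim: (xs) => [_|z s IH].
      exists 0; apply: (@eq_germ _ 1 (fun=> 1) (fun e => hl_kernel t e [::])).
      - exact: oner_neq0.
      - by move=> x _; rewrite /hl_kernel big_nil.
      - exact: germ_cst.
    rewrite inE negb_or eq_sym => /andP[z0 /IH[b gb]].
    have g3 := germD (germ_id K) (germ_cst (- (t * z))).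
    have g4 := germD (germ_id K) (germ_cst (- z)).
    have z0' : 0 + - z != 0 by rewrite add0r oppr_eq0.
    have := germM (germM g3 (germV z0' g4)) gb.
    rewrite !add0r invrN mulrNN mulfK // -exprS => H.
    eexists; apply: (@eq_germ _ 1 _ _ _ _ _ _ H); first exact: oner_neq0.
    by move=> x _; rewrite {2}/hl_kernel big_cons.
  case: a a0 {HF} @f1 @f2 => // a _ f1 _.
  have gX : germ (fun e : K => e ^+ a.+1) ('X^(a.+1) : {poly K})`_0 ('X^(a.+1) : {poly K})`_1.
    apply: eq_germ (germ_poly ('X^(a.+1) : {poly K})); first exact: oner_neq0.
    by move=> x _; rewrite hornerXn.
  have := germM (germM gX gk) (germ_cst (F xs)).
  rewrite !coefXn [(1 == _)%N]eq_sym [(0 == _)%N]eq_sym [(a.+1 == 0)%N]/= mulr0n.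
  by rewrite !mul0r !add0r mulrA.
have g2 : germ f2 (\sum_(p <- selections xs) p.1 ^+ a * hl_kernel t p.1 p.2 * F0 p.2)
   (\sum_(p <- selections xs) (p.1 ^+ a * hl_kernel t p.1 p.2 * F1 p.2 +
     (1 - t) * (p.1 ^+ a.-1 * hl_kernel t p.1 p.2 * F0 p.2))).
  apply: germ_sum => p pi; have [gp p0 _] := good_selections gx pi.
  have g3 := germD (germ_cst p.1) (germM (germ_cst (- t)) (germ_id K)).
  have g4 := germD (germ_cst p.1) (germM (germ_cst (-1)) (germ_id K)).
  have p0' : p.1 + -1 * 0 != 0 by rewrite mulr0 addr0.
  have := germM (germM (germ_cst (p.1 ^+ a)) (germM (germM g3 (germV p0' g4))
    (germ_cst (hl_kernel t p.1 p.2)))) (HF _ gp (size_selections pi)).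
  rewrite !mulr0 !addr0 !mul0r !add0r !mulr1 !addr0 divff // !mul1r.
  set G := hl_kernel _ _ _.
  have -> : p.1 ^+ a * G * F1 p.2 + p.1 ^+ a *
     ((p.1 * - (-1 / p.1 ^+ 2) + - t * p.1^-1) * G) * F0 p.2 =
    p.1 ^+ a * G * F1 p.2 + (1 - t) * (p.1 ^+ a.-1 * G * F0 p.2).
    case: a a0 {HF f1 f2 g1} => // a _ /=; rewrite exprS; field; exact: p0.
  apply: eq_germ; first exact: oner_neq0.
  by move=> x _; rewrite mulN1r mulNr.
have := germM (germ_cst (1 - t)) (germD g1 g2).
rewrite add0r mul0r addr0 /hl_op; congr (germ _ _ _).
rewrite big_split /= -mulr_sumr; ring.
Qed.

End HallLittlewoodGerms.

(** * Lowering a partition, and the derivative of Q in p_1 *)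

Definition is_part (la : seq nat) := sorted geq la && (0%N \notin la).

(* Removes the bottom box of column v. *)
Fixpoint lower (v : nat) (la : seq nat) : seq nat :=
  if la is a :: s then
    if v \in s then a :: lower v s
    else if a == v then (if v == 1%N then s else v.-1 :: s) else la
  else [::].

Lemma geq_trans : transitive geq.
Proof. by move=> b a c ab bc; apply: leq_trans bc ab. Qed.

Lemma is_part_cons a s :
  is_part (a :: s) = [&& (0 < a)%N, all (geq a) s & is_part s].
Proof.
rewrite /is_part /= (path_sortedE geq_trans) inE negb_or eq_sym lt0n.
by case: (a != 0%N) => //=; rewrite ?andbF // andbA.
Qed.

Section Evaluation.
Variables (K : numFieldType) (t : K).
Local Notation hl_op := (hl_op t).
Local Notation hl_val := (hl_val t).

Lemma good_points_nil : @good_points K [::]. Proof. by []. Qed.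

Lemma hl_val_nil a s : hl_val (a :: s) [::] = 0.
Proof. by rewrite /= !hl_opE big_nil mulr0. Qed.

(** The exponent a - 1 is moved behind all the parts equal to a; each straightening costs one factor
    t. *)
Lemma hl_op_lower a s xs : is_part (a :: s) -> (1 < a)%N -> good_points xs ->
  hl_op a.-1 (hl_val s) xs = t ^+ count_mem a s * hl_val (lower a (a :: s)) xs.
Proof.
elim: s xs => [|b s IH] xs.
  by case: a => [|[|a]] //= _ _ _; rewrite eqxx /= mul1r.
move=> pabs a1 gx; have := pabs; rewrite !is_part_cons.
case/and3P=> a0 /andP[ba sa] /and3P[b0 sb ps]; have {}ba : (b <= a)%N := ba; have {}sa : all (geq a) s := sa.
have [eba|ba'] := eqVneq b a.
  subst b; have pas : is_part (a :: s) by rewrite is_part_cons a0 sa.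
  have -> : hl_val (a :: s) = hl_op a.-1.+1 (hl_val s) by rewrite prednK.
  rewrite hl_op_straighten // prednK //.
  have -> : lower a [:: a, a & s] = a :: lower a (a :: s).
    by rewrite /= inE eqxx.
  rewrite [count_mem _ _]/= eqxx exprS -mulrA -[hl_val (a :: _)]/(hl_op a _).
  congr (_ * _); rewrite -hl_opZ; apply: eq_hl_op => // ys gy _.
  by rewrite IH.
have anbs : a \notin b :: s.
  rewrite inE negb_or eq_sym ba'; apply/negP => /(allP sb) /= ab.
  by move: ba'; rewrite eqn_leq ba ab.
rewrite (count_memPn anbs) expr0 mul1r /= (negPf anbs) eqxx.
by case: eqP a1 => // ->.
Qed.

(** Here all parts are 1 and the exponent 0 is moved to the end, at the cost of t^l with l =
    [size s]. There n - l of the n points are left and [hl_op0_const] contributes 1 - t^(n - l). *)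
Lemma hl_op_lower1 s xs : is_part (1%N :: s) -> good_points xs ->
  hl_op 0 (hl_val s) xs = (t ^+ size s - t ^+ size xs) * hl_val s xs.
Proof.
elim: s xs => [|b s IH] xs; first by move=> _ gx; rewrite /= hl_op0_const.
move=> pabs gx; have := pabs; rewrite !is_part_cons.
case/and3P=> _ /andP[ba sa] /and3P[b0 sb ps]; have {}ba : (b <= 1)%N := ba; have {}sa : all (geq 1) s := sa.
have b1 : b = 1%N by lia.
subst b; rewrite hl_op_straighten //.
case: xs gx => [|x xs] gx; first by rewrite /= !hl_opE !big_nil !mulr0.
rewrite -[hl_val (1%N :: s)]/(hl_op 1 (hl_val s)) -!hl_opZ; apply: eq_hl_op => // ys gy [sy].
by rewrite -/(hl_val s) IH ?is_part_cons ?sa //= sy !exprS -mulrBr !mulrA.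
Qed.

Lemma lower_notin v la : v \notin la -> lower v la = la.
Proof.
elim: la => //= a s IH; rewrite inE negb_or => /andP[va /negPf vs].
by rewrite vs eq_sym (negPf va).
Qed.

Lemma lower1 s : is_part (1%N :: s) -> lower 1 (1%N :: s) = s.
Proof.
elim: s => [//|b s IH]; rewrite is_part_cons => /and3P[_ /andP[b1 s1]].
rewrite is_part_cons => /and3P[b0 sb ps].
have {b1 b0} -> : b = 1%N by move: b0 b1 => /=; lia.
rewrite /= ?inE ?eqxx /=; congr (_ :: _).
by apply: IH; rewrite is_part_cons ps andbT; exact: s1.
Qed.

(** The formula for the p_1-derivative of Q_la. A column v that is not a part has coefficient 1 -
    t^0 = 0, so any bound [M] on the parts gives the same value. *)
Definition hl_deriv (M : nat) (la : seq nat) (xs : seq K) : K :=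
  \sum_(v <- iota 1 M) (1 - t ^+ count_mem v la) * hl_val (lower v la) xs.

(** The right-hand side has the shape found in [germ_hl_op]. For a = 1 its last two terms add up to
    (1 - t) t^(size s) times [hl_val s xs]: the dependence on the number of points cancels. For a >
    1 the middle term is straightened. *)
Lemma hl_deriv_cons M a s xs : is_part (a :: s) -> (a <= M)%N ->
  good_points xs ->
  hl_deriv M (a :: s) xs = hl_op a (hl_deriv M s) xs
    + (1 - t) * hl_op a.-1 (hl_val s) xs
    + (a == 1%N)%:R * ((1 - t) * t ^+ size xs * hl_val s xs).
Proof.
move=> pa aM gx; have a0 : (0 < a)%N by move: pa; rewrite is_part_cons => /andP[].
have -> : hl_op a (hl_deriv M s) xs = \sum_(v <- iota 1 M)
    (1 - t ^+ count_mem v s) * hl_val (a :: lower v s) xs.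
  rewrite /hl_deriv hl_op_sum; apply: eq_bigr => v _.
  by rewrite hl_opZ.
rewrite -addrA; have -> : (1 - t) * hl_op a.-1 (hl_val s) xs +
     (a == 1%N)%:R * ((1 - t) * t ^+ size xs * hl_val s xs) =
   (1 - t) * t ^+ count_mem a s * hl_val (lower a (a :: s)) xs.
  have [a1|a1] := eqVneq a 1%N.
    subst a; rewrite hl_op_lower1 // lower1 // mul1r.
    have -> : count_mem 1%N s = size s.
      apply/eqP; rewrite -all_count; apply/allP => b bs /=.
      move: pa; rewrite is_part_cons /is_part => /and3P[_ /allP/(_ _ bs)/= b1].
      by move=> /andP[_]; apply: contraR; case: b b1 bs => [|[]].
    ring.
  rewrite mul0r addr0 hl_op_lower //; last by move: a0 a1; case: a {pa aM} => [|[]].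
  by rewrite mulrA.
have ai : a \in iota 1 M by rewrite mem_iota a0 add1n ltnS.
(* Only the multiplicity of a changes, from m to m + 1, and 1 - t^(m + 1) = (1 - t^m) + (1 - t)
   t^m. *)
rewrite /hl_deriv !(bigD1_seq a ai (iota_uniq _ _)) /=.
rewrite eqxx [(true + _)%N]add1n [in RHS]addrAC; congr (_ + _).
  have [as_|nas] := boolP (a \in s); last first.
    rewrite (count_memPn nas); ring.
  rewrite -[hl_val (a :: lower a s)]/(hl_op a (hl_val (lower a s))) exprS; ring.
apply: eq_bigr => v va; rewrite eq_sym (negPf va) add0n.
have [//|nvs] := boolP (v \in s).
by rewrite (count_memPn nvs) subrr !mul0r.
Qed.

Lemma germ_hl_val M la xs : is_part la -> all (geq M) la -> good_points xs ->
  germ (fun e => hl_val la (e :: xs)) (hl_val la xs) (hl_deriv M la xs).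
Proof.
elim: la xs => [|a s IH] xs.
  move=> _ _ _; rewrite /hl_deriv big1 => [|v _]; first exact: germ_cst.
  by rewrite /= subrr mul0r.
move=> pas /= /andP[aM sM] gx; rewrite hl_deriv_cons //.
have := pas; rewrite is_part_cons => /and3P[a0 _ ps].
by apply: germ_hl_op => // ys gy _; apply: IH.
Qed.

End Evaluation.

(* n(la) = sum_i (i - 1) la_i in Macdonald's notation. *)
Fixpoint part_weight (la : seq nat) : nat :=
  if la is _ :: s then (sumn s + part_weight s)%N else 0%N.

(** * Linear independence of the functions Q_mu on point sets *)

Lemma sum_fibers (K : pzRingType) (T : eqType) (L : seq (K * T)) (F : T -> K) :
  (forall mu, \sum_(p <- L | p.2 == mu) p.1 = 0) ->
  \sum_(p <- L) p.1 * F p.2 = 0.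
Proof.
move=> H.
have -> : \sum_(p <- L) p.1 * F p.2 =
    \sum_(mu <- undup (map snd L)) \sum_(p <- L | p.2 == mu) p.1 * F mu.
  under [RHS]eq_bigr do rewrite big_mkcond.
  rewrite exchange_big /=; apply: eq_big_seq => p pL.
  rewrite (bigD1_seq p.2) ?undup_uniq ?mem_undup ?map_f //= eqxx big1 ?addr0 //.
  by move=> mu; rewrite eq_sym => /negPf ->.
by rewrite big1 // => mu _; rewrite -mulr_suml H mul0r.
Qed.

Section Independence.
Variables (K : numFieldType) (t : K).
Hypothesis t0 : t != 0.
Hypothesis t_nunity : forall i, (0 < i)%N -> t ^+ i != 1.
Local Notation hl_op := (hl_op t).
Local Notation hl_val := (hl_val t).

Definition limit0 (f : K -> K) (a : K) := exists b, germ f a b.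

Lemma limit0M f g a a' : limit0 f a -> limit0 g a' ->
  limit0 (fun x => f x * g x) (a * a').
Proof. by move=> [b gf] [b' gg]; eexists; exact: germM gf gg. Qed.

Lemma limit0D f g a a' : limit0 f a -> limit0 g a' ->
  limit0 (fun x => f x + g x) (a + a').
Proof. by move=> [b gf] [b' gg]; eexists; exact: germD gf gg. Qed.

Lemma limit0V f a : a != 0 -> limit0 f a -> limit0 (fun x => (f x)^-1) a^-1.
Proof. by move=> a0 [b gf]; eexists; exact: germV gf. Qed.

Lemma limit0_cst c : limit0 (fun=> c) c.
Proof. by exists 0; exact: germ_cst. Qed.

Lemma limit0_id : limit0 id 0.
Proof. by exists 1; exact: germ_id. Qed.

Lemma limit0_exp n : limit0 (fun x => x ^+ n) (n == 0%N)%:R.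
Proof.
exists ('X^n : {poly K})`_1.
have := germ_poly ('X^n : {poly K}); rewrite [_`_0]coefXn [(0 == n)%N]eq_sym.
by apply: eq_germ (oner_neq0 _) _ => x _; rewrite hornerXn.
Qed.

Lemma eq_limit0 (s : seq K) f g a : (forall x, x != 0 -> x \notin s -> f x = g x) ->
  limit0 f a -> limit0 g a.
Proof.
move=> fg [b gf]; exists b; apply: eq_germ gf; first exact: (avoid_neq0 s).
by move=> x; rewrite horner_avoid => /andP[]; exact: fg.
Qed.

Lemma limit0_sum (I : eqType) (s : seq I) (f : I -> K -> K) a :
  (forall i, i \in s -> limit0 (f i) (a i)) ->
  limit0 (fun x => \sum_(i <- s) f i x) (\sum_(i <- s) a i).
Proof.
elim: s => [|i s IH] H.
  rewrite big_nil; apply: (@eq_limit0 [::] (fun=> 0)); last exact: limit0_cst.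
  by move=> x _ _; rewrite big_nil.
rewrite big_cons; apply: (@eq_limit0 [::] (fun x => f i x + \sum_(j <- s) f j x)).
  by move=> x _ _; rewrite big_cons.
apply: limit0D; first by apply: H; rewrite mem_head.
by apply: IH => j js; apply: H; rewrite inE js orbT.
Qed.

Lemma limit0_uniq f a b : limit0 f a -> limit0 f b -> a = b.
Proof.
move=> la [b' lb]; have [c] := limit0D la (limit0M (limit0_cst (-1)) (ex_intro _ b' lb)).
rewrite mulN1r => /germ_inj_poly; move/(_ 1 0 (oner_neq0 _)) => [].
  by move=> x _; rewrite mulN1r subrr horner0.
by rewrite coef0 => /esym/eqP; rewrite subr_eq0 => /eqP.
Qed.

(** The additional point 1 / e tends to infinity. If it is selected, its kernel tends to 1 and its
    power survives only for a = M; any other selected point gains the factor t. *)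
Lemma limit_hl_op a M (F F0 : seq K -> K) xs : (a <= M)%N -> good_points xs ->
  (forall ys, good_points ys -> size xs = (size ys).+1 ->
    limit0 (fun e => e ^+ M * F (e^-1 :: ys)) (F0 ys)) ->
  limit0 (fun e => e ^+ M * hl_op a F (e^-1 :: xs))
    ((a == M)%:R * (1 - t) * F xs + t * hl_op a F0 xs).
Proof.
move=> aM gx HF.
pose f1 e := e ^+ (M - a) * hl_kernel t e^-1 xs * F xs.
pose f2 e := \sum_(p <- selections xs)
   p.1 ^+ a * ((e * p.1 - t) * (e * p.1 - 1)^-1 * hl_kernel t p.1 p.2) *
   (e ^+ M * F (e^-1 :: p.2)).
apply: (@eq_limit0 (map (fun x => x^-1) xs) (fun e => (1 - t) * (f1 e + f2 e))).
  move=> e e0 exs; rewrite !hl_opE /= big_cons big_map /= mulrCA; congr (_ * _).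
  rewrite mulrDr; congr (_ + _).
    by rewrite /f1 !mulrA -{2}(subnK aM) exprD exprVn mulfK ?expf_neq0.
  rewrite mulr_sumr; apply: eq_big_seq => p pi.
  have px : p.1 \in xs by rewrite -(perm_mem (selections_perm pi)) mem_head.
  rewrite {2}/hl_kernel big_cons -/(hl_kernel t p.1 p.2).
  have -> : (p.1 - t * e^-1) / (p.1 - e^-1) = (e * p.1 - t) / (e * p.1 - 1).
    have -> : p.1 - t * e^-1 = (e * p.1 - t) * e^-1 by field.
    have -> : p.1 - e^-1 = (e * p.1 - 1) * e^-1 by field.
    by rewrite invfM mulrACA mulfV ?invr_eq0 ?mulr1.
  ring.
have -> : (a == M)%:R * (1 - t) * F xs + t * hl_op a F0 xs =
  (1 - t) * ((a == M)%:R * 1 * F xs + \sum_(p <- selections xs)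
   p.1 ^+ a * (t * hl_kernel t p.1 p.2) * F0 p.2).
  rewrite !hl_opE; set S := \sum_(p <- _) _; set S' := \sum_(p <- _) _.
  have -> : S' = t * S.
    by rewrite /S /S' mulr_sumr; apply: eq_bigr => p _; ring.
  ring.
apply: limit0M; first exact: limit0_cst.
apply: limit0D.
  apply: limit0M; last exact: limit0_cst.
  apply: limit0M.
    have -> : (a == M) = (M - a == 0)%N by rewrite subn_eq0 eqn_leq aM.
    exact: limit0_exp.
  have : 0 \notin xs by case/andP: gx.
  elim: (xs) => [_|z s IH].
    apply: (@eq_limit0 [::] (fun=> 1)); last exact: limit0_cst.
    by move=> x _ _; rewrite /hl_kernel big_nil.
  rewrite inE negb_or eq_sym => /andP[z0 /IH ls].
  apply: (@eq_limit0 [::] (fun e => (1 + (- (t * z)) * e) / (1 + (- z) * e) *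
     hl_kernel t e^-1 s)).
    move=> e e0 _; rewrite {2}/hl_kernel big_cons; congr (_ * _).
    have -> : e^-1 - t * z = (1 + (- (t * z)) * e) * e^-1 by field.
    have -> : e^-1 - z = (1 + (- z) * e) * e^-1 by field.
    by rewrite invfM mulrACA mulfV ?invr_eq0 ?mulr1.
  have l1 c : limit0 (fun e => 1 + c * e) 1.
    have := limit0D (limit0_cst 1) (limit0M (limit0_cst c) limit0_id).
    by rewrite mulr0 addr0.
  have := limit0M (limit0M (l1 (- (t * z))) (limit0V (oner_neq0 _) (l1 (- z)))) ls.
  by rewrite invr1 !mulr1.
apply: limit0_sum => p pi; have [gp p0 _] := good_selections gx pi.
apply: limit0M; last exact: HF (size_selections pi).
apply: limit0M; first exact: limit0_cst.
apply: limit0M; last exact: limit0_cst.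
have l1 c : limit0 (fun e => e * p.1 - c) (- c).
  have := limit0D (limit0M limit0_id (limit0_cst p.1)) (limit0_cst (- c)).
  by rewrite mul0r add0r.
have := limit0M (l1 t) (limit0V _ (l1 1)); rewrite oppr_eq0 oner_neq0.
by rewrite invrN mulrNN invr1 mulr1; exact.
Qed.

(** The point at infinity may take any of the m leading parts equal to [M]; taking the i-th one,
    counted from 0, costs (1 - t) t^i, and these weights add up to 1 - t^m. *)
Lemma limit_hl_val M la xs : is_part la -> (0 < M)%N -> all (geq M) la ->
  good_points xs ->
  limit0 (fun e => e ^+ M * hl_val la (e^-1 :: xs))
    ((1 - t ^+ count_mem M la) * hl_val (behead la) xs).
Proof.
elim: la xs => [|a s IH] xs pa M0.
  move=> _ _; rewrite subrr mul0r /= -[0](mulr1); apply: limit0M; last exact: limit0_cst.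
  by have := limit0_exp M; rewrite (gtn_eqF M0).
move=> /= /andP[aM sM] gx.
have := pa; rewrite is_part_cons => /and3P[a0 sa ps].
have := limit_hl_op aM gx (fun ys gy _ => IH ys ps M0 sM gy).
congr (limit0 _ _); rewrite hl_opZ.
have [eaM|naM] := eqVneq a M; last first.
  rewrite mulr0n !mul0r add0r (_ : count_mem M s = 0%N) ?subrr ?mul0r ?mulr0 //.
  apply/count_memPn/negP => /(allP sa) /= Ma.
  by move: naM; rewrite eqn_leq aM Ma.
subst a; rewrite mul1r add1n exprS.
case: s {IH pa aM} sa sM ps => [|b s] sa sM ps.
  by rewrite /= subrr; ring.
have [bM|bM] := eqVneq b M.
  by subst b; rewrite /=; ring.
rewrite (_ : count_mem M (b :: s) = 0%N) ?subrr; first by rewrite mul0r expr0; ring.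
rewrite /= (negPf bM) add0n; apply/count_memPn/negP.
move: ps sM; rewrite is_part_cons => /and3P[_ /allP + _] /= /andP[Mb _] => /[apply].
by move=> /= Mb'; move: bM; rewrite eqn_leq Mb Mb'.
Qed.

Lemma is_part_head M la : is_part la -> all (geq M) la -> M \in la ->
  la = M :: behead la.
Proof.
case: la => [//|a s]; rewrite is_part_cons => /and3P[_ /allP sa _].
move=> /andP[/= aM _]; rewrite inE => /orP[/eqP-> //|/sa /= Ma].
by congr (_ :: _); apply/eqP; rewrite eqn_leq aM Ma.
Qed.

Lemma is_part_behead la : is_part la -> is_part (behead la).
Proof. by case: la => // a s; rewrite is_part_cons => /and3P[]. Qed.

(** Induction on a bound for the lengths, and inside it on a bound for the parts. The list may
    repeat a partition, hence the conclusion about total coefficients. *)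
Lemma hl_val_independent (L : seq (K * seq nat)) :
  (forall p, p \in L -> is_part p.2) ->
  (forall xs, good_points xs -> \sum_(p <- L) p.1 * hl_val p.2 xs = 0) ->
  forall mu, \sum_(p <- L | p.2 == mu) p.1 = 0.
Proof.
have [l] : exists l, all (fun p => size p.2 <= l)%N L.
  exists (\max_(p <- L) size p.2); apply/allP => p pL.
  by rewrite (big_rem p pL) /= leq_maxl.
elim: l L => [|l IHl] L.
  move=> /allP L0 Lp H mu; have := H [::] (good_points_nil K).
  have [->|mu0] := eqVneq mu [::].
    move=> H0; rewrite -[RHS]H0 [LHS]big_mkcond; apply: eq_big_seq => p pL.
    by have := L0 p pL; case: (p.2) => //= _; rewrite mulr1.
  move=> _; rewrite big_seq_cond big1 // => p /andP[/L0].
  by case: (p.2) mu0 => //= mu0 _ /eqP m; rewrite -m in mu0.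
have [M] : exists M, all (fun p : K * seq nat => all (geq M) p.2) L.
  exists (\max_(p <- L) \max_(i <- p.2) i); apply/allP => p pL; apply/allP => i ip.
  by rewrite /= (big_rem p pL) /= (big_rem i ip) /= leq_max leq_maxl.
elim: M L => [|M IHM] L LM Ll Lp H.
  apply: IHl => //; apply/allP => p pL.
  have := allP LM p pL; have := Lp p pL; case: (p.2) => // a s.
  by rewrite is_part_cons => /and3P[+ _ _] /= /andP[]; lia.
(* The leading coefficient as one point tends to infinity. Each partition containing [M.+1] loses
   its first part, so the induction on lengths applies. *)
pose L1 := [seq (p.1 * (1 - t ^+ count_mem M.+1 p.2), behead p.2) |
             p <- L & M.+1 \in p.2].
have H1 : forall mu, \sum_(p <- L1 | p.2 == mu) p.1 = 0.
  apply: IHl.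
  - apply/allP => _ /mapP[p + ->]; rewrite mem_filter => /andP[Mp pL] /=.
    by have := allP Ll p pL; rewrite /= size_behead; lia.
  - move=> _ /mapP[p + ->]; rewrite mem_filter => /andP[_ pL].
    exact/is_part_behead/Lp.
  move=> xs gx.
  have := limit0_sum (fun (p : K * seq nat) pL => limit0M (limit0_cst p.1)
    (limit_hl_val (Lp p pL) (ltn0Sn M) (allP LM p pL) gx)).
  move=> /(@eq_limit0 (map (fun x => x^-1) xs) _ (fun=> 0)).
  have /[swap]/[apply] : forall x, x != 0 -> x \notin [seq x^-1 | x <- xs] ->
    \sum_(p <- L) p.1 * (x ^+ M.+1 * hl_val p.2 (x^-1 :: xs)) = 0.
    move=> x x0 xx; have gxx : good_points (x^-1 :: xs).
      move: gx; rewrite /good_points /= inE negb_or => /andP[-> ->].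
      rewrite eq_sym invr_eq0 x0 !andbT; apply: contra xx => xx.
      by rewrite -[x]invrK map_f.
    under eq_bigr do rewrite mulrCA.
    by rewrite -mulr_sumr H // mulr0.
  move=> /limit0_uniq /(_ (limit0_cst 0)) S0; rewrite -[RHS]S0.
  rewrite big_map big_filter big_mkcond /=; apply: eq_bigr => p _.
  by case: ifPn => [_|/count_memPn ->]; rewrite ?mulrA // subrr ?mul0r ?mulr0 ?mul0r ?mulr0.
(* A partition bounded by [M.+1] and containing it is determined by its tail, so fibers over [mu]
   and over [behead mu] correspond; the factor 1 - t^m is nonzero. *)
have H2 mu : M.+1 \in mu -> \sum_(p <- L | p.2 == mu) p.1 = 0.
  move=> Mmu; have [/hasP[p0 p0L /eqP p0mu]|/hasPn nL] := boolP (has (fun p => p.2 == mu) L); last first.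
    by rewrite big_seq_cond big1 // => p /andP[/nL/negPf->].
  have muE : mu = M.+1 :: behead mu.
    by rewrite -p0mu in Mmu *; apply: is_part_head (Lp _ p0L) (allP LM _ p0L) Mmu.
  have := H1 (behead mu); rewrite big_map big_filter_cond big_seq_cond.
  rewrite (eq_bigl (fun p => (p \in L) && (p.2 == mu))) => [|p].
    rewrite (eq_bigr (fun p => p.1 * (1 - t ^+ count_mem M.+1 mu))); last first.
      by move=> p /andP[_ /eqP pmu]; rewrite /= pmu.
    rewrite -mulr_suml -big_seq_cond => /eqP; rewrite mulf_eq0 subr_eq0.
    rewrite eq_sym; have [|_] := eqVneq (t ^+ _) 1; last by rewrite orbF => /eqP.
    move=> tc; have := t_nunity (i := count_mem M.+1 mu); rewrite tc eqxx.
    by rewrite -has_count has_pred1 => /(_ Mmu).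
  have [pL|//] := boolP (p \in L); rewrite /=; apply/andP/eqP => [[Mp /eqP bp]|->]; last first.
    by rewrite Mmu eqxx.
  by rewrite muE -bp; apply: is_part_head (Lp _ pL) (allP LM _ pL) Mp.
pose L2 := [seq p <- L | M.+1 \notin p.2].
have L2L p : p \in L2 -> p \in L by rewrite mem_filter => /andP[].
move=> mu; have [Mmu|Mmu] := boolP (M.+1 \in mu); first exact: H2.
rewrite -[RHS](IHM L2 _ _ _ _ mu).
- rewrite big_filter_cond; apply: eq_bigl => p.
  by rewrite andbC; case: eqP => // ->.
- apply/allP => p; rewrite mem_filter => /andP[Mp /(allP LM)/= Lpp].
  apply/allP => i ip /=; have := allP Lpp _ ip; rewrite /= leq_eqVlt ltnS.
  by case: eqP => // ei; move: Mp; rewrite -ei ip.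
- by apply/allP => p /L2L/(allP Ll).
- by move=> p /L2L/Lp.
(* The partitions containing [M.+1] have total coefficient 0 by [H2] and drop out of the
   relation. *)
move=> xs gx; rewrite -[RHS](H xs gx) big_filter [RHS](bigID (fun p => M.+1 \notin p.2)) /=.
rewrite -[LHS]addr0; congr (_ + _).
rewrite -big_filter (@sum_fibers K _ _ (fun la => hl_val la xs)) // => nu.
rewrite big_filter_cond; have [Mnu|Mnu] := boolP (M.+1 \in nu).
  rewrite -[RHS](H2 _ Mnu); apply: eq_bigl => p; rewrite negbK andbC.
  by case: eqP => // ->.
by rewrite big1 // => p /andP[+ /eqP pnu]; rewrite pnu (negPf Mnu).
Qed.

(** * Values on geometric progressions *)

Definition t_string (x : K) (n : nat) := traject ( *%R t) x n.

Lemma mem_t_string x n y : y \in t_string x n -> exists i, y = x * t ^+ i.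
Proof.
case/trajectP => i _ ->; exists i; elim: i => [|i IH]; first by rewrite mulr1.
by rewrite iterS IH exprS mulrCA.
Qed.

Lemma t_expI : injective (fun i => t ^+ i).
Proof.
move=> i j; wlog ij : i j / (i <= j)%N => [H|].
  by have [/H//|/ltnW/H H' /esym/H'] := leqP i j.
move=> /= tij; apply/eqP; rewrite eqn_leq ij leqNgt; apply/negP => ji.
have := t_nunity (i := j - i); rewrite subn_gt0 => /(_ ji).
have /(mulfI (expf_neq0 i t0)) -> : t ^+ i * t ^+ (j - i) = t ^+ i * 1.
  by rewrite -exprD subnKC // mulr1 tij.
by rewrite eqxx.
Qed.

Lemma good_t_string x n : x != 0 -> good_points (t_string x n).
Proof.
move=> x0; elim: n x x0 => // n IH x x0; have tx0 := mulf_neq0 t0 x0.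
have /andP[u z] := IH _ tx0; rewrite /good_points /t_string /= inE negb_or eq_sym x0.
rewrite u z !andbT; apply/negP => /mem_t_string[ i ] /eqP.
rewrite mulrAC -exprS -{1}[x]mul1r (inj_eq (mulIf x0)) eq_sym.
by apply/negP/t_nunity.
Qed.

Lemma hl_kernel_eq0 y (r : seq K) z : z \in r -> y = t * z -> hl_kernel t y r = 0.
Proof.
by move=> zr ->; rewrite /hl_kernel (big_rem z zr) /= subrr !mul0r.
Qed.

(** The product telescopes, as its factors are (1 - t^(j + 1)) / (1 - t^j) for j from k on. Only k =
    1 is applied, but the induction moves k. *)
Lemma hl_kernel_t_string x n k : x != 0 -> (0 < k)%N ->
  (1 - t ^+ k) * hl_kernel t x (t_string (t ^+ k * x) n) = 1 - t ^+ (n + k).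
Proof.
move=> x0; elim: n k => [|n IH] k k0; first by rewrite /hl_kernel big_nil mulr1.
have xk : x - t ^+ k * x != 0.
  by rewrite -{1}[x]mul1r -mulrBl mulf_neq0 // subr_eq0 eq_sym t_nunity.
rewrite addSnnS -(IH k.+1) // /hl_kernel /t_string trajectS big_cons exprS -[t * _ * x]mulrA [LHS]mulrA.
by congr (_ * _); field.
Qed.

Lemma t_string_pred x n y : y \in t_string (t * x) n ->
  exists2 z, z \in x :: t_string (t * x) n & y = t * z.
Proof.
elim: n x => [//|n IH] x; rewrite {1}/t_string /= inE => /orP[/eqP ->|/IH[z zs ->]].
  by exists x; rewrite ?mem_head.
by exists z => //; rewrite inE zs orbT.
Qed.

(** Every point y other than the first is t times another point of the progression, so its kernel
    vanishes and the sum reduces to one term. *)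
Lemma hl_op_t_string a F x n : x != 0 ->
  hl_op a F (t_string x n.+1) =
  x ^+ a * (1 - t ^+ n.+1) * F (t_string (t * x) n).
Proof.
move=> x0; rewrite !hl_opE [selections _]/= big_cons big_map big_seq big1 ?addr0.
  have := @hl_kernel_t_string x n 1 x0 isT; rewrite expr1 addn1 => <- /=; ring.
move=> p pi /=; have ps : p.1 \in t_string (t * x) n.
  by rewrite -(perm_mem (selections_perm pi)) mem_head.
have [z zs pz] := t_string_pred ps.
have [_ p0 _] := good_selections (good_t_string n (mulf_neq0 t0 x0)) pi.
have zp : z \in x :: p.2.
  move: zs; rewrite !inE -(perm_mem (selections_perm pi)) inE.
  case/orP => [->//|/orP[/eqP zp|->]]; last by rewrite orbT.
  have := t_nunity (ltn0Sn 0); rewrite expr1 -(inj_eq (mulIf p0)) mul1r {2}pz zp.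
  by rewrite eqxx.
by rewrite (hl_kernel_eq0 zp pz) mulr0 mul0r.
Qed.

(** Each part shifts the progression from x to t x, and the powers of t collect to n(la). If there
    are fewer points than parts, the truncated [n - i] produces a factor 1 - t^0 = 0. *)
Lemma hl_val_t_string la x n : x != 0 ->
  hl_val la (t_string x n) =
  x ^+ sumn la * t ^+ part_weight la * \prod_(i < size la) (1 - t ^+ (n - i)).
Proof.
elim: la x n => [|a s IH] x n x0; first by rewrite /= big_ord0 !mulr1.
case: n => [|n].
  by rewrite [LHS]hl_val_nil [size _]/= big_ord_recl subn0 subrr mul0r mulr0.
rewrite [LHS](hl_op_t_string _ (hl_val s)) // IH ?mulf_neq0 //.
rewrite [size _]/= big_ord_recl subn0 /= exprMn !exprD.
under [in RHS]eq_bigr do rewrite /bump /= add1n subSS.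
ring.
Qed.

End Independence.

(** * From symmetric functions to their values *)

Section MonomialEvaluation.
Variables (I : choiceType) (A : comNzRingType).

Definition monom_eval (e : I -> A) (m : cmonom I) : A :=
  \prod_(i <- finsupp m) e i ^+ m i.

Lemma monom_evalw (e : I -> A) (m : cmonom I) (d : {fset I}) :
  (finsupp m `<=` d)%fset -> monom_eval e m = \prod_(i <- d) e i ^+ m i.
Proof.
move=> le; rewrite /monom_eval (big_fset_incl _ le) // => i _.
by rewrite -cmE_neq0 negbK => /eqP ->.
Qed.

Lemma monom_eval_mmorphism (e : I -> A) : mmorphism (monom_eval e).
Proof.
split=> [m1 m2|]; last by rewrite /monom_eval mdom1 big_seq_fset0.
rewrite {1}/monom_eval mdomD.
rewrite (monom_evalw _ (fsubsetUl _ (finsupp m2))).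
rewrite (monom_evalw _ (fsubsetUr (finsupp m1) _)).
by rewrite -big_split /=; apply: eq_bigr => i _; rewrite cmM exprD.
Qed.

HB.instance Definition _ (e : I -> A) :=
  monalg.isMultiplicative.Build (cmonom I) A (monom_eval e)
    (monom_eval_mmorphism e).

Lemma monom_evalU (e : I -> A) i : monom_eval e (ucm i) = e i.
Proof. by rewrite /monom_eval mdomU big_seq_fset1 cmUU expr1. Qed.

End MonomialEvaluation.

Section SymFunEvaluation.
Variable K : fieldType.

(** The map on coefficients is a separate argument, so that an evaluation can be pushed through any
    ring morphism, in particular into and out of polynomial rings. *)
Definition symfun_eval (A : comNzRingType) (f : K -> A) (c : nat -> A)
    (g : symfun K) : A :=
  \sum_(m <- msupp g) f (mcoeff m g) * monom_eval c m.

Lemma symfun_homE (A : comAlgType K) (c : nat -> A) g :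
  symfun_hom c g = symfun_eval (in_alg A) c g.
Proof. by []. Qed.

Lemma specializeE c g : specialize c g = symfun_eval id c g.
Proof.
rewrite /specialize symfun_homE; apply: eq_bigr => m _; congr (_ * _).
exact: mulr1.
Qed.

Lemma symfun_eval_morph (A B : comNzRingType) (h : {rmorphism A -> B})
    (f : K -> A) (c : nat -> A) g :
  h (symfun_eval f c g) = symfun_eval (h \o f) (h \o c) g.
Proof.
rewrite rmorph_sum; apply: eq_bigr => m _; rewrite rmorphM; congr (_ * _).
by rewrite rmorph_prod; apply: eq_bigr => i _; rewrite rmorphXn.
Qed.

Lemma eq_symfun_eval (A : comNzRingType) (f f' : K -> A) (c c' : nat -> A) g :
  f =1 f' -> c =1 c' -> symfun_eval f c g = symfun_eval f' c' g.
Proof.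
move=> ff cc; apply: eq_bigr => m _; rewrite ff; congr (_ * _).
by apply: eq_bigr => i _; rewrite cc.
Qed.

Lemma symfun_evalZ (c : nat -> K) a g :
  symfun_eval id c (a *: g) = a * symfun_eval id c g.
Proof. exact: (@mmapZ _ _ _ idfun). Qed.

Lemma symfun_eval0 (c : nat -> K) : symfun_eval id c 0 = 0.
Proof. by rewrite /symfun_eval msupp0 big_seq_fset0. Qed.

Definition symfun2_eval (e : nat + nat -> K) : symfun2 K -> K :=
  mmap idfun (monom_eval e).

Lemma symfun2_evalM e : {morph symfun2_eval e : g h / g * h}.
Proof. by move=> g h; rewrite /symfun2_eval rmorphM. Qed.

Lemma symfun2_hom_eval (e : nat + nat -> K) (c : nat -> symfun2 K) (g : symfun K) :
  symfun2_eval e (symfun_hom c g) = symfun_eval id (symfun2_eval e \o c) g.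
Proof.
rewrite symfun_homE.
etransitivity; first exact: (symfun_eval_morph (symfun2_eval e : {rmorphism symfun2 K -> K})).
apply: eq_symfun_eval => // a /=.
by rewrite /symfun2_eval (@mmapZ _ _ _ idfun) /= rmorph1 mulr1.
Qed.

Lemma symfun2_eval_psum2 e i : symfun2_eval e (psum2 K i) = e i.
Proof. by rewrite /symfun2_eval mmapU /= mul1r monom_evalU. Qed.

Lemma symfun2_eval_in_x e (g : symfun K) :
  symfun2_eval e (in_x g) = symfun_eval id (e \o inl) g.
Proof.
by rewrite symfun2_hom_eval; apply: eq_symfun_eval => // i; exact: symfun2_eval_psum2.
Qed.

Lemma symfun2_eval_in_y e (g : symfun K) :
  symfun2_eval e (in_y g) = symfun_eval id (e \o inr) g.
Proof.
by rewrite symfun2_hom_eval; apply: eq_symfun_eval => // i; exact: symfun2_eval_psum2.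
Qed.

Lemma symfun2_eval_in_xy e (g : symfun K) :
  symfun2_eval e (in_xy g) = symfun_eval id (fun i => e (inl i) + e (inr i)) g.
Proof.
rewrite symfun2_hom_eval; apply: eq_symfun_eval => // i.
rewrite -[e (inl i)]symfun2_eval_psum2 -[e (inr i)]symfun2_eval_psum2.
exact: (rmorphD (symfun2_eval e : {rmorphism symfun2 K -> K})).
Qed.

Definition psums (xs : seq K) (k : nat) : K := \sum_(x <- xs) x ^+ k.+1.

Lemma meval_in_vars n (v : 'I_n -> K) (g : symfun K) :
  meval v (in_vars n g) = symfun_eval id (psums (map v (enum 'I_n))) g.
Proof.
rewrite /in_vars symfun_homE.
etransitivity; first exact: (symfun_eval_morph (meval v : {rmorphism mpoly n K -> K})).
apply: eq_symfun_eval => [a|k] /=; first by rewrite mevalZ rmorph1 mulr1.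
rewrite rmorph_sum /psums big_map big_enum; apply: eq_bigr => i _.
by rewrite rmorphXn /= mevalXU.
Qed.

End SymFunEvaluation.

Section FractionEvaluation.
Variables (K : fieldType) (n : nat) (v : 'I_n -> K).

(** Evaluation at [v] is a relation because a fraction may have representatives whose denominator
    vanishes at [v]; one good representative is required. *)
Definition frac_eval (q : {fraction mpoly n K}) (a : K) : Prop :=
  exists p d : mpoly n K,
    [/\ meval v d != 0, q = tofrac p / tofrac d & a = meval v p / meval v d].

Lemma frac_den_neq0 (d : mpoly n K) : meval v d != 0 -> tofrac d != 0 :> {fraction mpoly n K}.
Proof. by rewrite tofrac_eq0; apply: contraNneq => ->; rewrite meval0. Qed.

Lemma frac_eval_tofrac (p : mpoly n K) : frac_eval (tofrac p) (meval v p).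
Proof.
by exists p, 1; rewrite meval1 oner_neq0 tofrac1 !divr1.
Qed.

Lemma frac_evalM q a q' a' : frac_eval q a -> frac_eval q' a' ->
  frac_eval (q * q') (a * a').
Proof.
move=> [p [d [d0 -> ->]]] [p' [d' [d0' -> ->]]]; exists (p * p'), (d * d').
by rewrite !mevalM !tofracM mulf_neq0 // !mulf_div.
Qed.

Lemma frac_evalD q a q' a' : frac_eval q a -> frac_eval q' a' ->
  frac_eval (q + q') (a + a').
Proof.
move=> [p [d [d0 -> ->]]] [p' [d' [d0' -> ->]]].
exists (p * d' + p' * d), (d * d').
by rewrite !(mevalD, mevalM) !(tofracD, tofracM) mulf_neq0 // !addf_div // frac_den_neq0.
Qed.

Lemma frac_evalV q a : a != 0 -> frac_eval q a -> frac_eval q^-1 a^-1.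
Proof.
move=> a0 [p [d [d0 qE aE]]]; exists d, p; rewrite qE aE !invf_div; split => //.
by move: a0; rewrite aE; apply: contraNneq => ->; rewrite mul0r.
Qed.

Lemma frac_eval1 : frac_eval 1 1.
Proof. by rewrite -tofrac1 -(meval1 v); exact: frac_eval_tofrac. Qed.

Lemma frac_eval_prod (I : Type) (s : seq I) (P : pred I) q a :
  (forall i, P i -> frac_eval (q i) (a i)) ->
  frac_eval (\prod_(i <- s | P i) q i) (\prod_(i <- s | P i) a i).
Proof.
move=> H; elim/big_rec2: _ => [|i y1 y2 Pi Hy]; first exact: frac_eval1.
by apply: frac_evalM => //; apply: H.
Qed.

Lemma frac_eval_sum (I : Type) (s : seq I) (P : pred I) q a :
  (forall i, P i -> frac_eval (q i) (a i)) ->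
  frac_eval (\sum_(i <- s | P i) q i) (\sum_(i <- s | P i) a i).
Proof.
move=> H; elim/big_rec2: _ => [|i y1 y2 Pi Hy].
  by rewrite -tofrac0 -(meval0 v); exact: frac_eval_tofrac.
by apply: frac_evalD => //; apply: H.
Qed.

Lemma frac_evalX q a k : frac_eval q a -> frac_eval (q ^+ k) (a ^+ k).
Proof.
move=> H; elim: k => [|k IH]; first by rewrite !expr0; exact: frac_eval1.
by rewrite !exprS; exact: frac_evalM.
Qed.

Lemma frac_eval_inj (p : mpoly n K) a : frac_eval (tofrac p) a -> meval v p = a.
Proof.
move=> [p' [d [d0 E ->]]]; have /eqP : tofrac (p * d) = tofrac p'.
  by rewrite tofracM E divfK // frac_den_neq0.
by rewrite tofrac_eq => /eqP <-; rewrite mevalM mulfK.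
Qed.

End FractionEvaluation.

(** * The sum over permutations as an iterated operator *)

Section PermSum.
Variables (K : numFieldType) (t : K).

Definition perm_sum (n : nat) (a : nat -> nat) (v : 'I_n -> K) : K :=
  \sum_(s : {perm 'I_n})
    ((\prod_(i < n) v (s i) ^+ a i) *
     \prod_(i < n) \prod_(j < n | (i < j)%N)
       ((v (s i) - t * v (s j)) / (v (s i) - v (s j)))).

Lemma frac_eval_hl_poly n la (v : 'I_n -> K) : injective v ->
  frac_eval v (hl_poly t n la) ((hl_v t n la)^-1 * perm_sum (nth 0%N la) v).
Proof.
move=> vi; apply: frac_evalM; first by rewrite -[X in frac_eval _ _ X](mevalC v); exact: frac_eval_tofrac.
apply: frac_eval_sum => s _; apply: frac_evalM.
  apply: frac_eval_prod => i _; apply: frac_evalX; rewrite -[X in frac_eval _ _ X](mevalXU v).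
  exact: frac_eval_tofrac.
apply: frac_eval_prod => i _; apply: frac_eval_prod => j ij.
have -> : v (s i) - t * v (s j) = meval v (var K (s i) - t *: var K (s j)).
  by rewrite mevalB mevalZ !mevalXU.
have e : v (s i) - v (s j) = meval v (var K (s i) - var K (s j)).
  by rewrite mevalB !mevalXU.
rewrite e; apply: frac_evalM; first exact: frac_eval_tofrac.
apply: frac_evalV; last exact: frac_eval_tofrac.
rewrite -e subr_eq0; apply/eqP => /vi/perm_inj ij'.
by rewrite ij' ltnn in ij.
Qed.

(** A permutation is the image i of the first index together with a permutation of the rest. The
    pairs that involve the first index make up the kernel of [v i]. *)
Lemma perm_sum_recl n (a : nat -> nat) (v : 'I_n.+1 -> K) :
  perm_sum a v = \sum_(i < n.+1) v i ^+ a 0%N *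
    (\prod_(j < n) ((v i - t * v (lift i j)) / (v i - v (lift i j)))) *
    perm_sum (a \o S) (v \o lift i).
Proof.
pose lp (p : 'I_n.+1 * {perm 'I_n}) := lift_perm ord0 p.1 p.2.
have lp_bij : bijective lp.
  apply: inj_card_bij; last by rewrite card_prod card_ord !card_Sn factS.
  move=> [i s] [i' s'] /permP E; have := E ord0; rewrite !lift_perm_id => /= ii.
  subst i'; congr (_, _); apply/permP => k; have := E (lift ord0 k).
  by rewrite !lift_perm_lift => /lift_inj.
rewrite /perm_sum (reindex lp (onW_bij _ lp_bij)) /=.
under [RHS]eq_bigr do rewrite mulr_sumr.
rewrite pair_bigA /=; apply: eq_bigr => -[i s] _; rewrite /lp /=.
rewrite !big_ord_recl lift_perm_id.
rewrite mulrACA; congr (_ * _ * (_ * _)).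
- rewrite big_mkcond big_ord_recl /= mul1r [RHS](reindex_inj (@perm_inj _ s)).
  by apply: eq_bigr => j _; rewrite lift_perm_lift.
- by apply: eq_bigr => j _; rewrite lift_perm_lift.
- apply: eq_bigr => j _; rewrite big_mkcond big_ord_recl /= mul1r [RHS]big_mkcond.
  by apply: eq_bigr => k _; rewrite !lift_perm_lift.
Qed.

(** Since [selections] preserves the order of the remaining points, they are literally the values of
    [v] along [lift i]. *)
Lemma selections_enum n (v : 'I_n.+1 -> K) :
  selections (map v (enum 'I_n.+1)) =
  [seq (v i, map (v \o lift i) (enum 'I_n)) | i <- enum 'I_n.+1].
Proof.
elim: n v => [|n IH] v; first by rewrite enum_ordSl enum_ord0.
have selE (x : K) s : selections (x :: s) =
  (x, s) :: [seq (p.1, x :: p.2) | p <- selections s] by [].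
rewrite enum_ordSl !map_cons -(map_comp v) selE (IH (v \o lift ord0)).
rewrite -(map_comp (fun p => (p.1, _ :: p.2))) -(map_comp (fun i => (v i, _))).
congr (_ :: _); apply: eq_map => i; rewrite [LHS]/= [RHS]/=; congr (_, _).
rewrite enum_ordSl map_cons -(map_comp (v \o _)); congr (_ :: _).
  by congr v; exact: val_inj.
apply: eq_map => k; rewrite [LHS]/= [RHS]/=; congr (v _); apply: val_inj => /=.
by rewrite /bump !leq0n !add1n ltnS addnS.
Qed.

Lemma perm_sumE n (a : nat -> nat) (v : 'I_n -> K) :
  (1 - t) ^+ n * perm_sum a v = hl_val t (mkseq a n) (map v (enum 'I_n)).
Proof.
elim: n a v => [|n IH] a v.
  rewrite /perm_sum /= mul1r (big_pred1 1%g) ?big_ord0 ?mulr1 // => s.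
  by apply/esym/eqP/permP => -[].
have -> : mkseq a n.+1 = a 0%N :: mkseq (a \o S) n.
  by rewrite /mkseq /= (iotaDl 1 0 n) -map_comp.
rewrite [RHS]/= /hl_op selections_enum big_map big_enum exprS -mulrA /=; congr (_ * _).
rewrite perm_sum_recl mulr_sumr; apply: eq_bigr => i _.
by rewrite mulrCA IH /hl_kernel big_map big_enum.
Qed.

(** The k padding zeros act on constants, one factor 1 - t^j each by [hl_op0_const]. This is the
    contribution of m_0 to v_la. *)
Lemma hl_val_zeros k la xs : size xs = (size la + k)%N -> good_points xs ->
  hl_val t (la ++ nseq k 0%N) xs = tpoch t k * hl_val t la xs.
Proof.
elim: la xs => [|a la IH] xs.
  rewrite add0n mulr1; elim: k xs => [|k IH] xs sx gx /=.
    by rewrite /tpoch big_nil.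
  rewrite -sx in IH *; rewrite (@eq_hl_op _ _ _ _ (fun=> tpoch t k)) //.
    by rewrite hl_op0_const // sx /tpoch [RHS]big_nat_recr //= mulrC.
  by move=> ys gy; rewrite sx => -[sy]; rewrite IH.
move=> sx gx; rewrite /= -hl_opZ; apply: eq_hl_op => // ys gy.
by rewrite sx => -[sy]; rewrite -IH.
Qed.

Lemma sum_part_mult M la : 0%N \notin la -> all (geq M) la ->
  (\sum_(1 <= i < M.+1) count_mem i la)%N = size la.
Proof.
elim: la => [|a s IH]; first by rewrite big1.
rewrite inE negb_or => /andP[a0 s0] /= /andP[aM sM].
rewrite big_split /= IH // -[(size s).+1]add1n; congr (_ + _)%N.
have ai : a \in index_iota 1 M.+1 by rewrite mem_index_iota ltnS aM lt0n eq_sym a0.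
rewrite (bigD1_seq a ai (iota_uniq _ _)) /= eqxx.
by rewrite big1 // => i; rewrite eq_sym => /negPf ->.
Qed.

(** Macdonald's b_la(t), the ratio Q_la / P_la. *)
Definition hl_b (la : seq nat) : K :=
  \prod_(1 <= i < (nth 0%N la 0).+1) tpoch t (count_mem i la).

Lemma is_part_all la : is_part la -> all (geq (nth 0%N la 0)) la.
Proof. by case: la => // a s; rewrite is_part_cons /= leqnn => /and3P[]. Qed.

Hypothesis t_nunity : forall i, (0 < i)%N -> t ^+ i != 1.

Lemma tpoch_neq0 m : tpoch t m != 0.
Proof.
rewrite prodf_seq_neq0; apply/allP => i; rewrite mem_index_iota => /andP[i0 _].
by rewrite subr_eq0 eq_sym t_nunity.
Qed.

Lemma hl_b_neq0 la : hl_b la != 0.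
Proof. by rewrite prodf_seq_neq0; apply/allP => i _; rewrite tpoch_neq0. Qed.

Lemma intpart_is_part (la : intpart) : is_part la. Proof. exact: partsP. Qed.

Lemma hl_vE n (la : intpart) : (size la <= n)%N ->
  hl_v t n la = tpoch t (n - size la) * hl_b la / (1 - t) ^+ n.
Proof.
move=> ln; rewrite /hl_v big_nat_recl // /padded_mult /=.
have [_ la0] := andP (intpart_is_part la).
have -> : \prod_(0 <= i < nth 0%N la 0)
    (tpoch t (part_mult la i.+1) / (1 - t) ^+ part_mult la i.+1) =
  \prod_(1 <= i < (nth 0%N la 0).+1)
    (tpoch t (count_mem i la) / (1 - t) ^+ count_mem i la) by rewrite big_add1.
rewrite big_split /= prodfV -expr_sum.
rewrite sum_part_mult ?is_part_all ?intpart_is_part //.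
have -> : (1 - t) ^+ n = (1 - t) ^+ (n - size la) * (1 - t) ^+ size la.
  by rewrite -exprD subnK.
by rewrite /part_mult -/(hl_b la) invfM; ring.
Qed.

Definition is_hl_P (la : intpart) (f : symfun K) : Prop :=
  forall n, (size la <= n)%N -> tofrac (in_vars n f) = hl_poly t n la.

Lemma hl_P_eval_large la f xs : is_hl_P la f -> good_points xs ->
  (size la <= size xs)%N ->
  symfun_eval id (psums xs) f = hl_val t la xs / hl_b la.
Proof.
move=> Pf gx lx; pose v := tnth (in_tuple xs).
have vE : map v (enum 'I_(size xs)) = xs by rewrite map_tnth_enum.
have vi : injective v by apply/tuple_uniqP; case/andP: gx.
have := @frac_eval_hl_poly _ la v vi; rewrite -Pf // => /frac_eval_inj.
rewrite meval_in_vars vE => ->.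
have t1 : (1 - t) ^+ size xs != 0.
  by rewrite expf_neq0 // subr_eq0 eq_sym -[t]expr1 t_nunity.
apply: (mulfI t1); rewrite mulrCA perm_sumE vE.
have -> : mkseq (nth 0%N la) (size xs) = la ++ nseq (size xs - size la) 0%N.
  apply: (@eq_from_nth _ 0%N); rewrite size_mkseq ?size_cat ?size_nseq ?subnKC // => i ix.
  rewrite nth_mkseq // nth_cat; case: ltnP => // li; rewrite nth_nseq nth_default //.
  by case: ifP.
rewrite hl_val_zeros ?subnKC // hl_vE //.
by field; rewrite t1 tpoch_neq0 hl_b_neq0.
Qed.

End PermSum.

Lemma lower_in v la : is_part la -> v \in la ->
  [/\ is_part (lower v la), sumn la = (sumn (lower v la)).+1 &
    forall M, all (geq M) la -> all (geq M) (lower v la)].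
Proof.
elim: la => [//|a s IH]; rewrite is_part_cons => /and3P[a0 sa ps].
rewrite [v \in _]inE /=; have [vs _|vs] := boolP (v \in s).
  have [pl sl al] := IH ps vs; rewrite is_part_cons a0 pl (al _ sa) sl /=.
  by split=> // [|M /andP[-> /al]//]; lia.
rewrite orbF eq_sym => /eqP av; rewrite av eqxx; subst v.
have [a1|a1] := eqVneq a 1%N.
  by split=> // [|M /andP[]//]; rewrite a1.
rewrite is_part_cons ps /=; split; [|lia|].
  rewrite andbT; apply/andP; split; first by lia.
  apply/allP => i si /=; have /= := allP sa i si.
  have : i != a by apply: contraNneq vs => <-.
  lia.
by move=> M /andP[aM ->]; rewrite andbT; lia.
Qed.

Lemma is_part_lower v la : is_part la -> is_part (lower v la).
Proof.
by move=> pa; have [/(lower_in pa)[]//|/lower_notin->] := boolP (v \in la).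
Qed.

Lemma all_lower M v la : is_part la -> all (geq M) la -> all (geq M) (lower v la).
Proof.
move=> pa; have [/(lower_in pa)[_ _]|/lower_notin->//] := boolP (v \in la).
by apply.
Qed.

(** * Taylor expansion in p_1 *)

Section Taylor.
Variables (K : numFieldType) (t : K).
Hypothesis t0 : t != 0.
Hypothesis t_nunity : forall i, (0 < i)%N -> t ^+ i != 1.
Local Notation hl_val := (hl_val t).

(** The n-th derivative of Q_la in p_1, by iterating [hl_deriv]. *)
Fixpoint hl_iter (M n : nat) (la : seq nat) (xs : seq K) : K :=
  if n is n'.+1 then
    \sum_(v <- iota 1 M) (1 - t ^+ count_mem v la) * hl_iter M n' (lower v la) xs
  else hl_val la xs.

Lemma germ_hl_iter M n la xs : is_part la -> all (geq M) la -> good_points xs ->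
  germ (fun e => hl_iter M n la (e :: xs)) (hl_iter M n la xs)
    (hl_iter M n.+1 la xs).
Proof.
elim: n la => [|n IH] la pa aM gx; first exact: germ_hl_val.
apply: germ_sum => v _.
have := germM (germ_cst (1 - t ^+ count_mem v la))
  (IH (lower v la) (is_part_lower v pa) (all_lower v pa aM) gx).
by rewrite mul0r addr0.
Qed.

Lemma hl_iter_eq0 M n la xs : is_part la -> (sumn la < n)%N ->
  hl_iter M n la xs = 0.
Proof.
elim: n la => [//|n IH] la pa ln /=; rewrite big1 // => v _.
have [vl|vl] := boolP (v \in la); last by rewrite (count_memPn vl) subrr mul0r.
have [pl sl _] := lower_in pa vl.
by rewrite IH ?mulr0 // -ltnS -sl.
Qed.

Fixpoint descents (M n : nat) (la : seq nat) : seq (K * seq nat) :=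
  if n is n'.+1 then
    flatten [seq [seq ((1 - t ^+ count_mem v la) * p.1, p.2)
      | p <- descents M n' (lower v la)] | v <- iota 1 M]
  else [:: (1, la)].

Lemma hl_iterE M n la xs :
  hl_iter M n la xs = \sum_(p <- descents M n la) p.1 * hl_val p.2 xs.
Proof.
elim: n la => [|n IH] la /=; first by rewrite big_seq1 mul1r.
rewrite big_flatten big_map /=; apply: eq_bigr => v _.
by rewrite IH big_map mulr_sumr; apply: eq_bigr => p _; rewrite mulrA.
Qed.

(** Coefficient of Q_mu in the n-th p_1-derivative of Q_la: a sum over chains from la down to mu,
    where removing the bottom box of column v weighs 1 - t^m with m the multiplicity of v before the
    removal. *)
Definition descent_coef M n (mu la : seq nat) : K :=
  \sum_(p <- descents M n la | p.2 == mu) p.1.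

Lemma descent_coef0 M mu la : descent_coef M 0 mu la = (la == mu)%:R.
Proof.
by rewrite /descent_coef /= big_cons big_nil addr0 /=; case: ifP.
Qed.

Lemma descent_coefS M n mu la : descent_coef M n.+1 mu la =
  \sum_(v <- iota 1 M) (1 - t ^+ count_mem v la) * descent_coef M n mu (lower v la).
Proof.
rewrite /descent_coef /= big_flatten big_map; apply: eq_bigr => v _.
by rewrite big_map mulr_sumr.
Qed.

Lemma is_part_descents M n la p : is_part la -> p \in descents M n la ->
  is_part p.2.
Proof.
elim: n la p => [|n IH] la p pa /=; first by rewrite inE => /eqP ->.
case/flatten_mapP => v _ /mapP[q qi ->] /=; exact: IH (is_part_lower v pa) qi.
Qed.

Lemma psums_nil : psums ([::] : seq K) =1 (fun=> 0).
Proof. by move=> k; rewrite /psums big_nil. Qed.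

Definition adjoin_poly (f : symfun K) (xs : seq K) : {poly K} :=
  symfun_eval polyC (fun k => (psums xs k)%:P + 'X^(k.+1)) f.

Lemma horner_adjoin f xs e :
  (adjoin_poly f xs).[e] = symfun_eval id (psums (e :: xs)) f.
Proof.
rewrite -[LHS]/(horner_eval e _) symfun_eval_morph; apply: eq_symfun_eval.
  by move=> a; rewrite /= /horner_eval hornerC.
by move=> k; rewrite /= /horner_eval hornerD hornerC hornerXn /psums big_cons addrC.
Qed.

Lemma adjoin_coef0 f xs : (adjoin_poly f xs)`_0 = symfun_eval id (psums xs) f.
Proof.
rewrite -horner_coef0 horner_adjoin; apply: eq_symfun_eval => // k.
by rewrite /psums big_cons expr0n add0r.
Qed.

(** The defining property of P_la concerns only alphabets with at least as many points as parts.
    Fewer points are reached by adjoining points e and reading off the value at e = 0 on both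
    sides. *)
Lemma hl_P_eval la f xs : is_hl_P t la f -> good_points xs ->
  symfun_eval id (psums xs) f = hl_val la xs / hl_b t la.
Proof.
move=> Pf; have [m] := ubnP (size la - size xs)%N.
elim: m xs => // m IH xs lm gx.
have [lx|xl] := leqP (size la) (size xs); first exact: hl_P_eval_large.
have gF := germM (germ_hl_val t (intpart_is_part la) (is_part_all (intpart_is_part la)) gx)
  (germ_cst (hl_b t la)^-1).
rewrite -adjoin_coef0.
have [|-> _ //] := germ_inj_poly (avoid_neq0 xs) (q := adjoin_poly f xs) _ gF.
move=> e; rewrite horner_avoid => /andP[e0 ex]; rewrite horner_adjoin IH //=.
  by lia.
by move: gx; rewrite /good_points /= inE negb_or ex eq_sym e0.
Qed.

Definition shift_poly (f : symfun K) (xs : seq K) : {poly K} :=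
  symfun_eval polyC (fun k => (psums xs k)%:P + (k == 0%N)%:R * 'X) f.

(** The outer variable is the adjoined point e, the inner one is the shift s of p_1. *)
Definition shift_adjoin_poly (f : symfun K) (xs : seq K) : {poly {poly K}} :=
  symfun_eval (polyC \o polyC)
    (fun k => (psums xs k)%:P%:P + ((k == 0%N)%:R * 'X)%:P + 'X^(k.+1)) f.

Lemma horner_shift f xs s : (shift_poly f xs).[s] =
  symfun_eval id (fun k => psums xs k + (k == 0%N)%:R * s) f.
Proof.
rewrite -[LHS]/(horner_eval s _) symfun_eval_morph; apply: eq_symfun_eval.
  by move=> a; rewrite /= /horner_eval hornerC.
move=> k; rewrite /= /horner_eval hornerD hornerC hornerM hornerX.
by case: (k == 0%N); rewrite ?hornerC ?horner0.
Qed.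

Lemma horner_shift_adjoin f xs e :
  (shift_adjoin_poly f xs).[e%:P] = shift_poly f (e :: xs).
Proof.
rewrite -[LHS]/(horner_eval e%:P _) symfun_eval_morph; apply: eq_symfun_eval.
  by move=> a; rewrite /= /horner_eval hornerC.
move=> k; rewrite /= /horner_eval !hornerD !hornerC hornerXn /psums big_cons.
by rewrite polyCD polyC_exp addrAC [_ + e%:P ^+ _]addrC.
Qed.

(* Modulo e^2, adjoining the variable e shifts p_1 by e and fixes the other p_k. *)
Lemma shift_adjoin_coefs f xs :
  (shift_adjoin_poly f xs)`_0 = shift_poly f xs /\
  (shift_adjoin_poly f xs)`_1 = (shift_poly f xs)^`().
Proof.
pose rel (g : {poly {poly K}}) (p : {poly K}) := g`_0 = p /\ g`_1 = p^`().
have relM g p g' p' : rel g p -> rel g' p' -> rel (g * g') (p * p').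
  move=> [g0 g1] [g0' g1']; split; first by rewrite coef0M g0 g0'.
  by rewrite coef1M g0 g1 g0' g1' derivM addrC.
have relC (a : {poly K}) : a^`() = 0 -> rel a%:P a.
  by move=> a0; split; rewrite coefC //= a0.
rewrite -/(rel _ _) /shift_adjoin_poly /shift_poly /symfun_eval.
apply: (big_ind2 rel) => [|g p g' p' [g0 g1] [g0' g1']|m _].
- by apply: (relC); rewrite raddf0.
- by split; rewrite coefD ?g0 ?g0' // g1 g1' derivD.
apply: (relM); first by apply: (relC); rewrite derivC.
apply: (big_ind2 rel) => [|g p g' p' Hg Hg'|i _]; first by apply: (relC); rewrite derivC.
  exact: relM.
elim: (m i) => [|j IH]; first by apply: (relC); rewrite derivC.
rewrite [_ ^+ j.+1]exprS [X in rel _ X]exprS; apply: (relM _ _ _ _ _ IH); split.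
  by rewrite !coefD !coefC coefXn /= addr0.
rewrite !coefD !coefC coefXn /= !add0r derivD derivC add0r eqSS.
by rewrite [(0 == i)%N]eq_sym; case: (i == 0%N); rewrite ?mul1r ?derivX // mul0r deriv0.
Qed.

(** The e-derivative at 0 of the s^k-coefficient is the s^k-coefficient of the s-derivative, hence k
    + 1 times the next coefficient. Germs of known functions thereby give all coefficients in s. *)
Lemma shift_coef_step f (F F0 F1 : seq K -> K) k xs : good_points xs ->
  (forall ys, good_points ys -> (shift_poly f ys)`_k = F ys) ->
  germ (fun e => F (e :: xs)) (F0 xs) (F1 xs) ->
  (shift_poly f xs)`_k.+1 *+ k.+1 = F1 xs.
Proof.
move=> gx HF gF; set H := shift_adjoin_poly f xs.
(* The coefficient of s^k, as a polynomial in the adjoined point. *)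
pose h := \poly_(j < size H) H`_j`_k.
have hE j : h`_j = H`_j`_k.
  by rewrite coef_poly; case: ltnP => // /(nth_default 0) ->; rewrite coef0.
have [|_ <-] := germ_inj_poly (avoid_neq0 xs) (q := h) _ gF.
  move=> e; rewrite horner_avoid => /andP[e0 ex].
  rewrite -HF; last by move: gx; rewrite /good_points /= inE negb_or ex eq_sym e0.
  rewrite -horner_shift_adjoin -/H horner_coef coef_sum horner_poly.
  by apply: eq_bigr => j _; rewrite -polyC_exp coefMC.
by rewrite hE (shift_adjoin_coefs f xs).2 coef_deriv.
Qed.

Lemma hl_Q_taylor la (f : symfun K) xs s M : is_part la ->
  all (geq M) la -> good_points xs ->
  (forall ys, good_points ys -> symfun_eval id (psums ys) f = hl_val la ys) ->
  symfun_eval id (fun k => psums xs k + (k == 0%N)%:R * s) f =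
  \sum_(k < (sumn la).+1) s ^+ k / (k`!)%:R * hl_iter M k la xs.
Proof.
move=> pa aM gx Hf.
have H k ys : good_points ys -> (shift_poly f ys)`_k = hl_iter M k la ys / (k`!)%:R.
  elim: k ys => [|k IH] ys gy.
    rewrite -horner_coef0 horner_shift divr1 /= -Hf //.
    by apply: eq_symfun_eval => // k; rewrite mulr0 addr0.
  have := @shift_coef_step f (fun ys => hl_iter M k la ys / (k`!)%:R)
    (fun ys => hl_iter M k la ys / (k`!)%:R)
    (fun ys => hl_iter M k.+1 la ys / (k`!)%:R) k ys gy IH.
  have := germM (germ_hl_iter k pa aM gy) (germ_cst (k`!)%:R^-1).
  rewrite mulr0 add0r => /[swap]/[apply].
  have k0 : k.+1%:R != 0 :> K by rewrite pnatr_eq0.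
  move=> E; apply: (mulIf k0); rewrite mulr_natr E factS natrM.
  by field; rewrite addrC natr1 k0 pnatr_eq0 -lt0n fact_gt0.
rewrite -horner_shift (@horner_coef_wide _ (sumn la).+1).
  by apply: eq_bigr => k _; rewrite H // mulrC mulrAC mulrA.
apply/leq_sizeP => j lj; rewrite H // hl_iter_eq0 ?mul0r //.
Qed.

End Taylor.

(** * Principal and Plancherel specializations *)

Section Specializations.
Variables (K : numFieldType) (t : K).
Hypothesis t0 : t != 0.
Hypothesis t_nunity : forall i, (0 < i)%N -> t ^+ i != 1.
Local Notation hl_val := (hl_val t).

Lemma psums_t_string y n k : psums (t_string t y n) k =
  y ^+ k.+1 * (1 - t ^+ n ^+ k.+1) / (1 - t ^+ k.+1).
Proof.
have tk : 1 - t ^+ k.+1 != 0 by rewrite subr_eq0 eq_sym t_nunity.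
elim: n y => [|n IH] y; first by rewrite /psums big_nil expr0 expr1n subrr mulr0 mul0r.
rewrite /psums /t_string trajectS big_cons -/(psums (t_string t (t * y) n) k) IH.
by rewrite [t ^+ n.+1]exprS !exprMn; field.
Qed.

(** On 1, t, ..., t^(n-1) the k-th power sum is (1 - u^k) / (1 - t^k) with u = t^n. Both sides
    become polynomials in u that agree for all n >= [size la], hence identically, and u = 0 is the
    infinite alphabet. *)
Lemma principal_spec_hl_P la f : is_hl_P t la f ->
  principal_spec t f = t ^+ part_weight la / hl_b t la.
Proof.
move=> Pf.
pose U : {poly K} := symfun_eval polyC
  (fun k => ((1 - t ^+ k.+1)^-1)%:P * (1 - 'X^(k.+1))) f.
(* At u = t^n the factor 1 - u t^(-i) is the 1 - t^(n - i) of [hl_val_t_string]. *)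
pose V : {poly K} := (t ^+ part_weight la / hl_b t la)%:P *
  \prod_(i < size la) (1 - (t ^- i)%:P * 'X).
have UE u : U.[u] = symfun_eval id (fun k => (1 - u ^+ k.+1) / (1 - t ^+ k.+1)) f.
  rewrite -[LHS]/(horner_eval u _) symfun_eval_morph; apply: eq_symfun_eval.
    by move=> a; rewrite /= /horner_eval hornerC.
  by move=> k; rewrite /= /horner_eval hornerM hornerD hornerN !hornerC hornerXn mulrC.
have : U - V = 0.
  apply: (@poly_eq0_of_roots _ (fun n => t ^+ n) (size la)) => [|n ln].
    exact: t_expI.
  apply/eqP; rewrite hornerD hornerN subr_eq0; apply/eqP.
  have g1 := good_t_string t0 t_nunity n (oner_neq0 K).
  transitivity (symfun_eval id (psums (t_string t 1 n)) f).
    by rewrite UE; apply: eq_symfun_eval => // k; rewrite psums_t_string expr1n mul1r.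
  rewrite (hl_P_eval t0 t_nunity Pf g1) hl_val_t_string ?oner_neq0 //.
  rewrite hornerM hornerC horner_prod expr1n mul1r mulrAC; congr (_ * _).
  apply: eq_bigr => i _; rewrite hornerD hornerN hornerM !hornerC hornerX.
  by rewrite mulrC expfB_cond ?(negPf t0) //=; have := ltn_ord i; lia.
move/eqP; rewrite subr_eq0 => /eqP UV.
have := UE 0; rewrite UV hornerM hornerC horner_prod big1 ?mulr1 => [->|i _].
  by rewrite /principal_spec specializeE; apply: eq_symfun_eval => // k;
    rewrite expr0n subr0 mul1r.
by rewrite hornerD hornerN hornerM !hornerC hornerX mulr0 subr0.
Qed.

Lemma hl_P_spec la : is_hl_P t la (hl_P t la) \/ hl_P t la = 0.
Proof.
rewrite /hl_P; case: (xgetP 0 (is_hl_P t la)) => [f -> Pf|_]; first by left.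
by right.
Qed.

Lemma hl_Qskew_spec la :
  is_skew_Q t la (hl_Qskew t la) \/ hl_Qskew t la = (fun=> 0).
Proof.
rewrite /hl_Qskew; case: xgetP => [g -> sg|_]; first by left.
by right.
Qed.

Lemma hl_Q_eval la xs : is_hl_P t la (hl_P t la) -> good_points xs ->
  symfun_eval id (psums xs) (hl_Q t la) = hl_val la xs.
Proof.
move=> Pf gx; rewrite /hl_Q symfun_evalZ (hl_P_eval t0 t_nunity Pf gx).
by rewrite mulrC divfK // hl_b_neq0.
Qed.

Lemma hl_Q_eq0 la : hl_P t la = 0 -> hl_Q t la = 0.
Proof. by move=> P0; rewrite /hl_Q P0 scaler0. Qed.

(** All power sums of the empty alphabet are 0. Where P_la does not exist, Q_la is 0 by the default
    value. *)
Lemma hl_Q_eval0 la : symfun_eval id (fun=> 0) (hl_Q t la) =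
  (la == empty_partition)%:R * symfun_eval id (fun=> 0) (hl_Q t empty_partition).
Proof.
have [->|lan] := eqVneq la empty_partition; first by rewrite mul1r.
rewrite mul0r; have [Pf|/hl_Q_eq0 ->] := hl_P_spec la; last exact: symfun_eval0.
have <- := @eq_symfun_eval K K id id _ _ (hl_Q t la) (frefl _) (@psums_nil K).
rewrite hl_Q_eval //; case: la lan {Pf} => -[//|a s] p _; exact: hl_val_nil.
Qed.

Lemma plancherel_specE s (g : symfun K) : plancherel_spec t ((1 - t) * s) g =
  symfun_eval id (fun k => (k == 0%N)%:R * s) g.
Proof.
rewrite /plancherel_spec specializeE; apply: eq_symfun_eval => // k.
case: (k == 0%N); last by rewrite mul0r.
by rewrite mulrC mulrA mulVf ?mul1r // subr_eq0 eq_sym -[t]expr1 t_nunity.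
Qed.

(** The value of Q_{la/mu} at p_1 = s and p_k = 0 otherwise, as will turn out; it stops at |la|
    because no more boxes can be removed. *)
Definition descent_series (M : nat) (s : K) (mu la : seq nat) : K :=
  \sum_(k < (sumn la).+1) s ^+ k / (k`!)%:R * descent_coef t M k mu la.

Lemma skew_plancherel la g (S : seq intpart) s xs :
  in_xy (hl_Q t la) = \sum_(mu <- S) in_x (g mu) * in_y (hl_Q t mu) ->
  symfun_eval id (fun k => psums xs k + (k == 0%N)%:R * s) (hl_Q t la) =
  \sum_(mu <- S) plancherel_spec t ((1 - t) * s) (g mu) *
    symfun_eval id (psums xs) (hl_Q t mu).
Proof.
move=> E; pose e (i : nat + nat) := match i with
  inl k => (k == 0%N)%:R * s | inr k => psums xs k end.
have := congr1 (symfun2_eval e) E; rewrite symfun2_eval_in_xy.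
rewrite (eq_symfun_eval (f' := id) (c' := fun k => psums xs k + (k == 0%N)%:R * s)) //; last first.
  by move=> k; rewrite /= addrC.
move=> ->; transitivity (\sum_(mu <- S) symfun2_eval e (in_x (g mu) * in_y (hl_Q t mu))).
  exact: (raddf_sum (symfun2_eval e : {rmorphism symfun2 K -> K})).
apply: eq_bigr => mu _.
rewrite symfun2_evalM plancherel_specE; congr (_ * _).
  exact: symfun2_eval_in_x.
exact: symfun2_eval_in_y.
Qed.

(** With the second alphabet empty only the term of the empty partition survives. This works before
    the existence of the other P_mu is known, as the existence argument demands. *)
Lemma skew_Q_empty M la g s : is_hl_P t la (hl_P t la) -> is_skew_Q t la g ->
  all (geq M) la ->
  descent_series M s [::] la = plancherel_spec t ((1 - t) * s) (g empty_partition) *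
    symfun_eval id (fun=> 0) (hl_Q t empty_partition).
Proof.
move=> Pla [S [Su Sg /(skew_plancherel s [::]) E]] aM; move: E.
rewrite (@hl_Q_taylor _ t _ _ _ s _ (intpart_is_part la) aM (good_points_nil K)
  (fun ys gy => hl_Q_eval Pla gy)) => E.
transitivity (\sum_(k < (sumn la).+1) s ^+ k / (k`!)%:R * hl_iter t M k la [::]).
  apply: eq_bigr => k _; congr (_ * _); rewrite hl_iterE /descent_coef big_mkcond.
  apply: eq_bigr => -[c [|a r]] _; first by rewrite [RHS]mulr1.
  by rewrite [hl_val _ _]hl_val_nil mulr0.
rewrite E.
have H (mu : intpart) : symfun_eval id (psums [::]) (hl_Q t mu) =
    (mu == empty_partition)%:R * symfun_eval id (fun=> 0) (hl_Q t empty_partition).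
  by rewrite -hl_Q_eval0; apply: eq_symfun_eval => //; exact: psums_nil.
under eq_bigr do rewrite H.
have [eS|eS] := boolP (empty_partition \in S); last first.
  rewrite Sg // [plancherel_spec _ _ 0]plancherel_specE symfun_eval0 mul0r.
  rewrite big_seq big1 // => mu mS; have [me|] := eqVneq mu empty_partition.
    by rewrite -me mS in eS.
  by rewrite mul0r mulr0.
rewrite (bigD1_seq _ eS Su) eqxx mul1r big1 => [|mu /negPf ->].
  by rewrite /= addr0.
by rewrite mul0r mulr0.
Qed.

(** The factor Q_empty is 1, or else 0 by default; a nonzero series excludes the latter. *)
Lemma skew_Q_empty_neq0 M la g s : is_hl_P t la (hl_P t la) ->
  is_skew_Q t la g -> all (geq M) la -> descent_series M s [::] la != 0 ->
  plancherel_spec t ((1 - t) * s) (g empty_partition) = descent_series M s [::] la.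
Proof.
move=> P sk aM; rewrite (skew_Q_empty s P sk aM).
have [P0|/hl_Q_eq0 ->] := hl_P_spec empty_partition; last first.
  by rewrite symfun_eval0 mulr0 eqxx.
have <- := @eq_symfun_eval K K id id _ _ (hl_Q t empty_partition) (frefl _) (@psums_nil K).
by rewrite (hl_Q_eval P0 (good_points_nil K)) mulr1.
Qed.

(** Q_la at the union of the Plancherel alphabet and [xs] is expanded in the Q_mu(xs) twice, by the
    definition of skew functions and by Taylor's formula. The difference [L1 ++ L2] is a linear
    relation. *)
Lemma skew_Q_coef M la g s (mu : intpart) :
  (forall nu, is_hl_P t nu (hl_P t nu)) ->
  is_skew_Q t la g -> all (geq M) la ->
  plancherel_spec t ((1 - t) * s) (g mu) = descent_series M s mu la.
Proof.
move=> P [S [Su Sg E]] aM.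
pose L1 := [seq (plancherel_spec t ((1 - t) * s) (g nu), parts nu) | nu <- S].
pose L2 := [seq (- (s ^+ k / (k`!)%:R) * p.1, p.2) |
             k <- iota 0 (sumn la).+1, p <- descents t M k la].
have pla := intpart_is_part la.
have Lp p : p \in L1 ++ L2 -> is_part p.2.
  rewrite mem_cat => /orP[/mapP[nu _ ->]|/allpairsPdep[k [q [_ qi ->]]]].
    exact: intpart_is_part.
  exact: is_part_descents pla qi.
have sumL2 (Q : pred (seq nat)) (F : seq nat -> K) :
    \sum_(p <- L2 | Q p.2) p.1 * F p.2 = - \sum_(k < (sumn la).+1)
      s ^+ k / (k`!)%:R * \sum_(p <- descents t M k la | Q p.2) p.1 * F p.2.
  rewrite big_mkcond big_allpairs_dep -[iota 0 _]/(index_iota 0 (sumn la).+1) big_mkord.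
  rewrite -sumrN; apply: eq_bigr => k _; rewrite mulr_sumr -sumrN [RHS]big_mkcond.
  by apply: eq_bigr => p _; rewrite /=; case: (Q _) => //; rewrite -mulrA mulNr.
have LH xs : good_points xs -> \sum_(p <- L1 ++ L2) p.1 * hl_val p.2 xs = 0.
  move=> gx; have /= S2 := sumL2 predT (fun q => hl_val q xs).
  rewrite big_cat /= big_map S2; apply/eqP; rewrite subr_eq0.
  apply/eqP; have := skew_plancherel s xs E.
  rewrite (@hl_Q_taylor _ t _ _ _ s _ pla aM gx (fun ys gy => hl_Q_eval (P la) gy)).
  under [X in _ = X -> _]eq_bigr => nu _ do rewrite (hl_Q_eval (P nu) gx).
  by move=> <-; apply: eq_bigr => k _; rewrite hl_iterE.
have := hl_val_independent t0 t_nunity Lp LH (parts mu).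
rewrite big_cat /= big_map.
have -> : \sum_(p <- L2 | p.2 == parts mu) p.1 = - descent_series M s mu la.
  have := sumL2 (fun q => q == parts mu) (fun=> 1).
  under eq_bigr do rewrite mulr1; move=> ->; congr (- _).
  apply: eq_bigr => k _; congr (_ * _).
  by apply: eq_bigr => p _; rewrite mulr1.
move=> /eqP; rewrite subr_eq0 => /eqP <-.
have [mS|mS] := boolP (mu \in S).
  rewrite (big_rem mu mS) /= eqxx big_seq_cond big1 ?addr0 // => nu.
  rewrite mem_rem_uniq // inE => /andP[/andP[/negPf + _]].
  by rewrite -val_eqE /= => ->.
rewrite Sg // plancherel_specE symfun_eval0 big_seq_cond big1 // => nu /andP[nS].
by move=> /eqP/val_inj nm; rewrite -nm nS in mS.
Qed.

End Specializations.

(** * Partitions and particle configurations *)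

Definition particles (la : seq nat) : nat -> int :=
  fun k => (count (leq k.+1) la)%:Z - k.+1%:Z.

Definition unjump (z : nat -> int) (k : nat) : nat -> int :=
  fun j => if j == k then z j - 1 else z j.

Lemma jumpK k : cancel (fun x => jump x k) (fun z => unjump z k).
Proof.
by move=> x; apply/funext => j; rewrite /unjump /jump; case: eqP => // _; rewrite addrK.
Qed.

Lemma unjumpK k : cancel (fun z => unjump z k) (fun x => jump x k).
Proof.
by move=> x; apply/funext => j; rewrite /unjump /jump; case: eqP => // _; rewrite subrK.
Qed.

Lemma count_lower v la i : is_part la -> v \in la ->
  (count_mem i (lower v la) + (i == v) =
   count_mem i la + ((0 < i) && (i == v.-1)))%N.
Proof.
elim: la => [//|a s IH]; rewrite is_part_cons => /and3P[a0 sa ps].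
rewrite inE /=; have [vs _|vs] := boolP (v \in s).
  by rewrite /= -addnA IH // addnA.
rewrite orbF eq_sym => /eqP av; rewrite av eqxx; subst v.
have [->|a1] := eqVneq a 1%N.
  by case: i {IH} => [|[|i]] /=; lia.
rewrite /= [(a.-1 == i)%N]eq_sym [(a == i)%N]eq_sym.
have -> : (0 < i)%N && (i == a.-1) = (i == a.-1).
  by have [->|_] := eqVneq i a.-1; rewrite ?andbT ?andbF //; lia.
by lia.
Qed.

Lemma count_leq_succ k la :
  count (leq k) la = (count_mem k la + count (leq k.+1) la)%N.
Proof.
elim: la => //= a s ->; rewrite (leq_eqVlt k a) [(k == a)%N]eq_sym.
by case: eqP => [->|_] /=; rewrite ?ltnn; lia.
Qed.

Lemma is_part_gt0 v la : is_part la -> v \in la -> (0 < v)%N.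
Proof. by case/andP => _ la0 vl; rewrite lt0n; apply: contraNneq la0 => <-. Qed.

(** Descending induction on i from a bound of the parts, adding up the multiplicities from
    [count_lower]. *)
Lemma count_leq_lower v la i : is_part la -> v \in la ->
  (count (leq i.+1) (lower v la) + (i.+1 == v) = count (leq i.+1) la)%N.
Proof.
move=> pa vl.
have [N [hN hN']] : exists N, all (geq N) la /\ all (geq N) (lower v la).
  have [_ _ al] := lower_in pa vl.
  by exists (nth 0%N la 0); split; [|apply: al]; exact: is_part_all.
have c0 M mu : all (geq M) mu -> count (leq M.+1) mu = 0%N.
  move=> /allP am; apply/eqP; rewrite -leqn0 leqNgt -has_count -all_predC.
  by apply/allP => j /am /=; rewrite -ltnNge ltnS.
have vN : (v <= N)%N by have := allP hN _ vl.
have v0 := is_part_gt0 pa vl.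
have [m] := ubnP (N - i)%N; elim: m i => // m IH i im.
have [iN|Ni] := leqP N i; last first.
  have := count_lower i.+1 pa vl; rewrite !(count_leq_succ i.+1).
  have := IH i.+1; have -> /= : (N - i.+1 < m)%N by lia.
  move=> /(_ isT); have -> : (i.+1 == v.-1) = (i.+2 == v) by apply/eqP/eqP; lia.
  lia.
have cc mu : all (geq N) mu -> count (leq i.+1) mu = 0%N.
  by move=> am; apply: c0; apply/allP => j /(allP am) /=; lia.
rewrite !cc //; case: eqP => //; lia.
Qed.

Lemma particles_lower v la : is_part la -> v \in la ->
  particles (lower v la) = unjump (particles la) v.-1.
Proof.
move=> pa vl; apply/funext => k; rewrite /particles /unjump.
have v0 := is_part_gt0 pa vl.
have := count_leq_lower k pa vl; have -> : (k.+1 == v) = (k == v.-1) by apply/eqP/eqP; lia.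
by case: eqP => _ <-; rewrite ?addn1 ?addn0 //; lia.
Qed.

(** A box in row i contributes i - 1 to n(la), and i - 1 is the length of column v without its
    bottom box. *)
Lemma part_weight_lower v la : is_part la -> v \in la ->
  part_weight la = (part_weight (lower v la) + count (leq v) (lower v la))%N.
Proof.
elim: la => [//|a s IH]; rewrite is_part_cons => /and3P[a0 sa ps].
rewrite inE /=; have [vs _|vs] := boolP (v \in s).
  have [_ sl _] := lower_in ps vs; rewrite /= (IH ps vs) sl.
  by have /= := allP sa _ vs; lia.
rewrite orbF eq_sym => /eqP av; rewrite av eqxx; subst v.
have c0 : count (leq a) s = 0%N.
  apply/eqP; rewrite -leqn0 leqNgt -has_count -all_predC.
  apply/allP => j js /=; have /= := allP sa _ js.
  have : j != a by apply: contraNneq vs => <-.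
  lia.
have [a1|a1] := eqVneq a 1%N; last by rewrite /= c0; lia.
case: s {IH vs} sa ps c0 => [//|b s] /= /andP[ba _].
by rewrite is_part_cons => /and3P[b0 _ _]; lia.
Qed.

Lemma particles_inj (la mu : intpart) : particles la = particles mu -> la = mu.
Proof.
move=> E; apply/val_inj => /=.
have [/andP[sl l0] /andP[sm m0]] := (partsP la, partsP mu).
have cE k : count (leq k.+1) la = count (leq k.+1) mu.
  by have := congr1 (fun f => f k) E; rewrite /particles; lia.
apply: (sorted_eq geq_trans) => //; first by move=> x y /=; lia.
apply/allP => -[|k] _ /=; first by rewrite !(count_memPn _).
have := (count_leq_succ k.+1 la, count_leq_succ k.+1 mu, cE k, cE k.+1).
by move=> [[[-> ->] e1] e2]; apply/eqP; rewrite -[LHS]/(count_mem k.+1 la) -[RHS]/(count_mem k.+1 mu); lia.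
Qed.

Lemma particles_packed_states (la : intpart) : packed_states (particles la).
Proof.
split=> [k|]; first by rewrite /particles (count_leq_succ k.+1); lia.
exists (nth 0%N la 0) => k lk; rewrite /particles /packed.
suff -> : count (leq k.+1) la = 0%N by rewrite add0r.
apply/eqP; rewrite -leqn0 leqNgt -has_count -all_predC.
apply/allP => j /(allP (is_part_all (partsP la))) /=; lia.
Qed.

Lemma particles_empty : particles [::] = packed.
Proof. by apply/funext => k; rewrite /particles /packed /= add0r. Qed.

Lemma particles_surj x : packed_states x -> exists la : intpart, particles la = x.
Proof.
move=> [cx [N xN]].
pose h k := `|(x k + k.+1%:Z)%R|%N.
have x_ge k : packed k <= x k.
  have [Nk|kN] := leqP N k; first by rewrite xN.
  rewrite -(subKn (ltnW kN)); elim: (N - k)%N => [|m IH].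
    by rewrite subn0 xN.
  have [mN|Nm] := ltnP m N; last by move: IH; rewrite (_ : N - m.+1 = N - m)%N //; lia.
  have := cx (N - m.+1)%N; rewrite -subSn // subSS; move: IH; rewrite /packed.
  lia.
have hE k : x k = (h k)%:Z - k.+1%:Z.
  by have := x_ge k; rewrite /packed /h; lia.
have hS k : (h k.+1 <= h k)%N by have := cx k; rewrite !hE; lia.
have h_mono j k : (j <= k)%N -> (h k <= h j)%N.
  elim: k => [|k IH]; first by rewrite leqn0 => /eqP->.
  by rewrite leq_eqVlt => /orP[/eqP->//|/IH]; apply: leq_trans.
have hN k : (N <= k)%N -> h k = 0%N by move=> /xN; rewrite hE /packed; lia.
(* [h] lists the column lengths, so the parts form its conjugate. *)
pose c i := count (fun k => (i < h k)%N) (iota 0 N).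
have cP i k : (k.+1 <= c i)%N = (i < h k)%N.
  have [kN|Nk] := ltnP k N; last first.
    have := count_size (fun k => (i < h k)%N) (iota 0 N); rewrite size_iota -/(c i).
    by rewrite hN // ltn0; lia.
  rewrite /c -(subnKC kN) iotaD count_cat add0n.
  have [ik|ki] := ltnP i (h k).
    suff -> : count (fun k => (i < h k)%N) (iota 0 k.+1) = k.+1 by rewrite leq_addr.
    rewrite -[RHS](size_iota 0 k.+1); apply/eqP; rewrite -all_count; apply/allP => j.
    by rewrite mem_iota /= add0n ltnS => /h_mono; exact: leq_trans.
  have c0 m n : (k <= m)%N -> count (fun k => (i < h k)%N) (iota m n) = 0%N.
    move=> km; apply/eqP; rewrite -leqn0 leqNgt -has_count -all_predC; apply/allP => j.
    by rewrite mem_iota /= -leqNgt => /andP[mj _]; apply: leq_trans ki; apply: h_mono; lia.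
  rewrite (c0 k.+1) // addn0 -addn1 iotaD count_cat add0n (c0 k) // addn0.
  by have := count_size (fun k => (i < h k)%N) (iota 0 k); rewrite size_iota; lia.
have c_part : sorted geq (mkseq c (h 0%N)) && (0%N \notin mkseq c (h 0%N)).
  apply/andP; split.
    apply: (homo_sorted (e := leq)); last exact: iota_sorted.
    move=> i j ij /=; case cj: (c j) => [//|k]; rewrite cP.
    by apply: leq_ltn_trans ij _; rewrite -cP cj.
  apply/mapP => -[ i ]; rewrite mem_iota /= add0n => ih ci.
  by have := cP i 0%N; rewrite ih -ci.
exists (IntPart c_part); apply/funext => k; rewrite /particles hE /= count_map.
congr (_%:Z - _); rewrite (eq_count (a2 := fun i => i < h k)%N); last by move=> i; exact: cP.
by rewrite -size_filter (@filter_iota_ltn 0) ?size_iota ?h_mono.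
Qed.

(** * The jump chain *)

Section JumpChain.
Variables (R : realType) (t : R).
Hypothesis ht : 0 < t < 1.

Let t_gt0 : 0 < t. Proof. by case/andP: ht. Qed.

Lemma t_neq0 : t != 0. Proof. by rewrite gt_eqF. Qed.

Lemma t_not_unity i : (0 < i)%N -> t ^+ i != 1.
Proof.
move=> i0; case/andP: ht => _ t1; rewrite lt_eqF //.
by rewrite exprn_ilt1 ?ltW // -lt0n.
Qed.

Lemma configuration_gap x k : configuration x ->
  exists n : nat, x k - x k.+1 - 1 = n%:Z.
Proof.
by move=> /(_ k) cx; exists `|(x k - x k.+1 - 1)%R|%N; lia.
Qed.

Lemma jump_rate_ge0 x k : configuration x -> 0 <= jump_rate t x k.
Proof.
move=> cx; rewrite /jump_rate; apply: mulr_ge0; first exact: exprz_ge0 (ltW t_gt0).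
case: k => [|k]; first by rewrite subr0.
have [n ->] := configuration_gap k cx; rewrite subr_ge0 -exprnP.
by apply: exprn_ile1; rewrite ltW //; case/andP: ht.
Qed.

(** A jump onto an occupied site has the factor 1 - t^0 = 0 in its rate. *)
Lemma configuration_jump x k : configuration x -> jump_rate t x k != 0 ->
  configuration (jump x k).
Proof.
move=> cx r0 j; rewrite /jump; have := cx j.
case: (eqVneq j.+1 k) => [jk|jk]; case: (eqVneq j k) => [jk'|jk']; try lia.
subst k; move: r0; rewrite /jump_rate.
have [-> |] := eqVneq (x j - x j.+1 - 1) 0; first by rewrite expr0z subrr mulr0 eqxx.
lia.
Qed.

Lemma packed_states_jump x k : packed_states x -> jump_rate t x k != 0 ->
  packed_states (jump x k).
Proof.
move=> [cx [N xN]] r0; split; first exact: configuration_jump.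
exists (maxn N k.+1) => j; rewrite geq_max /jump => /andP[Nj kj].
by rewrite (gtn_eqF kj) xN.
Qed.

Lemma jump_rateE x k : jump_rate t x k =
  t ^ (x k + k.+1%:Z) - if k is k'.+1 then t ^ (x k' + k%:Z) else 0.
Proof.
rewrite /jump_rate mulrBr mulr1; case: k => [|k]; first by rewrite mulr0.
rewrite -expfzDr ?t_neq0 //; congr (_ - _ ^ _); lia.
Qed.

(** By [jump_rateE] the rates telescope. Once particle m is at its packed position the exponent is
    0, whence total rate 1. *)
Lemma sum_jump_rate x m : \sum_(k < m.+1) jump_rate t x k = t ^ (x m + m.+1%:Z).
Proof.
elim: m => [|m IH]; first by rewrite big_ord1 jump_rateE subr0.
by rewrite big_ord_recr /= IH jump_rateE addrC subrK.
Qed.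

Lemma sum_jump_rate1 x N m : (forall k, (N <= k)%N -> x k = packed k) ->
  (N < m)%N -> \sum_(k < m) jump_rate t x k = 1.
Proof.
case: m => // m xN; rewrite ltnS => Nm; rewrite sum_jump_rate xN // /packed.
by rewrite addNr expr0z.
Qed.

(** As exit rates are 1, rates are jump probabilities and this is the n-step transition probability
    of the jump chain, with only the first [M] particles allowed to move. *)
Fixpoint path_weight (M n : nat) (x z : nat -> int) : R :=
  if n is n'.+1 then \sum_(k < M) jump_rate t x k * path_weight M n' (jump x k) z
  else (x == z)%:R.

Lemma path_weight_ge0 M n x z : configuration x -> 0 <= path_weight M n x z.
Proof.
elim: n x => [|n IH] x cx /=; first exact: ler0n.
apply: sumr_ge0 => k _; have [->|r0] := eqVneq (jump_rate t x k) 0.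
  by rewrite mul0r.
by rewrite mulr_ge0 ?jump_rate_ge0 // IH //; apply: configuration_jump.
Qed.

Lemma path_weight_configuration M n x z : configuration x -> ~ configuration z ->
  path_weight M n x z = 0.
Proof.
elim: n x => [|n IH] x cx cz /=; first by case: eqP => // xz; rewrite xz in cx.
rewrite big1 // => k _; have [->|r0] := eqVneq (jump_rate t x k) 0.
  by rewrite mul0r.
by rewrite IH ?mulr0 //; apply: configuration_jump.
Qed.

(** Decomposition by the last jump, to match [descent_coefS], which takes boxes off the final
    partition. *)
Lemma path_weight_last M n x z : path_weight M n.+1 x z =
  \sum_(k < M) path_weight M n x (unjump z k) * jump_rate t (unjump z k) k.
Proof.
elim: n x => [|n IH] x.
  apply: eq_bigr => k _ /=.
  have -> : (jump x k == z) = (x == unjump z k).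
    by apply/eqP/eqP => [<-|->]; rewrite ?(jumpK k) ?(unjumpK k).
  by case: eqP => [->|_]; rewrite ?mulr1 ?mul1r // mulr0 mul0r.
transitivity (\sum_(k < M) jump_rate t x k * path_weight M n.+1 (jump x k) z) => //.
under eq_bigr do rewrite IH mulr_sumr.
rewrite exchange_big; apply: eq_bigr => k _; rewrite [path_weight _ n.+1 _ _]/=.
by rewrite mulr_suml; apply: eq_bigr => j _; rewrite mulrA.
Qed.

(** P_la(1, t, t^2, ...), which acts as the harmonic function of a Doob transform turning chain
    weights into jump rates. *)
Definition principal_weight (la : seq nat) : R := t ^+ part_weight la / hl_b t la.

Lemma hl_bE M la : is_part la -> all (geq M) la ->
  hl_b t la = \prod_(1 <= i < M.+1) tpoch t (count_mem i la).
Proof.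
move=> pa aM; rewrite /hl_b (@big_cat_nat _ _ _ (nth 0%N la 0).+1 1 M.+1) //=; last first.
  by rewrite ltnS; case: la {pa} aM => //= a s /andP[].
rewrite [X in _ * X]big_nat_cond [X in _ * X]big1 ?mulr1 // => i /andP[/andP[li _] _].
rewrite (count_memPn _) ?/tpoch ?big_nil //; apply/negP => il.
by have := allP (is_part_all pa) _ il; rewrite /= leqNgt li.
Qed.

(** With mu the lowered partition, n(la) - n(mu) accounts for the power of t in the rate. The ratio
    of the b's trades 1 - t^(m_v(la)) for 1 - t^(m_{v-1}(mu)), and m_{v-1}(mu) is the gap in front
    of the jumping particle. *)
Lemma jump_rate_lower v la : is_part la -> v \in la ->
  (1 - t ^+ count_mem v la) * principal_weight la =
  jump_rate t (particles (lower v la)) v.-1 * principal_weight (lower v la).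
Proof.
move=> pa vl; have v0 := is_part_gt0 pa vl.
have [pl _ al] := lower_in pa vl; set mu := lower v la in pl al *.
have aM := is_part_all pa; set M := nth 0%N la 0 in aM.
have vM : (v <= M)%N := allP aM v vl.
(* The exclusion factor, equal to 1 for the first column, whose particle has nobody in front. *)
pose c := if v is v'.+2 then 1 - t ^+ count_mem v.-1 mu else 1.
have bE : hl_b t mu * (1 - t ^+ count_mem v la) = hl_b t la * c.
  rewrite (hl_bE pl (al _ aM)) (hl_bE pa aM).
  pose A i := if i == v then 1 - t ^+ count_mem v la else 1.
  pose B i := if (0 < i)%N && (i == v.-1) then 1 - t ^+ count_mem i mu else 1.
  have AE : \prod_(1 <= i < M.+1) A i = 1 - t ^+ count_mem v la.
    rewrite (@bigD1_seq _ _ _ _ _ v) ?iota_uniq ?mem_index_iota ?v0 ?ltnS //=.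
    by rewrite /A eqxx big1 ?mulr1 // => i /negPf ->.
  have BE : \prod_(1 <= i < M.+1) B i = c.
    rewrite /c /B; case: (v) vM => [|[|v']] vM.
    - by rewrite big1 // => i _; case: i.
    - by rewrite big1 // => i _; case: i.
    rewrite (@bigD1_seq _ _ _ _ _ v'.+1) ?iota_uniq ?mem_index_iota //=; last first.
      by rewrite ltnS ltnW.
    by rewrite eqxx big1 ?mulr1 // => i /negPf ->; rewrite andbF.
  rewrite -AE -BE -!big_split /=; apply: eq_bigr => i _.
  have := count_lower i pa vl; rewrite -/mu /A /B.
  have [->|iv] := eqVneq i v.
    have -> : (v == v.-1) = false by apply/eqP; lia.
    rewrite andbF addn0 addn1 mulr1 => <-.
    by rewrite [in RHS]/tpoch big_nat_recr.
  case: ifP => _; rewrite addn0 ?addn1 ?addn0 => ->; rewrite ?mulr1 //.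
  by rewrite [in LHS]/tpoch big_nat_recr.
have -> : jump_rate t (particles mu) v.-1 = t ^+ count (leq v) mu * c.
  rewrite /jump_rate /particles prednK // subrK -exprnP; congr (_ * _).
  rewrite /c; case: (v) v0 => // -[_|v' _]; first by rewrite subr0.
  rewrite /= (count_leq_succ v'.+1) exprnP; congr (_ - _ ^ _); 
  move: (count_mem v'.+1 mu) (count (leq v'.+2) mu) => a b; lia.
rewrite /principal_weight (part_weight_lower pa vl) -/mu exprD.
have b0 := hl_b_neq0 t_not_unity.
have bla := b0 la; have bmu := b0 mu.
apply: (mulIf (mulf_neq0 bla bmu)).
transitivity (t ^+ part_weight mu * t ^+ count (leq v) mu * (hl_b t mu * (1 - t ^+ count_mem v la))).
  by field; rewrite bla.
rewrite bE; field; exact: bmu.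
Qed.

(** [jump_rate_lower] is applied along each path; the intermediate principal weights cancel. *)
Lemma path_weight_descents M n (mu la : intpart) : all (geq M) la ->
  path_weight M n (particles mu) (particles la) * principal_weight mu =
  descent_coef t M n mu la * principal_weight la.
Proof.
elim: n la => [|n IH] la aM.
  rewrite descent_coef0 [path_weight _ 0 _ _]/=; have [->|lm] := eqVneq la mu.
    by rewrite (eqxx (particles mu)) (eqxx (parts mu)).
  have -> : (particles mu == particles la) = false.
    by apply/eqP => /particles_inj ml; rewrite ml eqxx in lm.
  have -> : (parts la == parts mu) = false.
    by apply/eqP => /val_inj ml; rewrite ml eqxx in lm.
  by rewrite !mul0r.
rewrite path_weight_last descent_coefS !mulr_suml.
have -> : iota 1 M = index_iota 1 M.+1 by rewrite /index_iota subn1.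
rewrite big_add1 /= big_mkord.
apply: eq_bigr => k _; have pla := partsP la.
have [kl|kl] := boolP (k.+1 \in parts la).
  have [pl _ al] := lower_in pla kl.
  have := IH (IntPart pl) (al _ aM) => /= IHk.
  have pE := particles_lower pla kl; rewrite /= in pE; rewrite -pE.
  rewrite mulrAC IHk [in RHS]mulrAC (jump_rate_lower pla kl) /=.
  by rewrite -mulrA mulrC [_ * jump_rate _ _ _]mulrC -!mulrA.
(* If [k.+1] is not a part, the chain coefficient is 0; on the other side, undoing a jump of
   particle k would put it on the site of the next one. *)
rewrite (count_memPn kl) subrr !mul0r path_weight_configuration ?mul0r //.
  by case: (particles_packed_states mu).
move=> /(_ k); rewrite /unjump eqxx gtn_eqF // /particles (count_leq_succ k.+1).
by rewrite (count_memPn kl) add0n; lia.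
Qed.

End JumpChain.

(** * Uniqueness of the transition function *)

Local Open Scope classical_set_scope.

Lemma esum_ge_seq (R : realType) (T : choiceType) (S : set T) (a : T -> \bar R)
    (s : seq T) : uniq s -> (forall x, x \in s -> S x) ->
  (\sum_(x <- s) a x <= \esum_(x in S) a x)%E.
Proof.
move=> su sS; apply: esum_ge; exists [set` s].
  by split; [exact: finite_seq|exact: sS].
by rewrite fsbig_seq.
Qed.

Section TransitionFunction.
Variables (R : realType) (t : R).
Hypothesis ht : 0 < t < 1.
Variable p : R -> (nat -> int) -> (nat -> int) -> R.
Hypothesis hp : tasep_transition t p.

Lemma jump_neq x k : jump x k <> x.
Proof. by move=> /(congr1 (fun f => f k)); rewrite /jump eqxx; lia. Qed.

Lemma jump_inj x : injective (jump x).
Proof.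
move=> j k /(congr1 (fun f => f j)); rewrite /jump eqxx.
by case: eqVneq => // _; lia.
Qed.

(** Chapman-Kolmogorov, keeping only the intermediate states reached by at most one jump. *)
Lemma transition_first_step d h x z M : 0 <= d -> 0 <= h ->
  packed_states x -> packed_states z ->
  p d x x * p h x z + \sum_(k < M | jump_rate t x k != 0)
    p d x (jump x k) * p h (jump x k) z <= p (d + h) x z.
Proof.
move=> d0 h0 px pz; rewrite -lee_fin (trans_chapman_kolmogorov hp) //.
have := @esum_ge_seq R _ packed_states (fun y => (p d x y * p h y z)%:E)
  (x :: [seq jump x (val k) | k <- enum 'I_M & jump_rate t x (val k) != 0]).
rewrite big_cons big_map big_filter big_enum_cond EFinD -sumEFin => -> //.
  rewrite cons_uniq; apply/andP; split.
    by apply/mapP => -[k _] /esym; exact: jump_neq.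
  rewrite map_inj_uniq; first by apply: filter_uniq; exact: enum_uniq.
  by move=> j k /jump_inj; exact: val_inj.
move=> y; rewrite inE => /orP[/eqP -> //|/mapP[k]].
by rewrite mem_filter => /andP[rk _] ->; apply: (packed_states_jump ht).
Qed.

Lemma limn_jump_rate x : packed_states x -> limn (series (jump_rate t x)) = 1.
Proof.
move=> [_ [N xN]]; apply: cvg_lim => //; apply: cvg_near_cst.
near=> m; rewrite seriesEnat /= big_mkord (sum_jump_rate1 ht xN) //.
by near: m; exists N.+1.
Unshelve. all: by end_near. Qed.

Lemma transition_stay x c : packed_states x -> 1 < c ->
  \forall d \near 0^'+, expR (- (c * d)) <= p d x x.
Proof.
move=> px c1; have [b b1 bc] : exists2 b, 1 < b & b < c by exists ((1 + c) / 2); lra.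
have := trans_exit hp px; rewrite limn_jump_rate // => cv.
near=> d.
have d0 : 0 < d by near: d; exact: nbhs_right_gt.
have : (1 - p d x x) / d < b.
  near: d; exact: (cvgr_lt _ cv).
rewrite ltr_pdivrMr // => pd.
(* Ensures (1 - b d) (1 + c d) >= 1, so that 1 - b d dominates 1 / (1 + c d) and hence exp(-c d). *)
have db : d < (c - b) / (c * (b)).
  near: d; apply: nbhs_right_lt; rewrite divr_gt0 ?subr_gt0 ?mulr_gt0 //; lra.
rewrite expRN; apply: (@le_trans _ _ (1 + c * d)^-1).
  rewrite lef_pV2 ?posrE ?expR_gt0 ?expR_ge1Dx //.
  by rewrite addr_gt0 // mulr_gt0 //; lra.
have cd : 0 < 1 + c * d by rewrite addr_gt0 // mulr_gt0 //; lra.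
apply: (@le_trans _ _ (1 - b * d)); last lra.
rewrite -[leLHS]mul1r ler_pdivrMr //.
move: db; rewrite ltr_pdivlMr; last by rewrite mulr_gt0 //; lra.
move=> db.
have dd : 0 < d * (c - b - d * (c * b)) by rewrite mulr_gt0 // subr_gt0.
have -> : (1 - b * d) * (1 + c * d) = 1 + d * (c - b - d * (c * b)) by ring.
by rewrite lerDl ltW.
Unshelve. all: by end_near. Qed.

Lemma transition_jump x k a : packed_states x -> jump_rate t x k != 0 -> a < 1 ->
  \forall d \near 0^'+, a * d * jump_rate t x k <= p d x (jump x k).
Proof.
move=> px r0 a1; have r_gt0 : 0 < jump_rate t x k.
  by rewrite lt_def r0 jump_rate_ge0 //; case: px.
have := trans_jump hp px (packed_states_jump ht px r0) => cv.
near=> d.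
have d0 : 0 < d by near: d; exact: nbhs_right_gt.
have : a * jump_rate t x k < p d x (jump x k) / d.
  near: d; apply: (cvgr_gt _ cv); by rewrite -[ltRHS]mul1r ltr_pM2r.
by rewrite ltr_pdivlMr // => /ltW; rewrite mulrAC.
Unshelve. all: by end_near. Qed.

(** Among m steps of length d, the n steps with a jump are chosen in binomially many ways. Cutting
    at [L] jumps of the first [M] particles involves finitely many states, so one range of d serves
    all m and z. *)
Lemma transition_discrete_bound M L x a c : packed_states x -> 0 < a < 1 -> 1 < c ->
  \forall d \near 0^'+, forall m z, packed_states z ->
    expR (- (c * d)) ^+ m *
      \sum_(n < L) 'C(m, n)%:R * (a * d) ^+ n * path_weight t M n x z
    <= p (m%:R * d) x z.
Proof.
move=> px a01 c1; elim: L x px => [|L IH] x px.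
  near=> d => m z pz; rewrite big_ord0 mulr0; apply: (trans_ge0 hp) => //.
  by rewrite mulr_ge0 // ltW //; near: d; exact: nbhs_right_gt.
have Hk : \forall d \near 0^'+, forall k : 'I_M, jump_rate t x k != 0 ->
   a * d * jump_rate t x k <= p d x (jump x k) /\
   forall m z, packed_states z ->
    expR (- (c * d)) ^+ m *
      \sum_(n < L) 'C(m, n)%:R * (a * d) ^+ n * path_weight t M n (jump x k) z
    <= p (m%:R * d) (jump x k) z.
  apply: filter_forall => k; have [->|r0] := eqVneq (jump_rate t x k) 0.
    by apply: nearW => d.
  have := IH _ (packed_states_jump ht px r0).
  have /andP[_ a1] := a01; have := transition_jump px r0 a1.
  by apply: filterS2 => d H1 H2 _; split.
have Hs := transition_stay px c1.
near=> d => m z pz.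
have d0 : 0 < d by near: d; exact: nbhs_right_gt.
have Hk' : forall k : 'I_M, jump_rate t x k != 0 ->
   a * d * jump_rate t x k <= p d x (jump x k) /\
   forall m z, packed_states z ->
    expR (- (c * d)) ^+ m *
      \sum_(n < L) 'C(m, n)%:R * (a * d) ^+ n * path_weight t M n (jump x k) z
    <= p (m%:R * d) (jump x k) z by near: d.
have Hs' : expR (- (c * d)) <= p d x x by near: d.
have [cx _] := px; have a0 : 0 < a by case/andP: a01.
move: (a * d) (mulr_gt0 a0 d0) Hk' => A A0 Hk1.
have c0 : 0 < c by lra.
have b1 : expR (- (c * d)) <= 1 by rewrite -expR0 ler_expR oppr_le0 ltW // mulr_gt0.
move: (expR (- (c * d))) (expR_gt0 (- (c * d))) b1 Hs' Hk1 => b b0 b1 Hs1 Hk1.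
have T0 K y j : configuration y ->
    0 <= \sum_(n < K) 'C(j, n)%:R * A ^+ n * path_weight t M n y z.
  move=> cy; apply: sumr_ge0 => n _.
  by rewrite mulr_ge0 ?path_weight_ge0 // mulr_ge0 // exprn_ge0 // ltW.
elim: m => [|m IHm].
  rewrite mul0r (trans_0 hp) // mul1r big_ord_recl big1 ?addr0.
    by rewrite bin0 !mul1r.
  by move=> i _; rewrite bin0n /= !mul0r.
rewrite -natr1 mulrDl mul1r [_ + d]addrC.
apply: le_trans (transition_first_step M (ltW d0) _ px pz); last first.
  by rewrite mulr_ge0 // ltW.
(* Pascal's rule: the first step is a stay or a jump. *)
have -> : \sum_(n < L.+1) 'C(m.+1, n)%:R * A ^+ n * path_weight t M n x z =
  \sum_(n < L.+1) 'C(m, n)%:R * A ^+ n * path_weight t M n x z +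
  \sum_(k < M | jump_rate t x k != 0) A * jump_rate t x k *
    \sum_(n < L) 'C(m, n)%:R * A ^+ n * path_weight t M n (jump x k) z.
  rewrite big_ord_recl [X in _ = X + _]big_ord_recl !bin0 -addrA; congr (_ + _).
  have -> : \sum_(k < M | jump_rate t x k != 0) A * jump_rate t x k *
      \sum_(n < L) 'C(m, n)%:R * A ^+ n * path_weight t M n (jump x k) z =
    \sum_(n < L) 'C(m, n)%:R * A ^+ n.+1 * path_weight t M n.+1 x z.
    rewrite big_mkcond /=; under [RHS]eq_bigr do rewrite mulr_sumr.
    rewrite exchange_big; apply: eq_bigr => k _; case: eqP => [->|_] /=.
      by rewrite big1 // => n _; rewrite mul0r mulr0.
    by rewrite mulr_sumr; apply: eq_bigr => n _; rewrite exprS; ring.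
  rewrite -big_split; apply: eq_bigr => n _ /=.
  by rewrite /bump /= add1n binS natrD !mulrDl.
rewrite mulrDr; apply: lerD.
  rewrite exprS -mulrA; apply: ler_pM => //; first exact: ltW.
  by rewrite mulr_ge0 ?exprn_ge0 ?T0 // ltW.
rewrite mulr_sumr; apply: ler_sum => k rk; have [H1 H2] := Hk1 k rk.
have r0 := jump_rate_ge0 ht k cx.
apply: le_trans (ler_pM _ _ H1 (H2 m z pz)).
- rewrite mulrCA; apply: ler_wpM2l; first by rewrite mulr_ge0 // ltW.
  apply: ler_wpM2r; first by apply: T0; apply: (configuration_jump ht cx rk).
  by rewrite exprS ler_piMl // exprn_ge0 // ltW.
- by rewrite mulr_ge0 // ltW.
- apply: mulr_ge0; first by rewrite exprn_ge0 // ltW.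
  by apply: T0; apply: (configuration_jump ht cx rk).
Unshelve. all: by end_near. Qed.

End TransitionFunction.

Lemma esumZl (R : realType) (T : choiceType) (S : set T) (r : R) (f : T -> \bar R) :
  0 <= r -> (forall i, 0 <= f i)%E ->
  (\esum_(i in S) (r%:E * f i) = r%:E * \esum_(i in S) f i)%E.
Proof.
move=> r0 f0; rewrite /esum -ereal_supZl //; last first.
  by apply/set0P; eexists; exists set0 => //; exact: fsets_set0.
rewrite image_comp; congr ereal_sup.
by apply: eq_imagel => A _ /=; rewrite ge0_mule_fsumr.
Qed.

(** Compares the binomial coefficients of the discrete bound with the Poisson weights h^n / n!. *)
Lemma ffact_ge (R : realType) (a : R) (L N k : nat) : 0 <= a ->
  L%:R <= (1 - a) * N%:R -> (k <= L)%N ->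
  (a * N%:R) ^+ k <= (N ^_ k)%:R :> R.
Proof.
move=> a0 LN; elim: k => [|k IH] kL; first by rewrite ffactn0.
rewrite exprSr ffactnSr natrM; apply: ler_pM; rewrite ?IH //.
- by rewrite exprn_ge0 // mulr_ge0.
- by rewrite mulr_ge0.
- exact: ltnW.
have kL' : k%:R <= L%:R :> R by rewrite ler_nat ltnW.
rewrite natrB; first by lra.
rewrite -(ler_nat R); apply: le_trans kL' (le_trans LN _).
by rewrite ler_piMl //; lra.
Qed.

Section TransitionFunction.
Variables (R : realType) (t : R).
Hypothesis ht : 0 < t < 1.

(** The jump chain run for a Poisson(h) number of steps, restricted to fewer than [L] jumps. *)
Definition partial_transition (L M : nat) (h : R) (x z : nat -> int) : R :=
  expR (- h) * \sum_(n < L) h ^+ n / (n`!)%:R * path_weight t M n x z.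

Lemma partial_transition_ge0 L M h x z : 0 <= h -> configuration x ->
  0 <= partial_transition L M h x z.
Proof.
move=> h0 cx; rewrite mulr_ge0 ?expR_ge0 //; apply: sumr_ge0 => n _.
by rewrite mulr_ge0 ?path_weight_ge0 // divr_ge0 ?exprn_ge0.
Qed.

(** Only particles 0, ..., N can move when all from N on are packed, so each jump raises N by at
    most one; no possible jump is lost as long as N + n < M. *)
Lemma esum_path_weight M N n x : packed_states x ->
  (forall k, (N <= k)%N -> x k = packed k) -> (N + n < M)%N ->
  (\esum_(z in packed_states) (path_weight t M n x z)%:E = 1)%E.
Proof.
elim: n N x => [|n IH] N x px xN NM.
  rewrite (esumID [set x]); last by move=> z _; rewrite lee_fin /= ler0n.
  have -> : packed_states `&` [set x] = [set x].
    by apply/seteqP; split => [z []//|z ->]; split.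
  rewrite esum_set1 /= ?eqxx ?lee01 // esum1 ?adde0 // => z [_ /= zx].
  by case: eqVneq => // xz; case: zx.
have px' k := packed_states_jump ht px (k := k).
under eq_esum do rewrite /= -sumEFin.
rewrite esum_sum; last first.
  move=> z k _ _; rewrite lee_fin; have [->|r0] := eqVneq (jump_rate t x k) 0.
    by rewrite mul0r.
  by rewrite mulr_ge0 ?jump_rate_ge0 ?path_weight_ge0 //; [case: px|case: (px' k r0)].
have rk (k : 'I_M) : (\esum_(z in packed_states)
    (jump_rate t x k * path_weight t M n (jump x k) z)%:E = (jump_rate t x k)%:E)%E.
  have [->|r0] := eqVneq (jump_rate t x k) 0.
    by rewrite esum1 // => z _; rewrite mul0r.
  have kN : (k <= N)%N.
    rewrite leqNgt; apply/negP => Nk; move: r0; rewrite (jump_rateE ht).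
    case: (nat_of_ord k) Nk => // k' Nk; rewrite (xN k'.+1 (ltnW Nk)) (xN k' Nk).
    by rewrite /packed !addNr expr0z subrr eqxx.
  under eq_esum do rewrite EFinM.
  rewrite esumZl; first rewrite (IH N.+1 _ (px' k r0)) ?mule1 //.
  - move=> j Nj; rewrite /jump gtn_eqF ?xN //; [exact: ltnW|].
    exact: leq_ltn_trans Nj.
  - by rewrite addSnnS.
  - by rewrite jump_rate_ge0 //; case: px.
  - by move=> z; rewrite lee_fin path_weight_ge0 //; case: (px' k r0).
rewrite (eq_bigr (fun k : 'I_M => (jump_rate t x k)%:E)) //.
by rewrite sumEFin (sum_jump_rate1 ht xN) //; lia.
Qed.

Lemma esum_partial_transition L M N h x : 0 <= h -> packed_states x ->
  (forall k, (N <= k)%N -> x k = packed k) -> (N + L <= M)%N ->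
  (\esum_(z in packed_states) (partial_transition L M h x z)%:E =
   (expR (- h) * \sum_(n < L) h ^+ n / (n`!)%:R)%:E)%E.
Proof.
move=> h0 px xN NM; have [cx _] := px.
under eq_esum do rewrite /partial_transition mulr_sumr -sumEFin.
rewrite esum_sum; last first.
  move=> z n _ _; rewrite lee_fin mulr_ge0 ?expR_ge0 // mulr_ge0 ?path_weight_ge0 //.
  by rewrite divr_ge0 ?exprn_ge0.
rewrite mulr_sumr -sumEFin; apply: eq_bigr => n _.
under eq_esum do rewrite mulrA EFinM.
rewrite esumZl.
- by rewrite (esum_path_weight px xN) ?mule1 //; have := ltn_ord n; lia.
- by rewrite mulr_ge0 ?expR_ge0 // divr_ge0 ?exprn_ge0.
- by move=> z; rewrite lee_fin path_weight_ge0.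
Qed.

Variable p : R -> (nat -> int) -> (nat -> int) -> R.
Hypothesis hp : tasep_transition t p.

(** The discrete bound with many steps of length h / N, a = 1 - e and c = 1 + e, and then e tends to
    0. In (1 - e)^(2 L), one half pays for [ffact_ge] and the other for the factors a of the
    jumps. *)
Lemma partial_transition_le L M h x z : 0 <= h -> packed_states x ->
  packed_states z -> partial_transition L M h x z <= p h x z.
Proof.
move=> h0 px pz; have [cx _] := px.
have [->|hn0] := eqVneq h 0.
  rewrite /partial_transition oppr0 expR0 mul1r (trans_0 hp) //.
  case: L => [|L]; first by rewrite big_ord0 ler0n.
  rewrite big_ord_recl big1 ?addr0 => [|n _]; first by rewrite expr0 divr1 mul1r.
  by rewrite expr0n /= !mul0r.
have h_gt0 : 0 < h by rewrite lt_def hn0.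
set S := \sum_(n < L) h ^+ n / (n`!)%:R * path_weight t M n x z.
have S0 : 0 <= S.
  apply: sumr_ge0 => n _; rewrite mulr_ge0 ?path_weight_ge0 //.
  by rewrite divr_ge0 ?exprn_ge0.
have bound (e : R) : 0 < e -> e < 1 ->
    expR (- ((1 + e) * h)) * (1 - e) ^+ (2 * L) * S <= p h x z.
  move=> e0 e1; set a := 1 - e; set c := 1 + e.
  have a01 : 0 < a < 1 by rewrite /a; lra.
  have c1 : 1 < c by rewrite /c; lra.
  have := transition_discrete_bound ht hp M L px a01 c1.
  move=> /nbhs_ballP[r /= r0 Hr].
  (* N must exceed h / r, to make the step small enough, and L / e, for [ffact_ge]. *)
  have r1 : 0 <= h / r + L%:R / e by rewrite addr_ge0 // divr_ge0 // ltW.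
  have := archi_boundP r1; set N := Num.bound _ => Nb.
  have Nr : h / r < N%:R by apply: le_lt_trans Nb; rewrite lerDl divr_ge0 // ltW.
  have Ne : L%:R / e < N%:R by apply: le_lt_trans Nb; rewrite lerDr divr_ge0 // ltW.
  have N0 : 0 < N%:R :> R by apply: le_lt_trans Nr; rewrite divr_ge0 // ltW.
  have hN : 0 < h / N%:R by rewrite divr_gt0.
  have Nh : N%:R * (h / N%:R) = h by rewrite mulrC divfK ?gt_eqF.
  rewrite -[h in leRHS]Nh; apply: le_trans (Hr _ _ hN N z pz); last first.
    by rewrite /ball /= sub0r normrN gtr0_norm // ltr_pdivrMr // mulrC -ltr_pdivrMr.
  rewrite -expRM_natl mulrN [N%:R * _]mulrCA Nh -mulrA.
  rewrite ler_wpM2l ?expR_ge0 // mulr_sumr; apply: ler_sum => n _.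
  rewrite [leLHS]mulrA ler_wpM2r ?path_weight_ge0 //.
  have a0 : 0 <= a by case/andP: a01 => /ltW.
  have LN : L%:R <= (1 - a) * N%:R.
    by rewrite /a opprB addrCA subrr addr0 mulrC -ler_pdivrMr // ltW.
  have := ffact_ge a0 LN (ltnW (ltn_ord n)) => fN.
  have n0 : 0 < (n`!)%:R :> R by rewrite ltr0n fact_gt0.
  rewrite [leLHS]mulrA ler_pdivrMr // [leRHS]mulrAC -natrM bin_ffact.
  apply: (@le_trans _ _ ((a * N%:R) ^+ n * (a * (h / N%:R)) ^+ n)); last first.
    by rewrite ler_wpM2r // exprn_ge0 // mulr_ge0 // ltW.
  rewrite -exprMn; have -> : a * N%:R * (a * (h / N%:R)) = a ^+ 2 * h.
    by field; rewrite gt_eqF.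
  rewrite exprMn -exprM ler_wpM2r ?exprn_ge0 //.
  apply: ler_wiXn2l => //; first by case/andP: a01 => _ /ltW.
  by rewrite leq_pmul2l // ltnW.
have cv : expR (- ((1 + e) * h)) * (1 - e) ^+ (2 * L) * S @[e --> 0^'+] -->
    expR (- h) * S.
  apply: cvg_at_right_filter; apply: cvgM; last exact: cvg_cst.
  have -> : expR (- h) = expR (- ((1 + 0) * h)) * (1 - 0) ^+ (2 * L).
    by rewrite addr0 mul1r subr0 expr1n mulr1.
  apply: cvgM.
    apply: (continuous_comp (f := fun e : R => - ((1 + e) * h))).
      apply: cvgN; apply: cvgM; last exact: cvg_cst.
      by apply: cvgD; [exact: cvg_cst|exact: cvg_id].
    exact: continuous_expR.
  apply: (continuous_comp (f := fun e : R => 1 - e) (g := fun e => e ^+ (2 * L))).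
    by apply: cvgB; [exact: cvg_cst|exact: cvg_id].
  exact: exprn_continuous.
apply: (cvgr_to_le cv); near=> e; apply: bound.
  by near: e; exact: nbhs_right_gt.
by near: e; apply: nbhs_right_lt.
Unshelve. all: by end_near. Qed.

End TransitionFunction.

(** * Chain coefficients and the value of the transition function *)

Section DescentCoef.
Variables (K : numFieldType) (t : K).

Lemma descent_coef_eq0 M n mu la : is_part la -> (sumn la < n)%N ->
  descent_coef t M n mu la = 0.
Proof.
elim: n la => [//|n IH] la pa ln; rewrite descent_coefS big1 // => v _.
have [vl|vl] := boolP (v \in la); last by rewrite (count_memPn vl) subrr mul0r.
have [pl sl _] := lower_in pa vl.
by rewrite IH ?mulr0 // -ltnS -sl.
Qed.

Lemma descent_coef_widen M M' n mu la : is_part la -> all (geq M) la ->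
  (M <= M')%N -> descent_coef t M' n mu la = descent_coef t M n mu la.
Proof.
move=> + + MM; elim: n la => [|n IH] la pa aM; first by rewrite !descent_coef0.
rewrite !descent_coefS -(subnKC MM) iotaD big_cat /= [X in _ + X]big_seq.
rewrite [X in _ + X]big1 ?addr0 => [|v].
  apply: eq_bigr => v _; rewrite -{1}[M']/M' subnKC // IH //.
    exact: is_part_lower.
  exact: all_lower.
rewrite mem_iota add1n => /andP[Mv _].
rewrite (count_memPn _) ?subrr ?mul0r //.
by apply/negP => /(allP aM) /=; rewrite leqNgt Mv.
Qed.

Hypothesis t_ge0 : 0 <= t.
Hypothesis t_lt1 : t < 1.

Lemma descent_coef_ge0 M n mu la : 0 <= descent_coef t M n mu la.
Proof.
elim: n la => [|n IH] la; first by rewrite descent_coef0 ler0n.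
rewrite descent_coefS; apply: sumr_ge0 => v _; rewrite mulr_ge0 // subr_ge0.
by rewrite exprn_ile1 // ltW.
Qed.

(** One chain of positive weight suffices: always remove the bottom box of the column given by the
    largest part. *)
Lemma descent_coef_gt0 M la : is_part la -> all (geq M) la ->
  0 < descent_coef t M (sumn la) [::] la.
Proof.
have [n] : exists n, (sumn la <= n)%N by exists (sumn la).
elim: n la => [|n IH] la.
  case: la => [|a s].
    by rewrite [sumn [::]]/= descent_coef0 eqxx ltr01.
  by rewrite is_part_cons /= => al /and3P[a0 _ _]; exfalso; lia.
case: la => [|a s].
  by rewrite [sumn [::]]/= descent_coef0 eqxx ltr01.
move=> ln pa aM; have va : a \in a :: s by rewrite mem_head.
have [pl sl al] := lower_in pa va; rewrite sl descent_coefS.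
have aM' := allP aM a va; have a0 := is_part_gt0 pa va.
rewrite (big_rem a) /=; last by rewrite mem_iota add1n ltnS a0.
rewrite ltr_pwDl //; last first.
  apply: sumr_ge0 => v _; rewrite mulr_ge0 ?descent_coef_ge0 // subr_ge0.
  by rewrite exprn_ile1 // ltW.
rewrite mulr_gt0 //; first by rewrite subr_gt0 exprn_ilt1 // eqxx.
by apply: IH => //; [rewrite -ltnS -sl|exact: al].
Qed.

Lemma descent_series_gt0 M s la : is_part la -> all (geq M) la -> 0 < s ->
  0 < descent_series t M s [::] la.
Proof.
move=> pa aM s0; rewrite /descent_series big_ord_recr /= ltr_wpDl //.
  apply: sumr_ge0 => k _.
  by rewrite mulr_ge0 ?descent_coef_ge0 // divr_ge0 ?exprn_ge0 // ltW.
by rewrite mulr_gt0 ?descent_coef_gt0 // divr_gt0 ?exprn_gt0 // ltr0n fact_gt0.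
Qed.

End DescentCoef.

Section TransitionValue.
Variables (R : realType) (t : R).
Hypothesis ht : 0 < t < 1.
Variable p : R -> (nat -> int) -> (nat -> int) -> R.
Hypothesis hp : tasep_transition t p.

Lemma principal_weight_gt0 la : 0 < principal_weight t la.
Proof.
case/andP: ht => t0 t1; rewrite /principal_weight divr_gt0 ?exprn_gt0 //.
apply: prodr_gt0 => i _; rewrite /tpoch big_seq; apply: prodr_gt0 => j.
rewrite mem_index_iota => /andP[j0 _].
by rewrite subr_gt0 exprn_ilt1 ?ltW // -lt0n.
Qed.

Lemma partial_transition_descents L M h (mu la : intpart) : all (geq M) la ->
  (sumn la < L)%N ->
  partial_transition t L M h (particles mu) (particles la) =
  expR (- h) * descent_series t M h mu la *
    (principal_weight t la / principal_weight t mu).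
Proof.
move=> aM lL; rewrite /partial_transition -mulrA; congr (_ * _).
have pE n : path_weight t M n (particles mu) (particles la) =
    descent_coef t M n mu la * (principal_weight t la / principal_weight t mu).
  rewrite mulrA -(path_weight_descents ht) // mulfK //.
  by rewrite gt_eqF // principal_weight_gt0.
under eq_bigr do rewrite pE mulrA.
rewrite -mulr_suml; congr (_ * _).
rewrite /descent_series -(big_mkord predT (fun n => h ^+ n / (n`!)%:R * descent_coef t M n mu la)).
rewrite (@big_cat_nat _ _ _ (sumn la).+1) //= big_mkord.
rewrite [X in _ + X]big_nat_cond [X in _ + X]big1 ?addr0 // => n /andP[/andP[ln _] _].
by rewrite descent_coef_eq0 ?mulr0 //; exact: partsP.
Qed.

(** For the upper bound, [p] dominates everywhere a partial transition of total mass [s L] and has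
    mass 1 itself, so at a single state it is larger by at most 1 - [s L], which tends to 0. *)
Lemma transition_value M h (mu la : intpart) : 0 <= h -> all (geq M) la ->
  p h (particles mu) (particles la) = expR (- h) * descent_series t M h mu la *
    (principal_weight t la / principal_weight t mu).
Proof.
move=> h0 aM; set T := RHS.
have [pmu pla] := (particles_packed_states mu, particles_packed_states la).
apply/eqP; rewrite eq_le; apply/andP; split; last first.
  rewrite /T -(@partial_transition_descents (sumn la).+1) //.
  exact: (partial_transition_le ht hp).
pose s L := expR (- h) * \sum_(n < L) h ^+ n / (n`!)%:R : R.
have sT L : (sumn la < L)%N -> p h (particles mu) (particles la) <= T + (1 - s L).
  (* [M'] covers the parts of [la] and every particle that fewer than [L] jumps from [mu] can
     move. *)
  move=> lL; have [cmu [N muN]] := pmu; pose M' := maxn M (N + L).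
  have MM : (M <= M')%N by rewrite leq_maxl.
  have aM' : all (geq M') la by apply/allP => j /(allP aM) /=; lia.
  have -> : T = partial_transition t L M' h (particles mu) (particles la).
    rewrite partial_transition_descents // /T /descent_series.
    congr (_ * _ * _); apply: eq_bigr => n _; congr (_ * _).
    by rewrite (descent_coef_widen t n mu (partsP la) aM MM).
  have tr0 z : 0 <= partial_transition t L M' h (particles mu) z.
    exact: partial_transition_ge0.
  have pt0 z : packed_states z ->
      0 <= p h (particles mu) z - partial_transition t L M' h (particles mu) z.
    by move=> pz; rewrite subr_ge0 (partial_transition_le ht hp).
  have E : (\esum_(z in packed_states)
      ((partial_transition t L M' h (particles mu) z)%:E +
       (p h (particles mu) z - partial_transition t L M' h (particles mu) z)%:E) = 1)%E.
    rewrite -(trans_sum hp h0 pmu); apply: eq_esum => z _.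
    by rewrite -EFinD addrC subrK.
  rewrite esumD in E; last 2 first.
  - by move=> z _; rewrite lee_fin.
  - by move=> z pz; rewrite lee_fin pt0.
  rewrite (esum_partial_transition ht h0 pmu muN) ?leq_maxr // in E.
  have H := @esum_ge_seq R _ packed_states (fun z => (p h (particles mu) z -
    partial_transition t L M' h (particles mu) z)%:E) [:: particles la] isT.
  have {}H := leeD2l (s L)%:E (H (fun z zl => ltac:(
    by move: zl; rewrite inE => /eqP ->))).
  rewrite E big_seq1 -EFinD lee_fin in H; lra.
have cs : T + (1 - s L) @[L --> \oo] --> T + (1 - 1).
  apply: cvgD; first exact: cvg_cst.
  apply: cvgB; first exact: cvg_cst.
  rewrite -[X in _ --> X](expRxMexpNx_1 h) mulrC; apply: cvgM; first exact: cvg_cst.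
  have := is_cvg_series_exp_coeff h; rewrite -/(expR h) => /cvg_ex[l sl].
  have <- : l = expR h by apply/esym/cvg_lim.
  apply: cvg_trans sl; apply: near_eq_cvg; near=> L.
  by rewrite seriesEnat /= big_mkord.
rewrite subrr addr0 in cs.
apply: (cvgr_to_ge cs); near=> L; apply: sT.
by near: L; exists (sumn la).+1.
Unshelve. all: by end_near. Qed.

End TransitionValue.

(** * Laws on countable sets *)

HB.instance Definition _ := [Countable of intpart by <:].

Lemma countable_bigcup_measurable (d : measure_display) (Omega : measurableType d)
    (T : countType) (E : T -> set Omega) (A : set T) :
  (forall a, measurable (E a)) -> measurable (\bigcup_(a in A) E a).
Proof.
move=> mE.
have -> : \bigcup_(a in A) E a =
    \bigcup_n oapp (fun a => if `[<A a>] then E a else set0) set0 (pickle_inv n).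
  apply/seteqP; split=> [w [a Aa Ea]|w [n _]].
    by exists (choice.pickle a) => //; rewrite pickleK_inv /=; case: asboolP.
  case E0: (pickle_inv n) => [a|] //=.
  by case: asboolP => // Aa Ea; exists a.
apply: bigcupT_measurable => n; case: (pickle_inv n) => [a|] //=.
by case: asboolP.
Qed.

Section CountableLaw.
Variables (R : realType) (d : measure_display) (Omega : measurableType d).
Variables (Pr : probability Omega R) (T : countType) (E : T -> set Omega).
Hypothesis mE : forall a, measurable (E a).
Hypothesis tE : trivIset setT E.

Lemma probability_countable_bigcup (A : set T) : Pr (\bigcup_(a in A) E a) =
  (\sum_(0 <= n <oo) oapp (fun a => if `[<A a>] then Pr (E a) else 0) 0
     (pickle_inv n))%E.
Proof.
pose F n := oapp (fun a => if `[<A a>] then E a else set0) set0 (pickle_inv n).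
have -> : \bigcup_(a in A) E a = \bigcup_n F n.
  apply/seteqP; split=> [w [a Aa Ea]|w [n _]]; rewrite /F.
    by exists (choice.pickle a) => //; rewrite pickleK_inv /=; case: asboolP.
  case E0: (pickle_inv n) => [a|] //=.
  by case: asboolP => // Aa Ea; exists a.
have mF n : measurable (F n).
  by rewrite /F; case: (pickle_inv n) => [a|] //=; case: asboolP.
rewrite measure_semi_bigcup //; last exact: bigcupT_measurable.
  apply: eq_eseriesr => n _; rewrite /F; case: (pickle_inv n) => [a|] /=.
    by case: asboolP => // _; rewrite measure0.
  by rewrite measure0.
apply/trivIsetP => m n _ _ mn; apply/seteqP; split=> // w [].
rewrite /F; have := @pickle_invK T m; have := @pickle_invK T n.
case: (pickle_inv m) => [a|] //=; case: (pickle_inv n) => [b|] //= bn am.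
case: asboolP => // _; case: asboolP => // _ Ea Eb.
have ab : a = b by apply: tE => //; exists w.
by move: mn; rewrite -bn -am ab eqxx.
Qed.

End CountableLaw.

Section TwoLaws.
Variables (R : realType) (d d' : measure_display).
Variables (Omega : measurableType d) (Omega' : measurableType d').
Variables (Pr : probability Omega R) (Pr' : probability Omega' R).
Variables (T : countType) (E : T -> set Omega) (E' : T -> set Omega').
Hypothesis mE : forall a, measurable (E a).
Hypothesis tE : trivIset setT E.
Hypothesis pE : (Pr (\bigcup_a E a) = 1)%E.
Hypothesis mE' : forall a, measurable (E' a).
Hypothesis tE' : trivIset setT E'.
Hypothesis pE' : (Pr' (\bigcup_a E' a) = 1)%E.

(** An atom is 1 minus its complement, and domination of the other atoms reverses the inequality. *)
Lemma countable_law_le : (forall a, Pr' (E' a) <= Pr (E a))%E ->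
  forall a, Pr' (E' a) = Pr (E a).
Proof.
move=> H a.
have split1 d0 (O : measurableType d0) (P : probability O R) (F : T -> set O) :
    (forall a, measurable (F a)) -> trivIset setT F -> (P (\bigcup_a F a) = 1)%E ->
    (P (F a) = 1 - P (\bigcup_(b in [set b | b <> a]) F b))%E.
  move=> mF tF pF; have mb := @countable_bigcup_measurable _ _ _ _ [set b | b <> a] mF.
  rewrite -pF; have -> : \bigcup_b F b = F a `|` \bigcup_(b in [set b | b <> a]) F b.
    apply/seteqP; split=> [w [b _ Fb]|w [Fa|[b _ Fb]]].
    - by have [<-|ba] := pselect (b = a); [left|right; exists b].
    - by exists a.
    - by exists b.
  rewrite measureU ?addeK ?fin_num_measure //.
  apply/seteqP; split=> // w [Fa [b ba Fb]]; apply: ba.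
  by apply: tF => //; exists w.
apply/eqP; rewrite eq_le H /= (split1 _ _ Pr E) // (split1 _ _ Pr' E') //.
apply: leeB => //; rewrite !probability_countable_bigcup //.
apply: lee_nneseries => [n _ _|n _]; case: (pickle_inv n) => [b|] //=.
  by case: asboolP.
by case: asboolP.
Qed.

(** The events are compared on the atoms only; the rest of each space is a null set. *)
Lemma countable_law_eq (A : set T) (B : set Omega) (B' : set Omega') :
  (forall a, Pr' (E' a) = Pr (E a)) -> measurable B -> measurable B' ->
  (forall a w, E a w -> (B w <-> A a)) -> (forall a w, E' a w -> (B' w <-> A a)) ->
  Pr B = Pr' B'.
Proof.
move=> EE mB mB' BA BA'.
have part d0 (O : measurableType d0) (P : probability O R) (F : T -> set O) C :
    (forall a, measurable (F a)) -> (P (\bigcup_a F a) = 1)%E -> measurable C ->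
    (forall a w, F a w -> (C w <-> A a)) -> P C = P (\bigcup_(a in A) F a).
  move=> mF pF mC CA; have mU := @countable_bigcup_measurable _ _ _ _ setT mF.
  have -> : \bigcup_(a in A) F a = C `&` \bigcup_a F a.
    apply/seteqP; split=> [w [a Aa Fa]|w [Cw [a _ Fa]]].
      by split; [exact/(CA a)|exists a].
    by exists a => //; exact/(CA a w).
  rewrite -[C in LHS](setIT C) -(setvU (\bigcup_a F a)) setIUr measureU.
  - have mI : measurable (C `&` ~` (\bigcup_a F a)).
      by apply: measurableI => //; exact: measurableC.
    have nU : P (~` (\bigcup_a F a)) = 0%E by rewrite probability_setC // pF subee.
    rewrite -[RHS]add0e; congr (_ + _)%E.
    by apply: (subset_measure0 mI (measurableC mU) _ nU); exact: subIsetr.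
  - by apply: measurableI => //; exact: measurableC.
  - exact: measurableI.
  - by rewrite setIACA setICl setI0.
rewrite (part _ _ Pr E) // (part _ _ Pr' E') // !probability_countable_bigcup //.
by apply: eq_eseriesr => n _; case: (pickle_inv n) => [a|] //=; rewrite EE.
Qed.

End TwoLaws.

Lemma measurable_multitime (R : realType) (d : measure_display)
    (Omega : measurableType d) (Y : R -> Omega -> nat -> int) n (tau : 'I_n -> R) :
  (forall i k z, measurable [set w | Y (tau i) w k = z]) ->
  forall A, multitime_events A -> measurable [set w | A (fun i => Y (tau i) w)].
Proof.
move=> mY; apply: smallest_sub.
  split=> [|A mA|F mF].
  - exact: measurable0.
  - have -> : [set w | (setT `\` A) (fun i => Y (tau i) w)] =
      ~` [set w | A (fun i => Y (tau i) w)].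
      by apply/seteqP; split=> w /=; [case|split].
    exact: measurableC.
  - have -> : [set w | (\bigcup_k F k) (fun i => Y (tau i) w)] =
      \bigcup_k [set w | F k (fun i => Y (tau i) w)].
      by apply/seteqP; split=> w [k _ Fk]; exists k.
    exact: bigcupT_measurable.
by move=> _ [i [k [z ->]]]; exact: mY.
Qed.

(** * Finite-dimensional distributions *)

Local Notation "x %:C" := (real_complex _ x) : ring_scope.

Section Morphism.
Variables (K L : numFieldType) (f : {rmorphism K -> L}) (t : K).

(** Hall-Littlewood functions are taken over the complex numbers and t-TASEP over the reals; these
    morphism lemmas connect the two. *)
Lemma rmorph_descent_coef M n mu la :
  f (descent_coef t M n mu la) = descent_coef (f t) M n mu la.
Proof.
elim: n la => [|n IH] la; first by rewrite !descent_coef0 rmorph_nat.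
rewrite !descent_coefS rmorph_sum; apply: eq_bigr => v _.
by rewrite rmorphM rmorphB rmorph1 rmorphXn IH.
Qed.

Lemma rmorph_descent_series M s mu la :
  f (descent_series t M s mu la) = descent_series (f t) M (f s) mu la.
Proof.
rewrite rmorph_sum; apply: eq_bigr => k _.
by rewrite rmorphM fmorph_div rmorphXn rmorph_nat rmorph_descent_coef.
Qed.

Lemma rmorph_hl_b la : f (hl_b t la) = hl_b (f t) la.
Proof.
rewrite rmorph_prod; apply: eq_bigr => i _; rewrite rmorph_prod.
by apply: eq_bigr => j _; rewrite rmorphB rmorph1 rmorphXn.
Qed.

End Morphism.

Lemma measurable_forall_ord (d : measure_display) (Omega : measurableType d) n
    (B : 'I_n -> set Omega) :
  (forall i, measurable (B i)) -> measurable [set w | forall i, B i w].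
Proof.
move=> mB; have -> : [set w | forall i, B i w] = \bigcap_(i in [set: 'I_n]) B i.
  by apply/seteqP; split=> w /= H i; [move=> _|]; exact: H.
by apply: fin_bigcap_measurable => // i _; exact: mB.
Qed.

Lemma probability_setI1 (R : realType) (d : measure_display)
    (Omega : measurableType d) (Pr : probability Omega R) (A B : set Omega) :
  measurable A -> measurable B -> Pr B = 1%E -> Pr (A `&` B) = Pr A.
Proof.
move=> mA mB B1.
have nB : Pr (~` B) = 0%E by rewrite probability_setC // B1 subee.
rewrite [RHS](measureDI _ mA mB) -[LHS]add0e; congr (_ + _)%E; apply/esym.
by apply: (subset_measure0 (measurableD mA mB) (measurableC mB) _ nB) => w [].
Qed.

Lemma probability_forall1 (R : realType) (d : measure_display)
    (Omega : measurableType d) (Pr : probability Omega R) (I : eqType) (s : seq I)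
    (B : I -> set Omega) :
  (forall i, measurable (B i)) -> (forall i, Pr (B i) = 1%E) ->
  measurable [set w | forall i, i \in s -> B i w] /\
  Pr [set w | forall i, i \in s -> B i w] = 1%E.
Proof.
move=> mB B1; elim: s => [|a s [IHm IH1]].
  have -> : [set w | forall i, i \in [::] -> B i w] = setT by apply/seteqP; split.
  by rewrite probability_setT; split.
have -> : [set w | forall i, i \in a :: s -> B i w] =
    [set w | forall i, i \in s -> B i w] `&` B a.
  apply/seteqP; split=> w /= H.
    by split=> [i si|]; apply: H; rewrite inE ?si ?orbT ?eqxx.
  by move=> i; rewrite inE => /orP[/eqP->|]; case: H => [H1 H2] //; exact: H1.
by rewrite probability_setI1 //; split=> //; exact: measurableI.
Qed.

Section Tasep.
Variables (R : realType) (t : R).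
Hypothesis ht : 0 < t < 1.
Variables (d : measure_display) (Omega : measurableType d).
Variables (Pr : probability Omega R) (X : R -> Omega -> nat -> int).
Hypothesis hX : slowed_tTASEP t Pr X.
Variable p : R -> (nat -> int) -> (nat -> int) -> R.
Hypothesis hp : tasep_transition t p.
Hypothesis markov : forall (n : nat) (tau : nat -> R) (x : nat -> nat -> int),
  tau 0%N = 0 -> (forall j, (j < n)%N -> tau j <= tau j.+1) ->
  (forall j, (j <= n)%N -> packed_states (x j)) ->
  (Pr [set w | forall j, (j <= n)%N -> X (tau j) w = x j] =
   ((x 0%N == packed)%:R *
    \prod_(j < n) p (tau j.+1 - tau j) (x j) (x j.+1))%:E)%E.

Lemma measurable_state tau x : 0 <= tau -> measurable [set w | X tau w = x].
Proof.
move=> t0; have -> : [set w | X tau w = x] = \bigcap_k [set w | X tau w k = x k].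
  apply/seteqP; split=> w /= H; first by move=> k _; rewrite /= H.
  by apply/funext => k; exact: H.
by apply: bigcapT_measurable => k; exact: (tasep_measurable hX).
Qed.

Lemma packed_states_packed : packed_states packed.
Proof. by rewrite -particles_empty; exact: (particles_packed_states empty_partition). Qed.

Lemma tasep_initial : Pr [set w | X 0 w = packed] = 1%E.
Proof.
have := @markov 0%N (fun=> 0) (fun=> packed) erefl (fun j => ltac:(by [])) (fun _ _ => packed_states_packed).
rewrite eqxx big_ord0 mulr1 => <-; congr (Pr _); apply/seteqP; split=> w /=.
  by move=> H j _.
by move=> /(_ 0%N isT).
Qed.

Lemma tasep_one_time tau y : 0 <= tau -> packed_states y ->
  Pr [set w | X tau w = y] = (p tau packed y)%:E.
Proof.
move=> t0 py; have pp := packed_states_packed.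
have := @markov 1%N (fun j => if j == 0%N then 0 else tau)
  (fun j => if j == 0%N then packed else y) erefl.
rewrite /= (eqxx packed) big_ord1 /= subr0 mul1r => <-; last 2 first.
- by case.
- by case=> [|[]].
rewrite -(probability_setI1 (measurable_state y t0) (measurable_state packed (lexx 0)) tasep_initial).
congr (Pr _); apply/seteqP; split=> w /=.
  by move=> [Xy X0] [|[]].
by move=> H; split; [exact: (H 1%N)|exact: (H 0%N)].
Qed.

Lemma trivIset_state tau : trivIset setT (fun y => [set w | X tau w = y]).
Proof. by move=> x y _ _ [w /= [-> ->]]. Qed.

Lemma trivIset_particles tau :
  trivIset setT (fun la : intpart => [set w | X tau w = particles la]).
Proof. by move=> x y _ _ [w /= [-> /particles_inj ->]]. Qed.

(** The one-time probabilities sum to 1 by [trans_sum], and every finite partial sum is the measure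
    of a part of this union. *)
Lemma tasep_packed tau : 0 <= tau ->
  Pr (\bigcup_(la : intpart) [set w | X tau w = particles la]) = 1%E.
Proof.
move=> t0; have mU : measurable (\bigcup_(la : intpart) [set w | X tau w = particles la]).
  by apply: countable_bigcup_measurable => la; exact: measurable_state.
apply/eqP; rewrite eq_le probability_le1 //=.
rewrite -(trans_sum hp t0 packed_states_packed).
apply: ge_ereal_sup => _ [F [finF FP] <-].
rewrite (eq_fsbigr (fun y => Pr [set w | X tau w = y])); last first.
  by move=> y; rewrite inE => /FP py; rewrite tasep_one_time.
have mF : forall y, F y -> measurable [set w | X tau w = y].
  by move=> y _; exact: measurable_state.
have tF : trivIset F (fun y => [set w | X tau w = y]).
  by move=> x y _ _; exact: trivIset_state.
rewrite -(measure_fin_bigcup _ finF tF mF); apply: le_measure; rewrite ?inE //.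
  exact: fin_bigcup_measurable.
move=> w [y /FP/particles_surj[la <-] Xy]; by exists la.
Qed.

End Tasep.

Section HLProcess.
Variables (R : realType) (t : R).
Hypothesis ht : 0 < t < 1.
Variables (d : measure_display) (Omega : measurableType d).
Variables (Pr : probability Omega R) (lam : R -> Omega -> intpart).
Hypothesis hlam : hl_process t Pr lam.

Lemma complex_t_neq0 : t%:C != 0.
Proof. by rewrite fmorph_eq0 t_neq0. Qed.

Lemma complex_t_not_unity i : (0 < i)%N -> t%:C ^+ i != 1.
Proof. by move=> i0; rewrite -rmorphXn fmorph_eq1 t_not_unity. Qed.

Lemma principal_spec_weight la : is_hl_P t%:C la (hl_P t%:C la) ->
  principal_spec t%:C (hl_P t%:C la) = (principal_weight t la)%:C.
Proof.
move=> P; rewrite (principal_spec_hl_P complex_t_neq0 complex_t_not_unity P).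
by rewrite fmorph_div rmorphXn rmorph_hl_b.
Qed.

Lemma trivIset_lam tau : trivIset setT (fun la => [set w | lam tau w = la]).
Proof. by move=> x y _ _ [w /= [-> ->]]. Qed.

(** Time 1 - t is where p_1 is specialized to 1 and the normalization is e. If P_la or its skew
    functions do not exist, the default values make the probability 0. *)
Lemma lam_one_time la : Pr [set w | lam (1 - t) w = la] =
    (expR (-1) * descent_series t (nth 0%N la 0) 1 [::] la * principal_weight t la)%:E
    /\ is_hl_P t%:C la (hl_P t%:C la) /\ is_skew_Q t%:C la (hl_Qskew t%:C la)
  \/ Pr [set w | lam (1 - t) w = la] = 0%E.
Proof.
have [t0 t1] := andP ht.
have := @hl_marginals _ _ _ _ _ _ hlam 1%N (fun j => if j == 0%N then 0 else 1 - t)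
  (fun j => if j == 0%N then empty_partition else la) isT erefl erefl.
have -> : [set w | forall j, (0 < j <= 1)%N ->
    lam (if j == 0%N then 0 else 1 - t) w = (if j == 0%N then empty_partition else la)] =
  [set w | lam (1 - t) w = la].
  by apply/seteqP; split=> w /= => [H|H [|[|]] //]; exact: (H 1%N isT).
have mla : measurable [set w | lam (1 - t) w = la].
  by apply: (hl_measurable hlam); rewrite subr_ge0 ltW.
have fin : Pr [set w | lam (1 - t) w = la] \is a fin_num by exact: fin_num_measure.
rewrite /= big_nat1 /= subr0 divff; last by rewrite subr_eq0 gt_eqF.
move=> /(_ _)/wrap[|E]; first by case=> // _; rewrite subr_ge0 ltW.
have zero : fine (Pr [set w | lam (1 - t) w = la]) = 0 ->
    Pr [set w | lam (1 - t) w = la] = 0%E by move=> f0; rewrite -(fineK fin) f0.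
have inj0 : (fine (Pr [set w | lam (1 - t) w = la]))%:C = 0 ->
    Pr [set w | lam (1 - t) w = la] = 0%E.
  by move/eqP; rewrite fmorph_eq0 => /eqP.
have [P|P0] := hl_P_spec t%:C la; last first.
  right; apply: inj0; rewrite E P0 /principal_spec specializeE symfun_eval0.
  by rewrite mulr0 mul0r.
have [sk|sk0] := hl_Qskew_spec t%:C la; last first.
  by right; apply: inj0; rewrite E sk0 /plancherel_spec specializeE symfun_eval0 !mul0r.
left; split=> //; rewrite -[LHS](fineK fin); congr (_%:E).
apply: (fmorph_inj (real_complex R)); rewrite [LHS]E (principal_spec_weight P).
have pla := partsP la.
set M := nth 0%N la 0.
have DE : descent_series t%:C M 1 [::] la = (descent_series t M 1 [::] la)%:C.
  by rewrite rmorph_descent_series rmorph1.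
have D0 := descent_series_gt0 (ltW t0) t1 pla (is_part_all pla) (@ltr01 R).
have := @skew_Q_empty_neq0 _ _ complex_t_neq0 complex_t_not_unity M la _ 1 P sk (is_part_all pla).
rewrite DE fmorph_eq0 (gt_eqF D0) mulr1 rmorphB rmorph1 => -> //.
rewrite expRN -fmorphV -!rmorphM; congr (_%:C).
by rewrite mulrC mulrA.
Qed.

End HLProcess.

(** * Existence of the Hall-Littlewood and skew functions *)

Section Existence.
Variables (R : realType) (t : R).
Hypothesis ht : 0 < t < 1.
Variables (d d' : measure_display).
Variables (Omega : measurableType d) (Omega' : measurableType d').
Variables (Pr : probability Omega R) (Pr' : probability Omega' R).
Variables (lam : R -> Omega' -> intpart) (X : R -> Omega -> nat -> int).
Hypothesis hlam : hl_process t Pr' lam.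
Hypothesis hX : slowed_tTASEP t Pr X.

Lemma principal_weight_nil : principal_weight t [::] = 1.
Proof. by rewrite /principal_weight /hl_b big_nil divr1. Qed.

(* At time 1, the probabilities of [lam] are those of t-TASEP, except that they
   vanish where P or Q_{la/.} fails to exist; as both sum to 1 and those of t-TASEP
   are positive, there is no such partition. *)
Lemma hl_exists la :
  is_hl_P t%:C la (hl_P t%:C la) /\ is_skew_Q t%:C la (hl_Qskew t%:C la).
Proof.
have [t0 t1] := andP ht; have [p hp markov] := tasep_markov hX.
have pE (nu : intpart) : Pr [set w | X 1 w = particles nu] =
    (expR (-1) * descent_series t (nth 0%N nu 0) 1 [::] nu * principal_weight t nu)%:E.
  rewrite (tasep_one_time hX markov ler01 (particles_packed_states nu)).
  rewrite -particles_empty (transition_value ht hp empty_partition ler01 (is_part_all (partsP nu))).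
  by rewrite principal_weight_nil divr1.
have m1 : 0 <= 1 - t by rewrite subr_ge0 ltW.
have le nu : (Pr' [set w | lam (1 - t) w = nu] <= Pr [set w | X 1 w = particles nu])%E.
  by case: (lam_one_time ht hlam nu) => [[-> _]|->]; rewrite ?measure_ge0 // pE.
have lamT : Pr' (\bigcup_nu [set w | lam (1 - t) w = nu]) = 1%E.
  rewrite -[RHS](probability_setT Pr'); congr (Pr' _).
  by apply/seteqP; split=> // w _; exists (lam (1 - t) w).
have := countable_law_le (fun nu : intpart => measurable_state hX (particles nu) ler01)
  (@trivIset_particles _ _ _ X 1) (tasep_packed hX hp markov ler01)
  (fun nu => hl_measurable hlam nu m1) (@trivIset_lam _ _ _ lam (1 - t)) lamT le la.
case: (lam_one_time ht hlam la) => [[_ //]|->].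
rewrite pE => /esym/eqP; rewrite eqe gt_eqF // mulr_gt0 ?principal_weight_gt0 //.
rewrite mulr_gt0 ?expR_gt0 // descent_series_gt0 ?ltW //; first exact: partsP.
exact: is_part_all (partsP la).
Qed.

End Existence.

(** * Reduction to increasing times *)

Section SortedTimes.
Variables (R : realType) (n : nat) (tau : 'I_n -> R) (f : 'I_n -> intpart).
Hypothesis tau_ge0 : forall i, 0 <= tau i.

Definition time_order : seq 'I_n := sort (relpre tau <=%R) (enum 'I_n).

(** Shifted by one place, since index 0 is reserved for the initial time. *)
Definition sorted_time (j : nat) : R :=
  if j is j'.+1 then nth 0 (map tau time_order) j' else 0.

Definition sorted_part (j : nat) : intpart :=
  if j is j'.+1 then nth empty_partition (map f time_order) j'
  else empty_partition.

Lemma size_time_order : size time_order = n.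
Proof. by rewrite size_sort size_enum_ord. Qed.

Lemma sorted_time_le j : (j < n)%N -> sorted_time j <= sorted_time j.+1.
Proof.
case: j => [|j] jn /=.
  by rewrite (nth_map (Ordinal jn)) ?size_time_order.
have : sorted <=%R (map tau time_order).
  by rewrite sorted_map; apply: sort_sorted => i k /=; exact: le_total.
by move/(sortedP 0); apply; rewrite size_map size_time_order.
Qed.

Lemma sorted_timeP (P : R -> intpart -> Prop) :
  (forall i, P (tau i) (f i)) <->
  (forall j, (0 < j <= n)%N -> P (sorted_time j) (sorted_part j)).
Proof.
split=> [H [//|j] /= jn|H i].
  by rewrite !(nth_map (Ordinal jn)) ?size_time_order.
have ii : i \in time_order by rewrite mem_sort mem_enum.
have := H (index i time_order).+1; rewrite /= -[X in (_ < X)%N]size_time_order index_mem ii.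
by rewrite !(nth_map i) ?index_mem // nth_index // => /(_ isT).
Qed.

End SortedTimes.

Lemma telescoped_transition (R : realType) (T : nat -> R) (D g : nat -> R) n :
  (forall j, g j != 0) ->
  \prod_(j < n) (expR (- (T j.+1 - T j)) * D j * (g j.+1 / g j)) =
  (\prod_(j < n) D j) * (g n / g 0%N) * expR (T 0%N - T n).
Proof.
move=> g0; elim: n => [|n IH].
  by rewrite !big_ord0 subrr expR0 divff // !mulr1.
rewrite !big_ord_recr /= IH.
have -> : T 0%N - T n.+1 = (T 0%N - T n) + (- (T n.+1 - T n)) by ring.
rewrite [in RHS]expRD; move: (expR (T 0%N - T n)) (expR (- (T n.+1 - T n))) => a b.
by field; rewrite g0 g0.
Qed.

(** * Joint laws *)

Section FiniteDimensionalLaws.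
Variables (R : realType) (t : R).
Hypothesis ht : 0 < t < 1.
Variables (d d' : measure_display).
Variables (Omega : measurableType d) (Omega' : measurableType d').
Variables (Pr : probability Omega R) (Pr' : probability Omega' R).
Variables (lam : R -> Omega' -> intpart) (X : R -> Omega -> nat -> int).
Hypothesis hlam : hl_process t Pr' lam.
Hypothesis hX : slowed_tTASEP t Pr X.

Lemma plancherel_Qskew (la mu : intpart) s :
  plancherel_spec t%:C ((1 - t) * s)%:C (hl_Qskew t%:C la mu) =
  (descent_series t (nth 0%N la 0) s mu la)%:C.
Proof.
have Hex nu := hl_exists ht hlam hX nu.
rewrite rmorph_descent_series rmorphM rmorphB rmorph1.
apply: (skew_Q_coef (complex_t_neq0 ht) (complex_t_not_unity ht)).
- by move=> nu; case: (Hex nu).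
- by case: (Hex la).
- exact: is_part_all (partsP la).
Qed.

(** Both sides are products over successive sorted times. On the t-TASEP side the principal weights
    telescope to that of the last partition, and the exponentials to exp(-T n). *)
Lemma multitime_point (n : nat) (tau : 'I_n -> R) (f : 'I_n -> intpart) :
  (forall i, 0 <= tau i) ->
  Pr' [set w | forall i, lam ((1 - t) * tau i) w = f i] =
  Pr [set w | forall i, X (tau i) w = particles (f i)].
Proof.
move=> tau0; have [t0 t1] := andP ht; have m1 : 0 <= 1 - t by rewrite subr_ge0 ltW.
(* [hl_marginals] is stated for at least one time. *)
have [n0|n_gt0] := posnP n.
  have -> : [set w | forall i, lam ((1 - t) * tau i) w = f i] = setT.
    by apply/seteqP; split=> // w _ i; have := ltn_ord i; rewrite {2}n0.
  have -> : [set w | forall i, X (tau i) w = particles (f i)] = setT.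
    by apply/seteqP; split=> // w _ i; have := ltn_ord i; rewrite {2}n0.
  by rewrite !probability_setT.
have [p hp markov] := tasep_markov hX.
pose T := sorted_time tau; pose L := sorted_part tau f.
have T_le j : (j < n)%N -> T j <= T j.+1 by exact: sorted_time_le.
pose D j := descent_series t (nth 0%N (L j.+1) 0) (T j.+1 - T j) (L j) (L j.+1).
pose g j := principal_weight t (L j).
have g0 j : g j != 0 by rewrite gt_eqF // principal_weight_gt0.
have XE : Pr [set w | forall i, X (tau i) w = particles (f i)] =
    ((\prod_(j < n) D j) * g n * expR (- T n))%:E.
  have mE : measurable [set w | forall i, X (tau i) w = particles (f i)].
    by apply: measurable_forall_ord => i; exact: (measurable_state hX).
  (* [markov] also prescribes the state at time 0, which is packed with probability 1. *)
  rewrite -(probability_setI1 mE (measurable_state hX packed (lexx 0)) (tasep_initial markov)).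
  have := markov n T (fun j => particles (L j)) erefl T_le
    (fun j _ => particles_packed_states (L j)).
  rewrite [particles (L 0%N)]particles_empty (eqxx packed) mul1r => markovn.
  transitivity (\prod_(j < n) p (T j.+1 - T j) (particles (L j)) (particles (L j.+1)))%:E.
    rewrite -markovn; congr (Pr _).
    have := sorted_timeP tau f; rewrite -/T -/L => sE.
    apply/seteqP; split=> w /=.
      move=> [H X0] [|j] jn; first by rewrite [particles (L 0%N)]particles_empty.
      by move: {H}((sE (fun s la => X s w = particles la)).1 H); apply.
    move=> H; split; last by rewrite -particles_empty; exact: (H 0%N).
    by apply/(sE (fun s la => X s w = particles la)) => j /andP[_ jn]; exact: H.
  have g00 : g 0%N = 1 := principal_weight_nil t.
  have T0 : T 0%N = 0 by [].
  congr (_%:E); have := telescoped_transition T D n g0.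
  rewrite g00 divr1 T0 sub0r => <-; apply: eq_bigr => j _.
  rewrite (transition_value ht hp _ _ (is_part_all (partsP (L j.+1)))) //.
  by rewrite subr_ge0 T_le.
rewrite XE.
have mE' : measurable [set w | forall i, lam ((1 - t) * tau i) w = f i].
  by apply: measurable_forall_ord => i; apply: (hl_measurable hlam); rewrite mulr_ge0.
have fin : Pr' [set w | forall i, lam ((1 - t) * tau i) w = f i] \is a fin_num.
  exact: fin_num_measure.
rewrite -(fineK fin); congr (_%:E); apply: (fmorph_inj (real_complex R)).
have := @hl_marginals _ _ _ _ _ _ hlam n (fun j => (1 - t) * T j) L n_gt0 (mulr0 _) erefl.
have -> : [set w | forall j, (0 < j <= n)%N -> lam ((1 - t) * T j) w = L j] =
    [set w | forall i, lam ((1 - t) * tau i) w = f i].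
  apply/seteqP; split=> w /= H; first exact/(sorted_timeP tau f (fun s la => lam ((1 - t) * s) w = la)).
  exact: (sorted_timeP tau f (fun s la => lam ((1 - t) * s) w = la)).1.
move=> /(_ _)/wrap[j jn|E]; first by rewrite ler_wpM2l // T_le.
rewrite [LHS]E principal_spec_weight //; last by case: (hl_exists ht hlam hX (L n)).
have -> : \prod_(1 <= j < n.+1) plancherel_spec t%:C ((1 - t) * T j - (1 - t) * T j.-1)%:C
    (hl_Qskew t%:C (L j) (L j.-1)) = (\prod_(j < n) D j)%:C.
  rewrite big_add1 big_mkord rmorph_prod; apply: eq_bigr => j _.
  by rewrite /= -mulrBr plancherel_Qskew.
have -> : (1 - t) * T n / (1 - t) = T n.
  by rewrite mulrAC divff ?mul1r // subr_eq0 gt_eqF.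
by rewrite expRN -fmorphV -!rmorphM.
Qed.

End FiniteDimensionalLaws.

(** Almost surely each [X (tau i)] comes from a partition, so both laws live on the countable set of
    tuples of partitions, where [multitime_point] compares them atom by atom. *)
Theorem theorem3p3 (R : realType) (t : R) (ht : 0 < t < 1)
  (d d' : measure_display)
  (Omega : measurableType d) (Omega' : measurableType d')
  (Pr : probability Omega R) (Pr' : probability Omega' R)
  (lam : R -> Omega' -> intpart) (X : R -> Omega -> nat -> int)
  (hlam : hl_process t Pr' lam) (hX : slowed_tTASEP t Pr X) :
  eq_in_multitime_dist Pr Pr' X
    (fun tau w k =>
       (conj_part (lam ((1 - t) * tau) w) k.+1)%:Z - k.+1%:Z).
Proof.
move=> n tau tau0 A mA; have [t0 t1] := andP ht.
have m1 : 0 <= 1 - t by rewrite subr_ge0 ltW.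
have mlam (f : {ffun 'I_n -> intpart}) :
    measurable [set w | forall i, lam ((1 - t) * tau i) w = f i].
  by apply: measurable_forall_ord => i; apply: (hl_measurable hlam); rewrite mulr_ge0.
have mX (f : {ffun 'I_n -> intpart}) :
    measurable [set w | forall i, X (tau i) w = particles (f i)].
  by apply: measurable_forall_ord => i; exact: (measurable_state hX).
have [p hp markov] := tasep_markov hX.
change (Pr [set w | A (fun i => X (tau i) w)] =
  Pr' [set w | A (fun i => particles (lam ((1 - t) * tau i) w))]).
refine (@countable_law_eq R d d' Omega Omega' Pr Pr' {ffun 'I_n -> intpart}
  (fun f : {ffun 'I_n -> intpart} => [set w | forall i, X (tau i) w = particles (f i)])
  (fun f : {ffun 'I_n -> intpart} => [set w | forall i, lam ((1 - t) * tau i) w = f i])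
  mX _ _ mlam _ _ [set f : {ffun 'I_n -> intpart} | A (fun i => particles (f i))] _ _ _ _ _ _ _).
- move=> f g _ _ [w /= [wf wg]]; apply/ffunP => i; apply: particles_inj.
  by rewrite -wf -wg.
- have [mB B1] := probability_forall1 (enum 'I_n)
    (B := fun i => \bigcup_(la : intpart) [set w | X (tau i) w = particles la])
    (fun i => countable_bigcup_measurable setT
      (fun la : intpart => measurable_state hX (particles la) (tau0 i)))
    (fun i => tasep_packed hX hp markov (tau0 i)).
  rewrite -[RHS]B1; congr (Pr _); apply/seteqP; split=> w /=.
    by move=> [f _ wf] i _; exists (f i).
  move=> H; have {}H i : exists la : intpart, X (tau i) w = particles la.
    by have [|la _ wla] := H i; [rewrite mem_enum|exists la].
  exists [ffun i => projT1 (cid (H i))] => // i /=; rewrite ffunE.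
  exact: (projT2 (cid (H i))).
- move=> f g _ _ [w /= [wf wg]]; apply/ffunP => i; by rewrite -wf -wg.
- rewrite -[RHS](probability_setT Pr'); congr (Pr' _); apply/seteqP; split=> // w _.
  by exists [ffun i => lam ((1 - t) * tau i) w] => // i /=; rewrite ffunE.
- by move=> f; exact: multitime_point.
- exact: (measurable_multitime (fun i k z => tasep_measurable hX k z (tau0 i)) mA).
- refine (@measurable_multitime R d' Omega'
    (fun s w => particles (lam ((1 - t) * s) w)) n tau _ A mA) => i k z.
  have -> : [set w | particles (lam ((1 - t) * tau i) w) k = z] =
     \bigcup_(la in [set la : intpart | particles la k = z]) [set w | lam ((1 - t) * tau i) w = la].
    apply/seteqP; split=> w /=; first by move=> H; exists (lam ((1 - t) * tau i) w).
    by move=> [la H ->].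
  apply: countable_bigcup_measurable => la; apply: (hl_measurable hlam).
  by rewrite mulr_ge0.
- move=> f w wf /=; suff -> : (fun i => X (tau i) w) = (fun i => particles (f i)) by [].
  by apply/funext => i; exact: wf.
- move=> f w wf /=.
  suff -> : (fun i => particles (f i)) = (fun i => particles (lam ((1 - t) * tau i) w)) by [].
  by apply/funext => i; rewrite wf.
Qed.
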